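(* There is a constant $C>0$, depending only on $\Omega$ and on the constant in the inverse inequality (in particular independent of $\Delta t$, $h$, $\nu$, $N$ and the data), such that the following holds. Let $N>2$, and let $(u_{j,h}^{n+1},p_{j,h}^{n+1})\in X_h\times Q_h$, $j=1,\dots,J$, $n=2,\dots,N-1$, be a solution of the fully discrete (En-BlendedBDF) method with given starting values $u_{j,h}^0,u_{j,h}^1,u_{j,h}^2\in X_h$. Suppose that the time step conditions $$C\,\frac{\Delta t}{\nu h}\,\Vert \nabla u_{j,h}^{\prime n}\Vert^2\le 1,\qquad j=1,\dots,J,$$ hold for $n=2,\dots,N-1$. Then for each $j=1,\dots,J$, $$\begin{aligned} &\frac{1}{12}\Vert u_{j,h}^{N}\Vert^{2}+\frac{1}{12}\Vert 3u_{j,h}^{N}-u_{j,h}^{N-1}\Vert^{2}+\frac{1}{12}\Vert 3u_{j,h}^{N}-3u_{j,h}^{N-1}+u_{j,h}^{N-2}\Vert^2\\ &\quad+\frac{1}{24}\sum_{n=2}^{N-1}\Vert u_{j,h}^{n+1}-3u_{j,h}^{n}+3u_{j,h}^{n-1}-u_{j,h}^{n-2}\Vert^{2}+\frac{\Delta t}{4}\sum_{n=2}^{N-1}\nu\Vert \nabla u_{j,h}^{n+1}\Vert^{2}\\ &\le\sum_{n=2}^{N-1}\frac{\Delta t}{\nu}\Vert f_{j}^{n+1}\Vert_{-1}^{2}+\frac{1}{12}\Vert u_{j,h}^{2}\Vert^{2}+\frac{1}{12}\Vert 3u_{j,h}^{2}-u_{j,h}^{1}\Vert^{2}+\frac{1}{12}\Vert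 3u_{j,h}^{2}-3u_{j,h}^{1}+u_{j,h}^{0}\Vert^2 . \end{aligned}$$
   Context: $\Omega\subset\mathbb{R}^d$, $d=2$ or $3$, is an open, regular (bounded) domain; $\nu>0$ is the viscosity; $J\ge 1$ is the number of ensemble members; $\Delta t>0$ is the time step, $t^n=n\Delta t$. $\Vert\cdot\Vert$ and $(\cdot,\cdot)$ are the $L^2(\Omega)$ norm and inner product. $X=H_0^1(\Omega)^d$, $Q=L_0^2(\Omega)$ (zero-mean $L^2$ functions). $\Vert f\Vert_{-1}=\sup_{0\ne v\in X}(f,v)/\Vert\nabla v\Vert$. The body forces $f_j$ are given and $f_j^{n}=f_j(t^{n})$. Skew-symmetric trilinear form: $b^*(u,v,w)=\frac12(u\cdot\nabla v,w)-\frac12(u\cdot\nabla w,v)$ for $u,v,w\in X$. $X_h\subset X$ and $Q_h\subset Q$ are conforming velocity/pressure finite element spaces on an edge-to-edge triangulation ($d=2$) or tetrahedralization ($d=3$) of $\Omega$ with maximum element diameter $h$, satisfying the discrete inf-sup ($LBB$) condition and the inverse inequality $h\Vert\nabla v_h\Vert\le C_{inv}\Vert v_h\Vert$ for all $v_h\in X_h$. Ensemble mean and fluctuation: $$\langle u_h\rangle^n=\frac1J\sum_{j=1}^J(3u_{j,h}^n-3u_{j,h}^{n-1}+u_{j,h}^{n-2}),\qquad u_{j,h}^{\prime n}=3u_{j,h}^n-3u_{j,h}^{n-1}+u_{j,h}^{n-2}-\langle u_h\rangle^n.$$ Fully discrete (En-BlendedBDF) method: given $u_{j,h}^{n-2},u_{j,h}^{n-1},u_{j,h}^n\in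 X_h$ for $j=1,\dots,J$, find $u_{j,h}^{n+1}\in X_h$, $p_{j,h}^{n+1}\in Q_h$ such that for all $v_h\in X_h$, $q_h\in Q_h$, $$\begin{aligned} &\Big(\tfrac{10u_{j,h}^{n+1}-15u_{j,h}^{n}+6u_{j,h}^{n-1}-u_{j,h}^{n-2}}{6\Delta t},v_h\Big)+b^*(\langle u_h\rangle^n,u_{j,h}^{n+1},v_h)+b^*(u_{j,h}^{\prime n},3u_{j,h}^n-3u_{j,h}^{n-1}+u_{j,h}^{n-2},v_h)\\ &\quad-(p_{j,h}^{n+1},\nabla\cdot v_h)+\nu(\nabla u_{j,h}^{n+1},\nabla v_h)=(f_j^{n+1},v_h),\qquad (\nabla\cdot u_{j,h}^{n+1},q_h)=0. \end{aligned}$$ *)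

(* Defs.v *)
From HB Require Import structures.
From mathcomp Require Import all_boot all_order all_algebra.
From mathcomp Require Import all_classical all_reals all_analysis.

Set Implicit Arguments.
Unset Strict Implicit.
Unset Printing Implicit Defensive.

Import Order.TTheory GRing.Theory Num.Theory.
Import numFieldNormedType.Exports.

Local Open Scope classical_set_scope.
Local Open Scope ring_scope.

(* The library has no Lebesgue measure on R^n, so it is built here on 'rV[R]_n:
   the sigma-algebra is the one generated by the coordinates (it coincides with
   the Borel sigma-algebra), the measure is the n-fold product of the Lebesgue
   measure on R. *)
Definition measure_rV_display : measure_display. Proof. exact. Qed.

Section measurable_rV.
Context {R : realType} (n : nat).
Let coords : 'I_n -> 'rV[R]_n -> measurableTypeR R := fun i x => x 0 i.
Let rV_set0 : g_sigma_preimage coords set0.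
Proof. exact: sigma_algebra0. Qed.
Let rV_setC A : g_sigma_preimage coords A -> g_sigma_preimage coords (~` A).
Proof. exact: sigma_algebraC. Qed.
Let rV_bigcup (F : _^nat) : (forall i, g_sigma_preimage coords (F i)) ->
  g_sigma_preimage coords (\bigcup_i (F i)).
Proof. exact: sigma_algebra_bigcup. Qed.
HB.instance Definition _ := @isMeasurable.Build measure_rV_display
  'rV[R]_n (g_sigma_preimage coords) rV_set0 rV_setC rV_bigcup.
End measurable_rV.

Definition rV_cons {R : realType} n (p : R * 'rV[R]_n) : 'rV[R]_n.+1 :=
  row_mx p.1%:M p.2.

Lemma measurable_rV_coord {R : realType} n (i : 'I_n) :
  measurable_fun [set: 'rV[R]_n] (fun x => x 0 i : measurableTypeR R).
Proof.
move=> _ B mB; rewrite setTI; apply: sub_sigma_algebra => /=.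
rewrite -bigcup_seq/=; exists i => /=; first by rewrite mem_index_enum.
by exists B => //; rewrite setTI.
Qed.

Lemma measurable_rVP {R : realType} d (T : measurableType d) n
    (f : T -> 'rV[R]_n) :
  (forall i, measurable_fun setT (fun t => f t 0 i : measurableTypeR R)) ->
  measurable_fun setT f.
Proof.
move=> mf _ Y; rewrite setTI; move: Y.
apply: smallest_sub.
  split=> /=.
  - by rewrite preimage_set0.
  - by move=> A mA; rewrite setTD preimage_setC; exact: measurableC.
  - by move=> F mF; rewrite preimage_bigcup; exact: bigcupT_measurable.
case: n => [|n] in f mf *; first by rewrite big_ord0.
rewrite -bigcup_mkord_ord; apply: bigcup_sub => i Ii A [B mB <-].
by rewrite setTI -[X in measurable X]setTI; exact: mf.
Qed.

Lemma measurable_rV_cons {R : realType} n :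
  measurable_fun [set: measurableTypeR R * 'rV[R]_n] (@rV_cons R n).
Proof.
apply: measurable_rVP => i; have [j ->|->] := unliftP ord0 i.
- rewrite [X in measurable_fun _ X](_ : _ =
      (fun x : 'rV[R]_n => x 0 (j : 'I_n) : measurableTypeR R) \o snd); last first.
    apply/funext => p; rewrite (_ : lift ord0 j = rshift 1 (j : 'I_n)).
      exact: row_mxEr.
    exact/val_inj.
  exact: measurableT_comp (measurable_rV_coord j) measurable_snd.
- rewrite [X in measurable_fun _ X](_ : _ = fst); first exact: measurable_fst.
  apply/funext => p; rewrite (_ : ord0 = lshift n (ord0 : 'I_1)).
    by apply: etrans (row_mxEl _ _ _ _) _; rewrite mxE.
  exact/val_inj.
Qed.

Section lebesgue_rV_step.
Context {R : realType} (n : nat).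
Variable mu : {sigma_finite_measure set 'rV[R]_n -> \bar R}.

Definition lebesgue_rV_step : set 'rV[R]_n.+1 -> \bar R :=
  pushforward (@lebesgue_measure R \x mu)%E (@rV_cons R n).

Let step0 : lebesgue_rV_step set0 = 0%E.
Proof. by rewrite /lebesgue_rV_step /pushforward preimage_set0 measure0. Qed.

Let step_ge0 A : (0 <= lebesgue_rV_step A)%E.
Proof. by apply: integral_ge0 => x _; exact: measure_ge0. Qed.

Let step_sigma_additive : semi_sigma_additive lebesgue_rV_step.
Proof.
move=> F mF tF mUF; rewrite /lebesgue_rV_step /pushforward preimage_bigcup.
apply: measure_semi_sigma_additive.
- by move=> k; rewrite -[X in measurable X]setTI; exact: measurable_rV_cons.
- apply/trivIsetP => /= i j _ _ ij; rewrite -preimage_setI.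
  by move/trivIsetP : tF => /(_ _ _ _ _ ij) ->//; rewrite preimage_set0.
- rewrite -preimage_bigcup -[X in measurable X]setTI.
  exact: measurable_rV_cons.
Qed.

HB.instance Definition _ := isMeasure.Build _ _ _ lebesgue_rV_step
  step0 step_ge0 step_sigma_additive.

Let step_sigma_finite : sigma_finite setT lebesgue_rV_step.
Proof.
have /sigma_finiteP[F [TF ndF Foo]] := sigma_finiteT (@lebesgue_measure R).
have /sigma_finiteP[G [TG ndG Goo]] := sigma_finiteT mu.
pose g (x : 'rV[R]_n.+1) : R * 'rV[R]_n :=
  ((x : 'rV_(1 + n)) 0 (lshift n 0), rsubmx (x : 'rV_(1 + n))).
have gK : cancel (@rV_cons R n) g.
  case=> a y; rewrite /g /rV_cons; congr pair; last exact: row_mxKr.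
  by rewrite row_mxEl mxE.
have mg : measurable_fun setT (g : _ -> measurableTypeR R * 'rV[R]_n).
  apply: measurable_fun_pair; first exact: measurable_rV_coord.
  apply: measurable_rVP => i.
  rewrite [X in measurable_fun _ X](_ : _ = (fun x : 'rV[R]_n.+1 =>
    x 0 (rshift 1 i : 'I_n.+1) : measurableTypeR R)).
    exact: measurable_rV_coord.
  by apply/funext => x; rewrite /= mxE.
exists (fun k => g @^-1` (F k `*` G k)).
  rewrite -preimage_bigcup (_ : \bigcup_i _ = setT) ?preimage_setT//.
  rewrite -subTset => -[x y] _.
  have [k _ Fk] : (\bigcup_i F i) x by rewrite -TF.
  have [l _ Gl] : (\bigcup_i G i) y by rewrite -TG.
  exists (maxn k l) => //; split => /=.
  - by move: x Fk; exact/subsetPset/ndF/leq_maxl.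
  - by move: y Gl; exact/subsetPset/ndG/leq_maxr.
move=> k; have [mFk Fkoo] := Foo k; have [mGk Gkoo] := Goo k; split.
  by rewrite -[X in measurable X]setTI; apply: mg => //; exact: measurableX.
rewrite /lebesgue_rV_step /pushforward -comp_preimage.
rewrite (_ : g \o _ = id); last exact/funext.
by rewrite preimage_id product_measure1E// lte_mul_pinfty// ge0_fin_numE.
Qed.

HB.instance Definition _ := Measure_isSigmaFinite.Build _ _ _ lebesgue_rV_step
  step_sigma_finite.

End lebesgue_rV_step.

Fixpoint lebesgue_rV {R : realType} (n : nat) :
    {sigma_finite_measure set 'rV[R]_n -> \bar R} :=
  if n is n'.+1 then lebesgue_rV_step (lebesgue_rV n') else \d_(0 : 'rV[R]_0).

Section domains.
Context {R : realType} (d : nat).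
Implicit Types (x y e : 'rV[R]_d) (Omega A : set 'rV[R]_d).

Definition edot x y : R := \sum_(i < d) x 0 i * y 0 i.

(* The library norm `|x| on 'rV[R]_d is the sup norm. *)
Definition enorm x : R := Num.sqrt (edot x x).

Definition diam A : R := sup [set enorm (z.1 - z.2) | z in A `*` A].

(* Near each boundary point, Omega lies above the graph of a Lipschitz function
   gamma in the direction of a unit vector e; gamma is only evaluated on the
   hyperplane orthogonal to e. *)
Definition lipschitz_boundary Omega : Prop :=
  forall x0, (closure Omega `\` Omega) x0 ->
  exists (e : 'rV[R]_d) (r L : R) (gamma : 'rV[R]_d -> R),
    [/\ enorm e = 1, 0 < r,
        forall y z, `|gamma y - gamma z| <= L * enorm (y - z) &
        forall x, enorm (x - x0) < r ->
          (Omega x <-> gamma (x - edot x e *: e) < edot x e)].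

Definition regular_domain Omega : Prop :=
  [/\ open Omega, connected Omega, Omega !=set0, bounded_set Omega &
      lipschitz_boundary Omega].

End domains.

Section function_spaces.
Context {R : realType} {d : nat} (Omega : set 'rV[R]_d).
Implicit Types (f g q phi : 'rV[R]_d -> R) (u v w : 'rV[R]_d -> 'rV[R]_d).

Definition int_Omega f : R :=
  Rintegral (lebesgue_rV d : set 'rV[R]_d -> \bar R) Omega f.

Definition L2 f : Prop :=
  measurable_fun Omega f /\
  (lebesgue_rV d : set 'rV[R]_d -> \bar R).-integrable Omega
    (fun x => (f x ^+ 2)%:E).

Definition L2m m n (F : 'rV[R]_d -> 'M[R]_(m, n)) : Prop :=
  forall i j, L2 (fun x => F x i j).

Definition ip f g : R := int_Omega (fun x => f x * g x).

Definition ipm m n (F G : 'rV[R]_d -> 'M[R]_(m, n)) : R :=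
  int_Omega (fun x => \sum_(i < m) \sum_(j < n) F x i j * G x i j).

Definition norm f : R := Num.sqrt (ip f f).

Definition normm m n (F : 'rV[R]_d -> 'M[R]_(m, n)) : R := Num.sqrt (ipm F F).

Definition partial (i : 'I_d) f : 'rV[R]_d -> R :=
  fun x => 'D_(delta_mx 0 i) f x.

Definition smooth f : Prop :=
  forall s : seq 'I_d, continuous (foldr partial f s) /\
    forall x i, derivable (foldr partial f s) x (delta_mx 0 i).

Definition test_function phi : Prop :=
  let supp := closure [set x | phi x != 0] in
  [/\ smooth phi, compact supp & supp `<=` Omega].

Definition is_weak_grad u (G : 'rV[R]_d -> 'M[R]_d) : Prop :=
  L2m G /\ forall i j phi, test_function phi ->
    ip (fun x => u x 0 i) (partial j phi) = - ip (fun x => G x i j) phi.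

(* (grad u x) i j is the weak derivative of the i-th component of u with respect
   to the j-th coordinate; as a representative it is only determined almost
   everywhere, and it is a junk value when u is not in H^1. *)
Definition grad u : 'rV[R]_d -> 'M[R]_d := get (is_weak_grad u).

Definition div u : 'rV[R]_d -> R := fun x => \tr (grad u x).

Definition H1 u : Prop := L2m u /\ exists G, is_weak_grad u G.

Definition H1norm u : R := Num.sqrt (normm u ^+ 2 + normm (grad u) ^+ 2).

Definition X : set ('rV[R]_d -> 'rV[R]_d) :=
  [set u | H1 u /\ forall eps : R, 0 < eps ->
    exists phi : 'rV[R]_d -> 'rV[R]_d,
      (forall i, test_function (fun x => phi x 0 i)) /\
      H1norm (u - phi) < eps].

Definition Q : set ('rV[R]_d -> R^o) := [set q | L2 q /\ int_Omega q = 0].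

(* Elements of X are representatives: [normm v != 0] says that v is nonzero as an
   element of L^2. *)
Definition dual_norm (f : 'rV[R]_d -> 'rV[R]_d) : R :=
  sup [set ipm f v / normm (grad v) | v in X `&` [set v | normm v != 0]].

Definition convect u v : 'rV[R]_d -> 'rV[R]_d :=
  fun x => u x *m (grad v x)^T.

Definition bstar u v w : R :=
  2^-1 * ipm (convect u v) w - 2^-1 * ipm (convect u w) v.

End function_spaces.

Section finite_elements.
Context {R : realType} {d : nat} (Omega : set 'rV[R]_d).

(* A simplex is given by its d+1 vertices, the rows of V; [face V S] is the
   closed face spanned by the vertices in S (empty when S is empty). *)
Definition face (V : 'M[R]_(d.+1, d)) (S : set 'I_d.+1) : set 'rV[R]_d :=
  [set x | exists a : 'rV[R]_d.+1,
    [/\ forall i, 0 <= a 0 i, forall i, ~ S i -> a 0 i = 0,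
        \sum_i a 0 i = 1 & x = a *m V]].

Definition simplex (V : 'M[R]_(d.+1, d)) : set 'rV[R]_d := face V setT.

Definition affinely_independent (V : 'M[R]_(d.+1, d)) : Prop :=
  forall a : 'rV[R]_d.+1, \sum_i a 0 i = 0 -> a *m V = 0 -> a = 0.

Definition triangulation M (T : 'I_M -> 'M[R]_(d.+1, d)) : Prop :=
  [/\ forall k, affinely_independent (T k),
      \bigcup_k simplex (T k) = closure Omega &
      forall k l, k != l -> exists S S' : set 'I_d.+1,
        [/\ S <> setT, S' <> setT,
            simplex (T k) `&` simplex (T l) = face (T k) S &
            face (T k) S = face (T l) S']].

Definition mesh_size M (T : 'I_M -> 'M[R]_(d.+1, d)) : R :=
  \big[Num.max/0]_(k < M) diam (simplex (T k)).

Definition polynomial_on (A : set 'rV[R]_d) (f : 'rV[R]_d -> R) : Prop :=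
  exists (r : nat) (c : {ffun 'I_d -> 'I_r} -> R), forall x, A x ->
    f x = \sum_(a : {ffun 'I_d -> 'I_r}) c a * \prod_(i < d) x 0 i ^+ a i.

Definition fin_dim_subspace (V : lmodType R) (S : set V) : Prop :=
  exists (m : nat) (e : 'I_m -> V),
    S = [set v | exists c : 'I_m -> R, v = \sum_(i < m) c i *: e i].

(* Piecewise polynomials on the interiors of the elements: no condition is put on
   the interfaces, which are null sets; conformity is the inclusion in X, in Q. *)
Definition velocity_fe_space M (T : 'I_M -> 'M[R]_(d.+1, d))
    (Xh : set ('rV[R]_d -> 'rV[R]_d)) : Prop :=
  [/\ fin_dim_subspace Xh, Xh `<=` X Omega &
      forall v, Xh v -> forall k i,
        polynomial_on (simplex (T k))° (fun x => v x 0 i)].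

Definition pressure_fe_space M (T : 'I_M -> 'M[R]_(d.+1, d))
    (Qh : set ('rV[R]_d -> R^o)) : Prop :=
  [/\ fin_dim_subspace Qh, Qh `<=` Q Omega &
      forall q, Qh q -> forall k, polynomial_on (simplex (T k))° q].

Definition inf_sup (beta : R) (Xh : set ('rV[R]_d -> 'rV[R]_d))
    (Qh : set ('rV[R]_d -> R^o)) : Prop :=
  forall q, Qh q -> beta * norm Omega q <=
    sup [set ip Omega q (div Omega v) / normm Omega (grad Omega v) |
         v in Xh `&` [set v | normm Omega v != 0]].

Definition inverse_inequality (h Cinv : R)
    (Xh : set ('rV[R]_d -> 'rV[R]_d)) : Prop :=
  forall v, Xh v -> h * normm Omega (grad Omega v) <= Cinv * normm Omega v.

End finite_elements.

Section method.
Context {R : realType} {d : nat} (Omega : set 'rV[R]_d).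
Context (J : nat).
Local Notation field := ('rV[R]_d -> 'rV[R]_d).

Definition extrap (v : nat -> field) (n : nat) : field :=
  3 *: v n - 3 *: v n.-1 + v n.-2.

Definition ens_mean (u : 'I_J -> nat -> field) (n : nat) : field :=
  J%:R^-1 *: \sum_(j < J) extrap (u j) n.

Definition fluct (u : 'I_J -> nat -> field) (j : 'I_J) (n : nat) : field :=
  extrap (u j) n - ens_mean u n.

Definition en_blended_bdf (dt nu : R) (f : 'I_J -> R -> field)
    (Xh : set field) (Qh : set ('rV[R]_d -> R^o))
    (u : 'I_J -> nat -> field) (p : 'I_J -> nat -> 'rV[R]_d -> R^o)
    (j : 'I_J) (n : nat) : Prop :=
  [/\ Xh (u j n.+1), Qh (p j n.+1),
      forall v, Xh v ->
        ipm Omega ((6 * dt)^-1 *: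
          (10 *: u j n.+1 - 15 *: u j n + 6 *: u j n.-1 - u j n.-2)) v
        + bstar Omega (ens_mean u n) (u j n.+1) v
        + bstar Omega (fluct u j n) (extrap (u j) n) v
        - ip Omega (p j n.+1) (div Omega v)
        + nu * ipm Omega (grad Omega (u j n.+1)) (grad Omega v)
        = ipm Omega (f j (n.+1%:R * dt)) v &
      forall q, Qh q -> ip Omega (div Omega (u j n.+1)) q = 0].

End method.

(* Main.v *)
(** Testing the scheme with u^{n+1}, the BDF quotient is an energy difference plus
    |delta|^2 / 12, where delta = u^{n+1} - 3 u^n + 3 u^{n-1} - u^{n-2}, and the only
    nonlinear term left is b*(u', u^{n+1} - delta, u^{n+1}).  By skew-symmetry it
    equals (u' . grad u^{n+1}, delta) + 1/2 (div u' u^{n+1}, delta), which is at most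
    K h^(-1/2) |grad u'| |grad u^{n+1}| |delta| by the Sobolev embedding of H^1_0 in
    L^6, interpolation and the inverse inequality; the time step condition absorbs it
    into |delta|^2 / 24 and the viscous term.

    The embedding is proved for test functions by slicing and extended to H^1_0 by
    truncation.  Uniqueness of weak gradients is never needed: the weak gradient of u
    and the gradients of approximating test functions differ by a small function plus
    one orthogonal to all test functions, hence to the L^2-closure of these, which
    contains every product of two functions of H^1_0. *)

Require Import Defs.
From HB Require Import structures.
From mathcomp Require Import all_boot all_order all_algebra.
From mathcomp Require Import all_classical all_reals all_analysis.
From mathcomp Require Import measurable_realfun ring lra.

Set Implicit Arguments.
Unset Strict Implicit.
Unset Printing Implicit Defensive.

Import Order.TTheory GRing.Theory Num.Theory.
Import numFieldNormedType.Exports.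
Local Open Scope classical_set_scope.
Local Open Scope ring_scope.

(** * Lebesgue measure on R^n *)

(** Two things force the derivative off delta. On delta, the inverse inequality would cost a full
    power of 1/h, whereas an undifferentiated delta, measured in L^3 between L^2 and L^6, costs only
    h^(-1/2), which is what the time step condition pays for. Moreover [grad] picks some weak
    gradient, so that of u^{n+1} - delta cannot be expanded; skew-symmetry removes it altogether.
    The price is the term with div u', as u' need not be divergence free.

    The budget: half of |delta|^2 / 12 absorbs the nonlinear term; of the viscous term a quarter
    goes to the force, a half to the nonlinear term, a quarter is left.

    [get], [sup] and division are total, so their default values must be excluded: by the existence
    of a weak gradient before [grad] is used, by a Poincare inequality making the supremum in
    [dual_norm] finite, and by a positive mesh size. Interpolation is stated in integer powers (4,
    6, 12) to avoid roots, and of the approximations only L^2 convergence with bounded L^6 norms is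
    used. *)

Lemma ler_mx_coord {R : realType} m n (x : 'M[R]_(m, n)) i j : `|x i j| <= `|x|.
Proof.
by rewrite [leRHS]/Num.Def.normr /= mx_normrE; apply/bigmax_geP; right => /=; exists (i, j).
Qed.

Lemma ler_mx_norm {R : realType} m n (x : 'M[R]_(m, n)) M : 0 <= M ->
  (forall i j, `|x i j| <= M) -> `|x| <= M.
Proof.
by move=> M0 H; rewrite [leLHS]/Num.Def.normr /= mx_normrE; apply/bigmax_leP; split=> // -[].
Qed.

Section measurability.
Context {R : realType} {n : nat}.

Lemma measurable_ball_rV (c : 'rV[R]_n) (r : R) : measurable (ball c r).
Proof.
have [r0|r0] := ltP 0 r; last first.
  rewrite (_ : ball c r = set0) //; apply/seteqP; split => x //= [].
  by rewrite ltNge r0.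
rewrite (_ : ball c r = \bigcap_(i in [set: 'I_n]) ((fun x : 'rV[R]_n => x 0 i) @^-1` (ball (c 0 i) r))).
  apply: fin_bigcap_measurable => [|i _]; first exact: finite_finset.
  rewrite -[X in measurable X]setTI.
  apply: (@measurable_rV_coord R n i) => //; by apply: open_measurable; apply: ball_open.
apply/seteqP; split => x /=.
  by move=> [_ H] i _; exact: H.
move=> H; split => // i j; rewrite (ord1 i); exact: H.
Qed.

(** The sigma-algebra is generated by coordinates, not by open sets, so second countability is
    needed: an open set is the countable union of the balls with rational centre and radius that it
    contains. *)
Lemma open_measurable_rV (A : set 'rV[R]_n) : open A -> measurable A.
Proof.
move=> oA.
pose c (k : 'rV[rat]_n * rat) : 'rV[R]_n := map_mx ratr k.1.
pose r (k : 'rV[rat]_n * rat) : R := ratr k.2.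
pose B k := if `[< ball (c k) (r k) `<=` A >] then ball (c k) (r k) else set0.
rewrite (_ : A = \bigcup_k B k).
  apply: countable_bigcupT_measurable => [|k]; first exact: countableP.
  by rewrite /B; case: ifP => // _; exact: measurable_ball_rV.
apply/seteqP; split => x; last first.
  by move=> [k _]; rewrite /B; case: asboolP => // sA /sA.
move=> Ax; have /nbhs_ballP[e /= e0 eA] : nbhs x A by exact: open_nbhs_nbhs.
(* With a radius [q] below [e / 2] and a rational centre within [q] of [x], the ball contains [x]
   and stays inside the ball of radius [e] about [x]. *)
have [q qe] : exists q : rat, 0 < (ratr q : R) < e / 2.
  have [q] := rat_in_itvoo (ltac:(lra) : (0:R) < e / 2).
  by rewrite in_itv /=; exists q.
have /andP[q0 qe2] := qe.
have [p pP] : exists p : 'I_n -> rat, forall i, `|ratr (p i) - x 0 i| < ratr q.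
  suff H i : exists s : rat, `|ratr s - x 0 i| < ratr q.
    by exists (fun i => sval (cid (H i))) => i; case: cid.
  have [s] := rat_in_itvoo (ltac:(lra) : x 0 i < x 0 i + ratr q).
  rewrite in_itv /= => /andP[s1 s2]; exists s; rewrite ltr_norml; lra.
have cx i j : (c (\row_i p i, q)) i j = ratr (p j) by rewrite /c !mxE.
exists (\row_i p i, q) => //; rewrite /B; case: asboolP => [_|[]].
  split => // i j; rewrite cx (ord1 i) /ball/=; exact: pP.
move=> y [_ H]; apply: eA; split => // i j.
have := H i j; have := pP j; rewrite cx (ord1 i) /ball/= /r /= => h1 h2.
rewrite (_ : x 0 j - y 0 j = - (ratr (p j) - x 0 j) + (ratr (p j) - y 0 j)); last by ring.
by apply: (le_lt_trans (ler_normD _ _)); rewrite normrN; lra.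
Qed.

Lemma continuous_measurable_rV (f : 'rV[R]_n -> R) :
  continuous f -> measurable_fun setT (f : _ -> measurableTypeR R).
Proof.
move=> /continuousP cf; apply: (measurability _ (RGenOpens.measurableE R)).
move=> _ [_ [a [b ->] <-]]; rewrite setTI.
by apply: open_measurable_rV; apply: cf; exact: interval_open.
Qed.

End measurability.

(** * Splitting off the first coordinate of a row vector *)

Section rV_cons.
Context {R : realType} {n : nat}.
Implicit Types (a b : R) (x y : 'rV[R]_n).

Lemma rV_cons0 a y : rV_cons (a, y) 0 ord0 = a.
Proof.
rewrite (_ : ord0 = lshift n (ord0 : 'I_1)); last exact/val_inj.
by apply: etrans (row_mxEl _ _ _ _) _; rewrite mxE.
Qed.

Lemma rV_consS a y (j : 'I_n) : rV_cons (a, y) 0 (lift ord0 j) = y 0 j.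
Proof.
rewrite (_ : lift ord0 j = rshift 1 j); last exact/val_inj.
exact: row_mxEr.
Qed.

Lemma rV_consD a b x y :
  rV_cons (a + b, x + y) = rV_cons (a, x) + rV_cons (b, y).
Proof.
apply/rowP => i; rewrite [RHS]mxE; have [j ->|->] := unliftP ord0 i.
  by rewrite !rV_consS mxE.
by rewrite !rV_cons0.
Qed.

Lemma rV_consZ b a y : rV_cons (b * a, b *: y) = b *: rV_cons (a, y).
Proof.
apply/rowP => i; rewrite [RHS]mxE; have [j ->|->] := unliftP ord0 i.
  by rewrite !rV_consS mxE.
by rewrite !rV_cons0.
Qed.

Lemma rV_cons_delta0 : rV_cons (1, 0 : 'rV[R]_n) = delta_mx 0 ord0.
Proof.
apply/rowP => i; rewrite [RHS]mxE; have [j ->|->] := unliftP ord0 i.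
  by rewrite !rV_consS mxE.
by rewrite !rV_cons0 !eqxx.
Qed.

Lemma rV_cons_deltaS (j : 'I_n) :
  rV_cons (0, delta_mx 0 j) = delta_mx 0 (lift ord0 j) :> 'rV[R]_n.+1.
Proof.
apply/rowP => i; rewrite [RHS]mxE; have [k ->|->] := unliftP ord0 i.
  by rewrite !rV_consS mxE eqxx (inj_eq lift_inj).
by rewrite !rV_cons0.
Qed.

Lemma normr_rV_cons_head a y : `|a| <= `|rV_cons (a, y)|.
Proof. by rewrite -[a in leLHS](rV_cons0 a y); exact: ler_mx_coord. Qed.

Lemma normr_rV_cons_tail a y : `|y| <= `|rV_cons (a, y)|.
Proof.
apply: ler_mx_norm => // i j; rewrite (ord1 i) -(rV_consS a).
exact: ler_mx_coord.
Qed.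

Lemma continuous_rV_cons : continuous (@rV_cons R n).
Proof.
move=> [a y]; apply/cvg_ballP => e e0.
exists (ball a e, ball y e); first by split; exact: nbhsx_ballx.
move=> [b z] /= [H1 H2]; split => // i j; rewrite (ord1 i).
have [k ->|->] := unliftP ord0 j; last by rewrite !rV_cons0.
by rewrite !rV_consS; case: H2 => _; exact.
Qed.

Lemma continuous_rV_consr a : continuous (fun y : 'rV[R]_n => rV_cons (a, y)).
Proof.
move=> y; apply: (@cvg_comp _ _ _ (fun y => (a, y)) (@rV_cons R n) _ (nbhs (a, y))).
  by apply: (@cvg_pair _ _ _ (nbhs y) (nbhs a) (nbhs y)); [exact: cvg_cst|exact: cvg_id].
exact: continuous_rV_cons.
Qed.

Lemma continuous_rV_consl y : continuous (fun a : R => rV_cons (a, y)).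
Proof.
move=> a; apply: (@cvg_comp _ _ _ (fun a => (a, y)) (@rV_cons R n) _ (nbhs (a, y))).
  by apply: (@cvg_pair _ _ _ (nbhs a) (nbhs a) (nbhs y)); [exact: cvg_id|exact: cvg_cst].
exact: continuous_rV_cons.
Qed.

End rV_cons.

(** * Tonelli's theorem along the first coordinate *)

Section measure_step.
Context {R : realType} {n : nat}.
Local Notation mu := (@lebesgue_measure R).
Local Notation nu := (@lebesgue_rV R n).

Lemma measurable_rV_cons_comp d (T : measurableType d) (f : 'rV[R]_n.+1 -> T) :
  measurable_fun setT f ->
  measurable_fun setT (f \o @rV_cons R n : measurableTypeR R * 'rV[R]_n -> T).
Proof. by move=> mf; apply: measurableT_comp => //; exact: measurable_rV_cons. Qed.

Local Open Scope ereal_scope.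

Lemma measurable_slice (f : 'rV[R]_n.+1 -> \bar R) a :
  measurable_fun setT f -> measurable_fun setT (fun y => f (rV_cons (a, y))).
Proof.
move=> mf.
apply: (@measurableT_comp _ _ _ _ _ _ _ _ (fun y : 'rV[R]_n => ((a : measurableTypeR R), y))
  (measurable_rV_cons_comp mf)).
exact: pair1_measurable.
Qed.

Section ge0.
Variable f : 'rV[R]_n.+1 -> \bar R.
Hypotheses (mf : measurable_fun setT f) (f0 : forall x, 0 <= f x).

Lemma ge0_integral_rVS :
  \int[lebesgue_rV n.+1]_x f x = \int[mu]_a \int[nu]_y f (rV_cons (a, y)).
Proof.
transitivity (\int[mu \x nu]_p f (rV_cons p)).
  by rewrite /= /lebesgue_rV_step ge0_integral_pushforward//; exact: measurable_rV_cons.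
by rewrite fubini_tonelli1//; exact: measurable_rV_cons_comp.
Qed.

Lemma ge0_integral_rVS_swap :
  \int[lebesgue_rV n.+1]_x f x = \int[nu]_y \int[mu]_a f (rV_cons (a, y)).
Proof.
rewrite ge0_integral_rVS.
apply: (@fubini_tonelli _ _ _ _ _ mu nu (f \o @rV_cons R n)).
  exact: measurable_rV_cons_comp.
by move=> x; exact: f0.
Qed.

Lemma measurable_integral_slice :
  measurable_fun setT (fun a : measurableTypeR R => \int[nu]_y f (rV_cons (a, y))).
Proof.
apply: (@measurable_fun_fubini_tonelli_F _ _ _ _ _ nu (f \o @rV_cons R n)).
  exact: measurable_rV_cons_comp.
by move=> x; exact: f0.
Qed.

Lemma measurable_integral_coslice :
  measurable_fun setT (fun y => \int[mu]_a f (rV_cons (a, y))).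
Proof.
apply: (@measurable_fun_fubini_tonelli_G _ _ _ _ _ mu (f \o @rV_cons R n)).
  exact: measurable_rV_cons_comp.
by move=> x; exact: f0.
Qed.

End ge0.

End measure_step.

(** A sup-norm ball is a cube, whose preimage under [rV_cons] is an interval times a smaller cube;
    hence the induction on [n]. This is what gives bounded domains finite measure. *)
Lemma lebesgue_rV_ball_lty {R : realType} n (r : R) :
  (lebesgue_rV n (ball (0%R : 'rV[R]_n) r) < +oo)%E.
Proof.
have [r0|r0] := ltP 0 r; last first.
  rewrite (_ : ball _ r = set0) ?measure0 ?ltry//; apply/seteqP; split => x //= [].
  by rewrite ltNge r0.
elim: n => [|n IH].
  by rewrite /= /dirac indicE; exact: ltry.
rewrite /= /lebesgue_rV_step /pushforward.
rewrite (_ : _ @^-1` _ = ball (0 : R) r `*` ball (0 : 'rV[R]_n) r).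
  rewrite product_measure1E; [|by apply: open_measurable; apply: ball_open|exact: measurable_ball_rV].
  have lb : lebesgue_measure (ball (0 : R) r) = (r *+ 2)%:E.
    by rewrite lebesgue_measure_ball// ltW.
  by apply: lte_mul_pinfty => //; rewrite [X in X \is a _]lb.
apply/seteqP; split => [[a y]|[a y]] /=.
  move=> [_ H]; split; first by have := H 0 ord0; rewrite rV_cons0 mxE.
  by split => // i j; have := H i (lift ord0 j); rewrite (ord1 i) rV_consS !mxE.
move=> [H1 [_ H2]]; split => // i j; rewrite (ord1 i) mxE.
have [k ->|->] := unliftP ord0 j; last by rewrite rV_cons0.
by rewrite rV_consS; have := H2 0 k; rewrite mxE.
Qed.

(** * Functions of class C^1 with compact support *)

Section one_dimensional.
Context {R : realType}.
Local Notation mu := (@lebesgue_measure R).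
Variables (w : R -> R) (L : R).
Hypotheses (dw : forall x, derivable w x 1) (cw : continuous ('D_1 w))
  (w0 : forall x, L <= `|x| -> w x = 0).

Let FTC a b : a < b -> (\int[mu]_(x in `[a, b]) ('D_1 w x)%:E = (w b - w a)%:E)%E.
Proof.
move=> ab; have cw' : continuous w.
  by move=> x; apply/differentiable_continuous/derivable1_diffP.
rewrite (@continuous_FTC2 _ _ w)//.
- exact: continuous_subspaceT.
- by split=> //; [exact/cvg_at_right_filter/cw'|exact/cvg_at_left_filter/cw'].
- by move=> x _; rewrite derive1E.
Qed.

Lemma normr_le_integral_derive x : (`|w x|%:E <= \int[mu]_t `|('D_1 w t)|%:E)%E.
Proof.
have mD : measurable_fun setT ('D_1 w) by exact: continuous_measurable_fun.
have [a [ax a0]] : exists a, a < x /\ w a = 0.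
  (* A point to the left of [x] and outside the support: the fundamental theorem then starts from
     the value 0. *)
  exists (- (`|L| + `|x| + 1)); split.
    by have := ler_norm (- x); have := normr_ge0 L; rewrite normrN => ? ?; lra.
  have L0 := normr_ge0 L; have x0 := normr_ge0 x; have LL := ler_norm L.
  by apply: w0; rewrite normrN [`|_ + 1|]ger0_norm; lra.
have := FTC ax; rewrite a0 subr0 => /(congr1 abse) /= <-.
apply: (le_trans (le_abse_integral _ _ _)) => //.
  by apply/measurable_EFinP/measurable_funTS.
apply: ge0_subset_integral => //.
by apply/measurable_EFinP; exact: measurableT_comp.
Qed.

Lemma integral_derive0 : (\int[mu]_t ('D_1 w t)%:E = 0)%E.
Proof.
(* [L] may be negative; [M] yields a nondegenerate interval [[-M, M]] outside of which both [w] and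
   its derivative vanish. *)
pose M : R := `|L| + 1.
have L0 := normr_ge0 L; have LM : L < M by rewrite /M; have := ler_norm L => ?; lra.
have MM : - M < M by rewrite /M; lra.
have D0 x : M < `|x| -> 'D_1 w x = 0.
  move=> Mx; rewrite (@near_eq_derive _ _ _ _ (cst 0)) ?derive_cst//.
  near=> y; rewrite w0// ltW// (lt_le_trans LM)//.
  near: y; apply: (@cvgr_ge _ _ _ _ (fun y : R => `|y|) `|x|) => //.
  by apply: cvg_norm; exact: cvg_id.
have e : w M - w (- M) = 0.
  by rewrite !w0 ?subrr// ?normrN gtr0_norm ?ltW// /M; lra.
transitivity (\int[mu]_(x in `[(- M)%R, M]) ('D_1 w x)%:E)%E; last by rewrite FTC// e.
rewrite [RHS]integral_mkcond; apply: eq_integral => x _.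
rewrite patchE; case: ifPn => // /negP; rewrite inE /= in_itv /= => H.
rewrite D0 // ltNge ler_norml; exact/negP.
Unshelve. all: by end_near. Qed.

End one_dimensional.

Section c1c.
Context {R : realType}.

(** The support is recorded by one sup-norm radius [L], which products and slices in either
    direction inherit unchanged. This is what makes induction on the dimension possible. *)
Definition c1c n (L : R) (f : 'rV[R]_n -> R) :=
  [/\ forall x, L <= `|x| -> f x = 0, continuous f,
      forall i x, derivable f x (delta_mx 0 i) &
      forall i, continuous (partial i f)].

Section basic.
Context {n : nat}.
Implicit Types (f g : 'rV[R]_n -> R) (x : 'rV[R]_n) (i : 'I_n).

Lemma partial_near0 f x i : (\forall z \near x, f z = 0) -> partial i f x = 0.
Proof.
move=> f0; rewrite /partial (@near_eq_derive _ _ _ _ (cst 0)) ?derive_cst//.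
Qed.

Lemma partialM f g i : (forall x, derivable f x (delta_mx 0 i)) ->
  (forall x, derivable g x (delta_mx 0 i)) ->
  partial i (fun x => f x * g x) = (fun x => f x * partial i g x + g x * partial i f x).
Proof. by move=> df dg; apply/funext => x; rewrite /partial (deriveM (df x) (dg x)). Qed.

Lemma c1cM L f g : c1c L f -> c1c L g -> c1c L (fun x => f x * g x).
Proof.
move=> [f0 cf df cdf] [g0 cg dg cdg]; split.
- by move=> x /f0 ->; rewrite mul0r.
- by move=> x; exact: (cvgM (cf x) (cg x)).
- by move=> i x; apply: derivableM; [exact: df|exact: dg].
- by move=> i; rewrite partialM// => x; exact: (cvgD (cvgM (cf x) (cdg i x)) (cvgM (cg x) (cdf i x))).
Qed.

Lemma partial_c1c_eq0 L f i x : c1c L f -> L < `|x| -> partial i f x = 0.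
Proof.
move=> [f0 _ _ _] Lx; apply: partial_near0; near=> y; apply: f0; rewrite ltW//.
near: y; apply: (@cvgr_gt _ _ _ _ (fun y : 'rV[R]_n => `|y|) `|x|) => //.
by apply: cvg_norm; exact: cvg_id.
Unshelve. all: by end_near. Qed.

Lemma compact_support_bounded L f : (forall x, L < `|x| -> f x = 0) -> continuous f ->
  exists M, forall x, `|f x| <= M.
Proof.
move=> f0 cf.
have cB : compact [set x : 'rV[R]_n | `|x| <= L].
  apply: bounded_closed_compact.
    by exists L; split; [exact: num_real|move=> M LM x /= xL; exact: le_trans (ltW LM)].
  rewrite (_ : mkset _ = (fun x : 'rV[R]_n => `|x|) @^-1` [set t | t <= L]) //.
  apply: (@preimage_closed _ _ (fun x : 'rV[R]_n => `|x|) [set t | t <= L]); last exact: closed_le.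
  by move=> x _; exact: norm_continuous.
have cfB : {within [set x : 'rV[R]_n | `|x| <= L], continuous f} by exact: continuous_subspaceT.
have [M [_ HM]] := compact_bounded (continuous_compact cfB cB).
exists (`|M| + 1) => x.
have [xL|/f0 ->] := leP `|x| L; last by rewrite normr0 addr_ge0.
apply: HM; last by exists x.
by have := ler_norm M => ?; lra.
Qed.

End basic.

Section slices.
Context {n : nat}.
Variables (L : R) (f : 'rV[R]_n.+1 -> R).

(** Since [rV_cons] is linear, the difference quotients of a slice are those of [f] at the same
    point, so partial derivatives commute with slicing without any chain rule. *)
Let slice_quot a (y : 'rV[R]_n) (j : 'I_n) :
  (fun h : R => h^-1 *: (((fun y => f (rV_cons (a, y))) \o shift y) (h *: delta_mx 0 j) - f (rV_cons (a, y)))) =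
  (fun h : R => h^-1 *: ((f \o shift (rV_cons (a, y))) (h *: delta_mx 0 (lift ord0 j)) - f (rV_cons (a, y)))).
Proof.
apply/funext => h /=; rewrite -rV_cons_deltaS -rV_consZ -rV_consD.
by rewrite mulr0 add0r.
Qed.

Let coslice_quot a (y : 'rV[R]_n) :
  (fun h : R => h^-1 *: (((fun a => f (rV_cons (a, y))) \o shift a) (h *: (1 : R)) - f (rV_cons (a, y)))) =
  (fun h : R => h^-1 *: ((f \o shift (rV_cons (a, y))) (h *: delta_mx 0 ord0) - f (rV_cons (a, y)))).
Proof.
apply/funext => h /=; rewrite -rV_cons_delta0 -rV_consZ -rV_consD.
by rewrite scaler0 add0r.
Qed.

Lemma partial_slice a j :
  partial j (fun y => f (rV_cons (a, y))) = (fun y => partial (lift ord0 j) f (rV_cons (a, y))).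
Proof. by apply/funext => y; rewrite /partial /derive slice_quot. Qed.

Lemma derive_coslice y :
  'D_1 (fun a => f (rV_cons (a, y))) = (fun a => partial ord0 f (rV_cons (a, y))).
Proof. by apply/funext => a; rewrite /partial /derive coslice_quot. Qed.

Hypothesis cf : c1c L f.

Lemma c1c_slice a : c1c L (fun y => f (rV_cons (a, y))).
Proof.
have [f0 cf' df cdf] := cf; split.
- by move=> y Ly; apply: f0; exact: le_trans (normr_rV_cons_tail _ _).
- move=> y; apply: (@continuous_comp _ _ _ (fun y : 'rV[R]_n => rV_cons (a, y)) f).
    exact: continuous_rV_consr.
  exact: cf'.
- by move=> j y; have := df (lift ord0 j) (rV_cons (a, y)); rewrite /derivable slice_quot.
- move=> j; rewrite partial_slice => y.
  apply: (@continuous_comp _ _ _ (fun y : 'rV[R]_n => rV_cons (a, y)) (partial _ f)).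
    exact: continuous_rV_consr.
  exact: cdf.
Qed.

Lemma derivable_coslice y a : derivable (fun a => f (rV_cons (a, y))) a 1.
Proof.
by have [_ _ df _] := cf; have := df ord0 (rV_cons (a, y)); rewrite /derivable coslice_quot.
Qed.

Lemma continuous_derive_coslice y : continuous ('D_1 (fun a => f (rV_cons (a, y)))).
Proof.
have [_ _ _ cdf] := cf; rewrite derive_coslice => a.
apply: (@continuous_comp _ _ _ (fun a : R => rV_cons (a, y)) (partial _ f)).
  exact: continuous_rV_consl.
exact: cdf.
Qed.

Lemma coslice_eq0 y a : L <= `|a| -> f (rV_cons (a, y)) = 0.
Proof.
by have [f0 _ _ _] := cf; move=> La; apply: f0; exact: le_trans (normr_rV_cons_head _ _).
Qed.

End slices.

End c1c.

(** * Square-integrable functions *)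

Section square_integrable.
Context d (T : measurableType d) (R : realType) (mu : {measure set T -> \bar R}).
Variables (D : set T) (mD : measurable D).
Implicit Types f g : T -> R.

Definition l2 f := measurable_fun D f /\ mu.-integrable D (fun x => (f x ^+ 2)%:E).

Local Notation "'\I' f" := (Rintegral mu D f) (at level 10, f at level 9).

Lemma integrable_add f g : mu.-integrable D (EFin \o f) -> mu.-integrable D (EFin \o g) ->
  mu.-integrable D (EFin \o (fun x => f x + g x)).
Proof. by move=> fi gi; have := integrableD mD fi gi; apply: eq_integrable. Qed.

Lemma integrable_scale (c : R) f : mu.-integrable D (EFin \o f) ->
  mu.-integrable D (EFin \o (fun x => c * f x)).
Proof. by move=> fi; have := integrableZl mD c fi; apply: eq_integrable. Qed.

Lemma integrable_le f g : measurable_fun D f -> mu.-integrable D (EFin \o g) ->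
  (forall x, D x -> `|f x| <= g x) -> mu.-integrable D (EFin \o f).
Proof.
move=> mf gi fg; apply: (le_integrable mD _ _ gi); first exact/measurable_EFinP.
by move=> x Dx; rewrite /= lee_fin (le_trans (fg x Dx)) ?ler_norm.
Qed.

Lemma l2M f g : l2 f -> l2 g -> mu.-integrable D (EFin \o (fun x => f x * g x)).
Proof.
move=> [mf fi] [mg gi].
apply: (@integrable_le _ (fun x => f x ^+ 2 + g x ^+ 2)).
- exact: measurable_funM.
- exact: integrable_add.
- move=> x _; rewrite ler_norml; apply/andP; split; nra.
Qed.

Lemma l2D f g : l2 f -> l2 g -> l2 (fun x => f x + g x).
Proof.
move=> lf lg; have := l2M lf lg; move: lf lg => [mf fi] [mg gi] fgi.
split; first exact: measurable_funD.
have : mu.-integrable D (EFin \o (fun x => f x ^+ 2 + (2 * (f x * g x) + g x ^+ 2))).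
  by apply: integrable_add => //; apply: integrable_add => //; exact: integrable_scale.
by apply: eq_integrable => // x _ /=; congr EFin; ring.
Qed.

Lemma l2Z (c : R) f : l2 f -> l2 (fun x => c * f x).
Proof.
move=> [mf fi]; split; first by apply: measurable_funM => //; exact: measurable_cst.
have : mu.-integrable D (EFin \o (fun x => c ^+ 2 * f x ^+ 2)) by exact: integrable_scale.
by apply: eq_integrable => // x _ /=; congr EFin; ring.
Qed.

Lemma l2B f g : l2 f -> l2 g -> l2 (fun x => f x - g x).
Proof.
move=> lf /(l2Z (-1)) lg; have := l2D lf lg; congr l2.
by apply/funext => x; rewrite mulN1r.
Qed.

Lemma Rint_ge0 f : (forall x, D x -> 0 <= f x) -> 0 <= \I f.
Proof. exact: Rintegral_ge0. Qed.

Lemma RintD f g : mu.-integrable D (EFin \o f) -> mu.-integrable D (EFin \o g) ->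
  \I (fun x => f x + g x) = \I f + \I g.
Proof. exact: RintegralD. Qed.

Lemma RintZ (c : R) f : mu.-integrable D (EFin \o f) -> \I (fun x => c * f x) = c * \I f.
Proof. by move=> fi; rewrite RintegralZl. Qed.

Lemma Rint_le f g : mu.-integrable D (EFin \o f) -> mu.-integrable D (EFin \o g) ->
  (forall x, D x -> f x <= g x) -> \I f <= \I g.
Proof. exact: le_Rintegral. Qed.

Lemma l2_expand (a b : R) f g : l2 f -> l2 g ->
  \I (fun x => (a * f x + b * g x) ^+ 2) =
  a ^+ 2 * \I (fun x => f x ^+ 2) + 2 * a * b * \I (fun x => f x * g x) +
  b ^+ 2 * \I (fun x => g x ^+ 2).
Proof.
move=> lf lg; have fgi := l2M lf lg; have [_ fi] := lf; have [_ gi] := lg.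
transitivity (\I (fun x => a ^+ 2 * f x ^+ 2 +
    (2 * a * b * (f x * g x) + b ^+ 2 * g x ^+ 2))).
  by apply: eq_Rintegral => x _ /=; ring.
have i1 := integrable_scale (a ^+ 2) fi.
have i2 := integrable_scale (2 * a * b) fgi.
have i3 := integrable_scale (b ^+ 2) gi.
by rewrite RintD ?RintD ?RintZ ?addrA//; exact: integrable_add.
Qed.

Lemma cauchy_schwarz f g : l2 f -> l2 g ->
  (\I (fun x => f x * g x)) ^+ 2 <= \I (fun x => f x ^+ 2) * \I (fun x => g x ^+ 2).
Proof.
move=> lf lg.
set F := \I (fun x => f x ^+ 2); set G := \I (fun x => g x ^+ 2); set B := \I (fun x => _ * _).
have P a b : 0 <= a ^+ 2 * F + 2 * a * b * B + b ^+ 2 * G.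
  by rewrite -l2_expand//; apply: Rint_ge0 => x _; exact: sqr_ge0.
have F0 : 0 <= F by apply: Rint_ge0 => x _; exact: sqr_ge0.
have G0 : 0 <= G by apply: Rint_ge0 => x _; exact: sqr_ge0.
have [G1|G1] := ltP 0 G.
  (* The minimising choice in the quadratic form: its value at [(G, -B)] is
     [G * (F * G - B ^+ 2)]. *)
  rewrite -(ler_pM2l G1); have := P G (- B) => ?; lra.
have G2 : G = 0 by apply/le_anti; rewrite G1 G0.
have [/eqP B0|B0] := boolP (B == 0); first by rewrite B0 G2; nra.
(* With [G = 0] the form at this point equals [- B ^+ 2], which contradicts [B != 0]. *)
have := P (- B) ((F + 1) / 2).
rewrite G2 !mulr0 addr0 => H.
nra.
Qed.

End square_integrable.

Lemma EFin_Rintegral d (T : measurableType d) (R : realType)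
    (mu : {measure set T -> \bar R}) (D : set T) (f : T -> R) : measurable D ->
  mu.-integrable D (EFin \o f) ->
  ((Rintegral mu D f)%:E = \int[mu]_(x in D) (f x)%:E)%E.
Proof. by move=> mD fi; rewrite /Rintegral fineK//; exact: integrable_fin_num. Qed.

Section compactly_supported.
Context {R : realType} {n : nat}.
Implicit Types f : 'rV[R]_n -> R.
Local Notation mu := (@lebesgue_rV R n).

(** The inequality is strict, unlike in [c1c]: a function vanishing where [L <= |x|] vanishes near
    every point with [L < |x|], and only there does this settle its partial derivatives. *)
Definition c0c (L : R) f := continuous f /\ forall x, L < `|x| -> f x = 0.

Lemma c0c_integrable L f : c0c L f -> mu.-integrable setT (EFin \o f).
Proof.
move=> [cf f0]; pose A := ball (0 : 'rV[R]_n) (L + 1).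
have mA : measurable A by exact: measurable_ball_rV.
have [M HM] := compact_support_bounded f0 cf.
have mf := continuous_measurable_rV cf.
have : mu.-integrable A (EFin \o f).
  apply: measurable_bounded_integrable => //.
  - exact: lebesgue_rV_ball_lty.
  - exact: measurable_funTS.
  - exists M; split; first exact: num_real.
    by move=> K MK x _ /=; exact: le_trans (HM x) (ltW MK).
rewrite (integrable_mkcond (EFin \o f) mA); apply: eq_integrable => // x _.
rewrite patchE; case: ifPn => // /negP xA /=; rewrite f0//.
rewrite ltNge; apply/negP => xL; apply: xA; rewrite inE /A -ball_normE /ball_ /= sub0r normrN.
lra.
Qed.

Lemma c0c_l2 L f : c0c L f -> l2 mu setT f.
Proof.
move=> [cf f0]; split; first exact: continuous_measurable_rV.
apply: (@c0c_integrable L); split; first by move=> x; exact: (cvgM (cf x) (cf x)).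
by move=> x /f0 ->; rewrite expr0n.
Qed.

Lemma c0cM L f g : c0c L f -> c0c L g -> c0c L (fun x => f x * g x).
Proof.
move=> [cf f0] [cg g0]; split; first by move=> x; exact: (cvgM (cf x) (cg x)).
by move=> x /f0 ->; rewrite mul0r.
Qed.

Lemma c0c_norm L f : c0c L f -> c0c L (fun x => `|f x|).
Proof.
move=> [cf f0]; split; first by move=> x; exact: (cvg_norm (cf x)).
by move=> x /f0 ->; rewrite normr0.
Qed.

Lemma c0cZ L c f : c0c L f -> c0c L (fun x => c * f x).
Proof.
move=> [cf f0]; split; first by move=> x; exact: (cvgM (cvg_cst c) (cf x)).
by move=> x /f0 ->; rewrite mulr0.
Qed.

Lemma c0cD L f g : c0c L f -> c0c L g -> c0c L (fun x => f x + g x).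
Proof.
move=> [cf f0] [cg g0]; split; first by move=> x; exact: (cvgD (cf x) (cg x)).
by move=> x /[dup] /f0 -> /g0 ->; rewrite addr0.
Qed.

Lemma c1c_c0c L f : c1c L f -> c0c L f.
Proof. by move=> [f0 cf _ _]; split => // x /ltW; exact: f0. Qed.

Lemma c1c_c0c_partial L f i : c1c L f -> c0c L (partial i f).
Proof.
move=> cf; split; first by case: cf.
by move=> x; exact: partial_c1c_eq0.
Qed.

End compactly_supported.

(** * Integrals over slices of compactly supported functions *)

Section slicing.
Context {R : realType} {n : nat}.
Local Notation mu := (@lebesgue_measure R).
Local Notation nu := (@lebesgue_rV R n).

Section integrable.
Variable f : 'rV[R]_n.+1 -> \bar R.
Hypothesis fi : (lebesgue_rV n.+1).-integrable setT f.

Let fi' : (mu \x nu)%E.-integrable setT (f \o @rV_cons R n).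
Proof.
have /integrableP[mf foo] := fi; apply/integrableP; split.
  exact: measurable_rV_cons_comp.
rewrite /= /lebesgue_rV_step ge0_integral_pushforward// in foo.
- exact: measurable_rV_cons.
- by apply: measurableT_comp.
Qed.

Let e : (\int[lebesgue_rV n.+1]_x f x = \int[mu \x nu]_p f (rV_cons p))%E.
Proof.
have /integrableP[mf foo] := fi.
by rewrite /= /lebesgue_rV_step integral_pushforward//; exact: measurable_rV_cons.
Qed.

Lemma integral_rVS :
  (\int[lebesgue_rV n.+1]_x f x = \int[mu]_a \int[nu]_y f (rV_cons (a, y)))%E.
Proof. by rewrite e -(integral12_prod_meas1 fi'). Qed.

Lemma integral_rVS_swap :
  (\int[lebesgue_rV n.+1]_x f x = \int[nu]_y \int[mu]_a f (rV_cons (a, y)))%E.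
Proof. by rewrite e -(integral21_prod_meas1 fi'). Qed.

End integrable.

Variables (L : R) (f : 'rV[R]_n.+1 -> R).
Hypothesis cf : c1c L f.

(** For fixed [y] the value at [(a, y)] is bounded by the integral of the first partial derivative
    along the whole line through it; integrating in [y] gives a bound uniform in [a]. *)
Lemma integral_slice_le a :
  (\int[nu]_y `|f (rV_cons (a, y))|%:E <= \int[lebesgue_rV n.+1]_x `|partial ord0 f x|%:E)%E.
Proof.
have mp : measurable_fun setT (fun x => `|partial ord0 f x|%:E).
  by apply/measurable_EFinP/measurableT_comp => //; apply: continuous_measurable_rV; case: cf.
have mf : measurable_fun setT (fun x => `|f x|%:E).
  by apply/measurable_EFinP/measurableT_comp => //; apply: continuous_measurable_rV; case: cf.
rewrite ge0_integral_rVS_swap//; apply: ge0_le_integral => //.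
- exact: (measurable_slice a mf).
- by apply: (measurable_integral_coslice mp).
- move=> y _.
  have := normr_le_integral_derive (@derivable_coslice _ _ _ _ cf y)
    (@continuous_derive_coslice _ _ _ _ cf y) (@coslice_eq0 _ _ _ _ cf y) a.
  have E t := congr1 (fun g => g t) (derive_coslice f y).
  by under eq_integral do rewrite E.
Qed.

End slicing.

(** If the direction is the first coordinate, the inner integral along it vanishes by the
    fundamental theorem; otherwise the slice over the first coordinate falls under the induction
    hypothesis. It serves to integrate test functions by parts. *)
Lemma integral_partial0 {R : realType} n L (f : 'rV[R]_n -> R) i : c1c L f ->
  (\int[lebesgue_rV n]_x (partial i f x)%:E = 0)%E.
Proof.
elim: n f i => [f []//|n IH f i cf].
have fi : (lebesgue_rV n.+1).-integrable setT (EFin \o partial i f).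
  exact: (c0c_integrable (c1c_c0c_partial i cf)).
have [j ij|i0] := unliftP ord0 i.
  rewrite (integral_rVS fi) integral0_eq// => a _ /=.
  rewrite -[RHS](IH (fun y => f (rV_cons (a, y))) j); last exact: c1c_slice.
  by rewrite partial_slice ij.
rewrite (integral_rVS_swap fi) integral0_eq// => y _ /=.
have := integral_derive0 (@derivable_coslice _ _ _ _ cf y)
  (@continuous_derive_coslice _ _ _ _ cf y) (@coslice_eq0 _ _ _ _ cf y).
have E t := congr1 (fun g => g t) (derive_coslice f y).
by rewrite i0; under eq_integral do rewrite E.
Qed.

(** * The Gagliardo-Nirenberg-Sobolev inequality in dimensions 2 and 3 *)

Lemma c1cX {R : realType} n L (f : 'rV[R]_n -> R) k : c1c L f ->
  c1c L (fun x => f x ^+ k.+1) /\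
  forall i, partial i (fun x => f x ^+ k.+1) = (fun x => k.+1%:R * f x ^+ k * partial i f x).
Proof.
move=> cf; elim: k => [|k [IH IHd]].
  split=> [|i]; first exact: cf.
  by apply/funext => x; rewrite expr0 !mul1r.
rewrite (_ : (fun x => f x ^+ k.+2) = (fun x => f x * f x ^+ k.+1)); last first.
  by apply/funext => x; rewrite exprS.
split=> [|i]; first exact: c1cM.
rewrite partialM; last 2 first.
- by move=> x; case: cf.
- by move=> x; case: IH.
by apply/funext => x; rewrite IHd -!natr1 !exprS; ring.
Qed.

Lemma sum_ord2 (V : nmodType) (F : 'I_2 -> V) :
  \sum_(i < 2) F i = F ord0 + F (lift ord0 ord0).
Proof. by rewrite !big_ord_recl big_ord0 addr0. Qed.

Lemma sum_ord3 (V : nmodType) (F : 'I_3 -> V) :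
  \sum_(i < 3) F i = F ord0 + \sum_(i < 2) F (lift ord0 i).
Proof. by rewrite big_ord_recl. Qed.

Section sobolev.
Context {R : realType}.
Local Notation S f := (Rintegral (lebesgue_rV _) setT f).

Lemma c0c_slice n L (f : 'rV[R]_n.+1 -> R) a : c0c L f -> c0c L (fun y => f (rV_cons (a, y))).
Proof.
move=> [cf f0]; split; last first.
  by move=> y Ly; apply: f0; exact: lt_le_trans Ly (normr_rV_cons_tail _ _).
move=> y; apply: (@continuous_comp _ _ _ (fun y : 'rV[R]_n => rV_cons (a, y)) f).
  exact: continuous_rV_consr.
exact: cf.
Qed.

(** Tonelli in the form used to gain one dimension: an inequality valid on every slice, with a
    constant independent of the slice, integrates to the whole space. *)
Lemma Rintegral_rVS_le n L (c : R) (f g : 'rV[R]_n.+1 -> R) : c0c L f -> c0c L g -> 0 <= c ->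
  (forall x, 0 <= f x) -> (forall x, 0 <= g x) ->
  (forall a, S (fun y => f (rV_cons (a, y))) <= c * S (fun y => g (rV_cons (a, y)))) ->
  S f <= c * S g.
Proof.
move=> cf cg c0 f0 g0 H.
have fi := c0c_integrable cf; have gi := c0c_integrable cg.
have /integrableP[mf _] := fi; have /integrableP[mg _] := gi.
have f0' x : (0 <= (f x)%:E)%E by rewrite lee_fin.
have g0' x : (0 <= (g x)%:E)%E by rewrite lee_fin.
have mIf := measurable_integral_slice mf f0'.
have mIg := measurable_integral_slice mg g0'.
have If a : (0 <= \int[lebesgue_rV n]_y (f (rV_cons (a, y)))%:E)%E.
  by apply: integral_ge0 => y _.
have Ig a : (0 <= \int[lebesgue_rV n]_y (g (rV_cons (a, y)))%:E)%E.
  by apply: integral_ge0 => y _.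
rewrite -lee_fin EFinM !EFin_Rintegral//.
rewrite (ge0_integral_rVS mf f0') (ge0_integral_rVS mg g0') -ge0_integralZl ?lee_fin//.
apply: ge0_le_integral.
- exact: measurableT.
- by move=> a _; exact: If.
- exact: mIf.
- exact: (measurable_funeM _ mIg).
move=> a _; have fai := c0c_integrable (c0c_slice a cf).
have gai := c0c_integrable (c0c_slice a cg).
by rewrite -!EFin_Rintegral// -EFinM lee_fin.
by move=> a _; exact: Ig.
Qed.

Lemma Rintegral_slice_le_partial n L (f : 'rV[R]_n.+1 -> R) a : c1c L f ->
  S (fun y => `|f (rV_cons (a, y))|) <= S (fun x => `|partial ord0 f x|).
Proof.
move=> cf; rewrite -lee_fin !EFin_Rintegral//; first exact: integral_slice_le cf a.
- exact: (c0c_integrable (c0c_norm (c1c_c0c_partial ord0 cf))).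
- exact: (c0c_integrable (c0c_slice a (c0c_norm (c1c_c0c cf)))).
Qed.

(** Since [lebesgue_rV 0] is a Dirac mass, the slice estimate becomes a pointwise one in dimension
    1. *)
Lemma normr_le_Rintegral_partial L (f : 'rV[R]_1 -> R) y : c1c L f ->
  `|f y| <= S (fun x => `|partial ord0 f x|).
Proof.
move=> cf; have := Rintegral_slice_le_partial (y 0 ord0) cf.
rewrite /Rintegral /= integral_dirac//=; last first.
  apply/measurable_EFinP.
  exact: (continuous_measurable_rV (c0c_norm (c0c_slice _ (c1c_c0c cf))).1).
rewrite indicT /= mul1r.
suff -> : rV_cons (y 0 ord0, 0) = y by [].
by apply/rowP => j; rewrite (ord1 j) rV_cons0.
Qed.

(* On each slice, one factor [w] is bounded by its supremum and the other one
   integrated. *)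
Lemma Rintegral_sqr_le_2d L (w : 'rV[R]_2 -> R) : c1c L w ->
  S (fun x => w x ^+ 2) <=
  S (fun x => `|partial ord0 w x|) * S (fun x => `|partial (lift ord0 ord0) w x|).
Proof.
move=> cw; have cw0 := c1c_c0c cw.
have P0 := c0c_norm (c1c_c0c_partial ord0 cw).
have P1 := c0c_norm (c1c_c0c_partial (lift ord0 ord0) cw).
apply: (@Rintegral_rVS_le _ L) => //.
- exact: (c0cM cw0 cw0).
- exact: Rintegral_ge0.
- by move=> x; exact: sqr_ge0.
move=> a; have caw := c1c_slice cw a; have caw0 := c1c_c0c caw.
set B := Rintegral (lebesgue_rV 2) _ _.
set A := S (fun y => `|partial (lift ord0 ord0) w (rV_cons (a, y))|).
have wA y : `|w (rV_cons (a, y))| <= A.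
  by have := normr_le_Rintegral_partial y caw; rewrite partial_slice.
apply: (@le_trans _ _ (A * S (fun y => `|w (rV_cons (a, y))|))); last first.
  rewrite mulrC ler_wpM2r//; first exact: Rintegral_ge0.
  exact: Rintegral_slice_le_partial cw.
have ni := c0c_integrable (c0c_norm caw0).
rewrite -RintZ//; apply: Rint_le => //.
- exact: (c0c_integrable (c0cM caw0 caw0)).
- exact: (c0c_integrable (c0cZ A (c0c_norm caw0))).
- by move=> y _; rewrite -real_normK ?num_real// expr2 ler_wpM2r.
Qed.

Definition dirichlet n (f : 'rV[R]_n -> R) : R :=
  \sum_(i < n) S (fun x => partial i f x ^+ 2).

(** Cauchy-Schwarz applied to [k.+2%:R * v ^+ k.+1 * partial i v]. *)
Lemma Rintegral_partialX_le n L (v : 'rV[R]_n -> R) k i : c1c L v ->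
  S (fun x => `|partial i (fun x => v x ^+ k.+2) x|) ^+ 2 <=
  k.+2%:R ^+ 2 * S (fun x => (v x ^+ k.+1) ^+ 2) * S (fun x => partial i v x ^+ 2).
Proof.
move=> cv; have [_ ->] := c1cX k.+1 cv.
have cg := c0c_norm (c1c_c0c (c1cX k cv).1).
have cp := c0c_norm (c1c_c0c_partial i cv).
rewrite (_ : Rintegral _ _ _ = k.+2%:R * S (fun x => `|v x ^+ k.+1| * `|partial i v x|)).
  rewrite exprMn -mulrA ler_wpM2l ?sqr_ge0//.
  apply: (le_trans (cauchy_schwarz measurableT (c0c_l2 cg) (c0c_l2 cp))).
  rewrite le_eqVlt; apply/orP; left; apply/eqP; congr (_ * _);
    by apply: eq_Rintegral => x _; rewrite real_normK ?num_real.
rewrite -RintZ//; last exact: (c0c_integrable (c0cM cg cp)).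
by apply: eq_Rintegral => x _; rewrite !normrM normr_nat mulrA.
Qed.

(** [Rintegral_sqr_le_2d] is applied to [v ^+ k.+2]; the product of the two L^1 norms is at most the
    mean of their squares, each of which [Rintegral_partialX_le] controls. Every use raises the
    power of [v] at the cost of one Dirichlet energy. *)
Lemma Rintegral_exprn_le_2d L (v : 'rV[R]_2 -> R) k : c1c L v ->
  S (fun x => (v x ^+ k.+2) ^+ 2) <=
  k.+2%:R ^+ 2 * S (fun x => (v x ^+ k.+1) ^+ 2) * dirichlet v.
Proof.
have aux (W P0 P1 K D0 D1 : R) : W <= P0 * P1 -> P0 ^+ 2 <= K * D0 ->
    P1 ^+ 2 <= K * D1 -> W <= K * (D0 + D1).
  move=> h2 h0 h1; apply: (le_trans h2).
  have k0 : 0 <= K * D0 by exact: le_trans (sqr_ge0 _) h0.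
  have k1 : 0 <= K * D1 by exact: le_trans (sqr_ge0 _) h1.
  by rewrite mulrDr; nra.
move=> cv; rewrite /dirichlet sum_ord2.
apply: aux (Rintegral_sqr_le_2d (c1cX k.+1 cv).1) _ _; exact: Rintegral_partialX_le cv.
Qed.

Lemma dirichlet_ge0 n (f : 'rV[R]_n -> R) : 0 <= dirichlet f.
Proof. by apply: sumr_ge0 => i _; apply: Rintegral_ge0 => x _; exact: sqr_ge0. Qed.

(* By Cauchy-Schwarz, [m] can be the measure of any set outside of which [v] vanishes. *)
Lemma sobolev_2d L m (v : 'rV[R]_2 -> R) : c1c L v -> 0 <= m ->
  S (fun x => v x ^+ 2) ^+ 2 <= m * S (fun x => v x ^+ 4) ->
  S (fun x => v x ^+ 6) <= 144 * m * dirichlet v ^+ 3.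
Proof.
(* 144 = 9 * 4 * 4: the first two bounds give [X2 <= 4 * m * D], then [X4 <= 16 * m * D ^+ 2], and
   the third multiplies by [9 * D]. *)
have aux (X2 X4 X6 D : R) : 0 <= D -> 0 <= m -> 0 <= X2 -> X2 ^+ 2 <= m * X4 ->
    X4 <= 2%:R ^+ 2 * X2 * D -> X6 <= 3%:R ^+ 2 * X4 * D -> X6 <= 144 * m * D ^+ 3.
  move=> D0 m0 X20 h1 h2 h3.
  have X2D : X2 <= 4 * m * D.
    have [X2p|X2n] := ltP 0 X2; last by nra.
    by rewrite -(ler_pM2l X2p); nra.
  have X4D : X4 <= 16 * m * D ^+ 2.
    by apply: (le_trans h2); have : X2 * D <= 4 * m * D * D by [rewrite ler_wpM2r]; lra.
  by apply: (le_trans h3); have : X4 * D <= 16 * m * D ^+ 2 * D by [rewrite ler_wpM2r]; lra.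
move=> cv m0 hm.
have h1 := Rintegral_exprn_le_2d 0 cv; have h2 := Rintegral_exprn_le_2d 1 cv.
have E k l : S (fun x => (v x ^+ k) ^+ l) = S (fun x => v x ^+ (k * l)).
  by apply: eq_Rintegral => x _; rewrite exprM.
move: h1 h2; rewrite (E 2 2)%N (E 1 2)%N (E 3 2)%N; apply: aux => //; first exact: dirichlet_ge0.
by apply: Rintegral_ge0 => x _; exact: sqr_ge0.
Qed.

Lemma dirichlet_slice n (f : 'rV[R]_n.+1 -> R) a :
  dirichlet (fun y => f (rV_cons (a, y))) =
  \sum_(i < n) S (fun y => partial (lift ord0 i) f (rV_cons (a, y)) ^+ 2).
Proof. by apply: eq_bigr => i _; rewrite partial_slice. Qed.

(* On each plane slice [v] of [u], the integral of v^6 is at most 9 D(v) times that of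
   v^4, and the latter is bounded, uniformly in the slice, by [B], the integral of
   |d_0 (u^4)|; in turn B^2 <= 16 D(u) times the integral of u^6. *)
Lemma sobolev_3d L (u : 'rV[R]_3 -> R) : c1c L u ->
  S (fun x => u x ^+ 6) <= 36 ^+ 2 * dirichlet u ^+ 3.
Proof.
(* Squaring the first bound and inserting the second gives [Z ^+ 2 <= 81 * 16 * Z * D ^+ 3], and 81
   * 16 = 36^2. *)
have aux (Z B D : R) : 0 <= Z -> 0 <= D -> 0 <= B -> Z <= 9 * B * D ->
    B ^+ 2 <= 16 * Z * D -> Z <= 36 ^+ 2 * D ^+ 3.
  move=> Z0 D0 B0 h1 h2.
  have [Zp|Zn] := ltP 0 Z; last first.
    by apply: (le_trans Zn); apply: mulr_ge0; [exact: sqr_ge0|exact: exprn_ge0].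
  rewrite -(ler_pM2l Zp).
  have : Z * Z <= (9 * B * D) * (9 * B * D) by apply: ler_pM.
  have : B ^+ 2 * D ^+ 2 <= 16 * Z * D * D ^+ 2 by rewrite ler_wpM2r// sqr_ge0.
  by move=> ? ?; lra.
move=> cu.
pose B := S (fun x => `|partial ord0 (fun x => u x ^+ 4) x|).
pose g x := partial (lift ord0 ord0) u x ^+ 2 + partial (lift ord0 (lift ord0 ord0)) u x ^+ 2.
have c6 := c1c_c0c (c1cX 5 cu).1.
have cp i := c1c_c0c_partial i cu.
have cp2 i : c0c L (fun x => partial i u x ^+ 2) by exact: c0cM (cp i) (cp i).
have cg : c0c L g by exact: c0cD.
have gD : S g <= dirichlet u.
  rewrite /dirichlet sum_ord3 sum_ord2 RintD//; last 2 first.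
  - exact: (c0c_integrable (cp2 _)).
  - exact: (c0c_integrable (cp2 _)).
  by rewrite lerDr; apply: Rintegral_ge0 => x _; exact: sqr_ge0.
have B0 : 0 <= B by exact: Rintegral_ge0.
have pos6 x : 0 <= u x ^+ 6 by rewrite (exprM _ 2 3) exprn_ge0 ?sqr_ge0.
apply: (aux _ B); rewrite ?dirichlet_ge0//.
- exact: Rintegral_ge0.
- apply: (@le_trans _ _ (9 * B * S g)); last by rewrite ler_wpM2l// mulr_ge0.
  apply: (Rintegral_rVS_le c6 cg) => //; first by rewrite mulr_ge0.
    by move=> x; rewrite addr_ge0 ?sqr_ge0.
  move=> a; have cau := c1c_slice cu a.
  have -> : S (fun y => g (rV_cons (a, y))) = dirichlet (fun y => u (rV_cons (a, y))).
    rewrite dirichlet_slice sum_ord2 /g RintD//.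
    + exact: (c0c_integrable (c0c_slice a (cp2 _))).
    + exact: (c0c_integrable (c0c_slice a (cp2 _))).
  have := Rintegral_exprn_le_2d 1 cau.
  rewrite (_ : S (fun y => (u (rV_cons (a, y)) ^+ 3) ^+ 2) = S (fun y => u (rV_cons (a, y)) ^+ 6)); last first.
    by apply: eq_Rintegral => y _; rewrite -exprM.
  rewrite (_ : S (fun y => (u (rV_cons (a, y)) ^+ 2) ^+ 2) = S (fun y => `|u (rV_cons (a, y)) ^+ 4|)); last first.
    by apply: eq_Rintegral => y _; rewrite -exprM ger0_norm// (exprM _ 2 2) sqr_ge0.
  move=> h; apply: (le_trans h); rewrite ler_wpM2r ?dirichlet_ge0//.
  have := Rintegral_slice_le_partial a (c1cX 3 cu).1; rewrite -/B => ?; lra.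
- have := Rintegral_partialX_le 2 ord0 cu; rewrite -/B.
  rewrite (_ : S (fun x => (u x ^+ 3) ^+ 2) = S (fun x => u x ^+ 6)); last first.
    by apply: eq_Rintegral => x _; rewrite -exprM.
  move=> h; apply: (le_trans h).
  rewrite (_ : 4%:R ^+ 2 = 16 :> R); last by ring.
  rewrite ler_wpM2l//; first by rewrite mulr_ge0// Rintegral_ge0.
  rewrite /dirichlet sum_ord3 lerDl; apply: sumr_ge0 => i _.
  by apply: Rintegral_ge0 => x _; exact: sqr_ge0.
Qed.

End sobolev.

(** * Test functions *)

Section smooth_functions.
Context {R : realType} {d : nat}.
Implicit Types (f g phi psi : 'rV[R]_d -> R) (Omega : set 'rV[R]_d).

(* [smooth] reorganised as a recursion on the order of differentiation, the form in
   which stability under sums and products is proved by induction. *)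
Fixpoint smoothn (k : nat) f : Prop :=
  (continuous f /\ forall x i, derivable f x (delta_mx 0 i)) /\
  (if k is k'.+1 then forall i, smoothn k' (partial i f) else True).

Lemma smooth_partial f i : smooth f -> smooth (partial i f).
Proof. by move=> sf s; have := sf (rcons s i); rewrite foldr_rcons. Qed.

Lemma smoothnP f : smooth f <-> forall k, smoothn k f.
Proof.
split=> [sf k|sf s].
  elim: k f sf => [|k IH] f sf; split=> //; try exact: (sf [::]).
  by move=> i; apply/IH/smooth_partial.
elim/last_ind: s f sf => [|s i IH] f sf; first by have [] := sf 0%N.
rewrite foldr_rcons; apply: IH => k.
by have [_] := sf k.+1; exact.
Qed.

Lemma smoothnW k f : smoothn k.+1 f -> smoothn k f.
Proof.
elim: k f => [|k IH] f [h1 h2]; split=> // i.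
exact/IH/h2.
Qed.

Lemma smoothnD k f g : smoothn k f -> smoothn k g -> smoothn k (fun x => f x + g x).
Proof.
elim: k f g => [|k IH] f g [[cf df] sf] [[cg dg] sg].
  by split; [split=> x; [exact: (cvgD (cf x) (cg x))|move=> i; exact: (derivableD (df x i) (dg x i))]|exact: I].
split; first by split=> x; [exact: (cvgD (cf x) (cg x))|move=> i; exact: (derivableD (df x i) (dg x i))].
move=> i; rewrite (_ : partial i _ = fun x => partial i f x + partial i g x).
  exact: IH (sf i) (sg i).
by apply/funext => x; rewrite /partial (deriveD (df x i) (dg x i)).
Qed.

Lemma smoothnM k f g : smoothn k f -> smoothn k g -> smoothn k (fun x => f x * g x).
Proof.
elim: k f g => [|k IH] f g sf' sg'; have [[cf df] sf] := sf'; have [[cg dg] sg] := sg'.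
  by split; [split=> x; [exact: (cvgM (cf x) (cg x))|move=> i; exact: (derivableM (df x i) (dg x i))]|exact: I].
split; first by split=> x; [exact: (cvgM (cf x) (cg x))|move=> i; exact: (derivableM (df x i) (dg x i))].
move=> i; rewrite (partialM (fun x => df x i) (fun x => dg x i)).
exact: smoothnD (IH _ _ (smoothnW sf') (sg i)) (IH _ _ (smoothnW sg') (sf i)).
Qed.

Lemma test_function_partial Omega phi i :
  test_function Omega phi -> test_function Omega (partial i phi).
Proof.
move=> [sp cp pO].
(* Off its closed support [phi] vanishes on a whole neighbourhood, hence so does its derivative
   there. *)
have sub : closure [set x | partial i phi x != 0] `<=` closure [set x | phi x != 0].

  have cl := @closed_closure _ [set x | phi x != 0].
  rewrite [X in _ `<=` X]((closure_id _).1 cl); apply: closure_subset => x /= px.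
  apply: contrapT => xS; move/eqP : px; apply; apply: partial_near0.
  have : nbhs x (~` closure [set x | phi x != 0]).
    by apply: open_nbhs_nbhs; split => //; exact: closed_openC.
  apply: filterS => y yS; apply/eqP/negPn/negP => py; apply: yS.
  exact: subset_closure.
split; first exact: smooth_partial.
- by apply: (subclosed_compact _ cp sub); exact: closed_closure.
- exact: subset_trans sub pO.
Qed.

Lemma test_functionM Omega phi psi :
  test_function Omega phi -> test_function Omega psi ->
  test_function Omega (fun x => phi x * psi x).
Proof.
move=> [sp cp pO] [sq _ _].
have sub : closure [set x | phi x * psi x != 0] `<=` closure [set x | phi x != 0].
  by apply: closureS => x /=; apply: contra => /eqP ->; rewrite mul0r.
split.
- by apply/smoothnP => k; apply: smoothnM; move: k; exact/smoothnP.
- by apply: (subclosed_compact _ cp sub); exact: closed_closure.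
- exact: subset_trans sub pO.
Qed.

Lemma test_function_out Omega phi x : test_function Omega phi -> ~ Omega x -> phi x = 0.
Proof.
move=> [_ _ pO] xO; apply/eqP/negPn/negP => px; apply: xO; apply: pO.
exact: subset_closure.
Qed.

Lemma test_function_c1c Omega phi : test_function Omega phi -> exists L, c1c L phi.
Proof.
move=> [sp cp pO]; have [M [_ HM]] := compact_bounded cp.
exists (`|M| + 2); split.
- move=> x Lx; apply/eqP/negPn/negP => px.
  have : `|x| <= `|M| + 1.
    apply: HM; first by have := ler_norm M => ?; lra.
    exact: subset_closure.
  lra.
- exact: (sp [::]).1.
- by move=> i x; exact: (sp [::]).2.
- by move=> i; exact: (sp [:: i]).1.
Qed.

End smooth_functions.

(** * Products of functions in L^6 *)

Section l2norm.
Context d (T : measurableType d) (R : realType) (mu : {measure set T -> \bar R}).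
Variables (D : set T) (mD : measurable D) (muD : (mu D < +oo)%E).
Implicit Types f g : T -> R.

Local Notation "'\I' f" := (Rintegral mu D f) (at level 10, f at level 9).
Local Notation l2 := (l2 mu D).

Definition l2norm f := Num.sqrt (\I (fun x => f x ^+ 2)).

Lemma l2norm_ge0 f : 0 <= l2norm f.
Proof. exact: sqrtr_ge0. Qed.

Lemma Rint_sqr_ge0 f : 0 <= \I (fun x => f x ^+ 2).
Proof. by apply: Rint_ge0 => x _; exact: sqr_ge0. Qed.

Lemma sqr_l2norm f : l2norm f ^+ 2 = \I (fun x => f x ^+ 2).
Proof. by rewrite sqr_sqrtr// Rint_sqr_ge0. Qed.

Lemma eq_l2norm f g : (forall x, D x -> f x = g x) -> l2norm f = l2norm g.
Proof.
by move=> fg; congr Num.sqrt; apply: eq_Rintegral => x; rewrite inE => /fg ->.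
Qed.

Lemma normr_Rint_le f g : l2 f -> l2 g ->
  `|\I (fun x => f x * g x)| <= l2norm f * l2norm g.
Proof.
move=> lf lg; rewrite -(@ler_pXn2r _ 2)// ?nnegrE ?mulr_ge0 ?l2norm_ge0//.
by rewrite real_normK ?num_real// exprMn !sqr_l2norm; exact: cauchy_schwarz.
Qed.

Lemma l2norm_lin (a b : R) f g : l2 f -> l2 g ->
  l2norm (fun x => a * f x + b * g x) <= `|a| * l2norm f + `|b| * l2norm g.
Proof.
move=> lf lg; have a0 := l2norm_ge0 f; have b0 := l2norm_ge0 g.
rewrite -(@ler_pXn2r _ 2)// ?nnegrE ?l2norm_ge0//; last by rewrite addr_ge0// mulr_ge0.
rewrite sqr_l2norm (l2_expand mD a b lf lg) sqrrD !exprMn !sqr_l2norm !real_normK ?num_real//.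
rewrite lerD2r lerD2l; have := normr_Rint_le lf lg; set B := \I _ => hB.
apply: (le_trans (ler_norm _)); rewrite !normrM normr_nat.
have -> : `|a| * l2norm f * (`|b| * l2norm g) *+ 2 = 2 * `|a| * `|b| * (l2norm f * l2norm g).
  by rewrite -mulr_natl; ring.
by rewrite ler_wpM2l// !mulr_ge0.
Qed.

Lemma l2norm_triangle f g : l2 f -> l2 g ->
  l2norm (fun x => f x + g x) <= l2norm f + l2norm g.
Proof.
move=> lf lg; have := l2norm_lin 1 1 lf lg; rewrite normr1 !mul1r.
by congr (_ <= _); apply: eq_l2norm => x _; rewrite !mul1r.
Qed.

Lemma l2norm_triangleB f g : l2 f -> l2 g ->
  l2norm (fun x => f x - g x) <= l2norm f + l2norm g.
Proof.
move=> lf lg; have := l2norm_lin 1 (-1) lf lg; rewrite normrN normr1 !mul1r.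
by congr (_ <= _); apply: eq_l2norm => x _; rewrite mul1r mulN1r.
Qed.

Lemma integrable_cst_fin (c : R) : mu.-integrable D (EFin \o (fun _ : T => c)).
Proof.
apply: measurable_bounded_integrable => //; exists `|c|; split; first exact: num_real.
by move=> M cM x _ /=; exact: ltW.
Qed.

Definition l6 f := measurable_fun D f /\ mu.-integrable D (EFin \o (fun x => f x ^+ 6)).

Lemma expr6_sqr3 (t : R) : t ^+ 6 = t ^+ 2 * t ^+ 2 * t ^+ 2.
Proof. by ring. Qed.

Lemma expr6_ge0 (t : R) : 0 <= t ^+ 6.
Proof. by rewrite (exprM _ 2 3) exprn_ge0// sqr_ge0. Qed.

Lemma l6_l2 f : l6 f -> l2 f.
Proof.
move=> [mf fi]; split=> //.
apply: (@integrable_le _ _ _ mu _ mD _ (fun x => 1 + f x ^+ 6)).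
- exact: measurable_funX.
- by apply: integrable_add => //; exact: integrable_cst_fin.
- move=> x _; rewrite ger0_norm ?sqr_ge0// expr6_sqr3.
  have := sqr_ge0 (f x); set s := f x ^+ 2 => s0.
  by have [s1|s1] := leP s 1; nra.
Qed.

Lemma l6M f g : l6 f -> l6 g -> l2 (fun x => f x * g x).
Proof.
move=> [mf fi] [mg gi]; split; first exact: measurable_funM.
apply: (@integrable_le _ _ _ mu _ mD _ (fun x => 1 + (f x ^+ 6 + g x ^+ 6))).
- by apply: measurable_funX; exact: measurable_funM.
- by apply: integrable_add => //; [exact: integrable_cst_fin|exact: integrable_add].
- move=> x _; rewrite ger0_norm ?sqr_ge0// exprMn !expr6_sqr3.
  have := sqr_ge0 (f x); have := sqr_ge0 (g x).
  set s := f x ^+ 2; set t := g x ^+ 2 => t0 s0.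
  have h (r : R) : 0 <= r -> r * r <= 1 + r * r * r.
    by move=> r0; have [r1|r1] := leP r 1; nra.
  have s3 : 0 <= s * s * s by exact: mulr_ge0 (mulr_ge0 s0 s0) s0.
  have t3 : 0 <= t * t * t by exact: mulr_ge0 (mulr_ge0 t0 t0) t0.
  by have := h _ s0; have := h _ t0; have := sqr_ge0 (s - t) => ? ? ?; lra.
Qed.

Lemma l6_sqrM f g : l6 f -> l6 g -> l2 (fun x => f x ^+ 2 * g x).
Proof.
move=> [mf fi] [mg gi]; split.
  by apply: measurable_funM => //; exact: measurable_funX.
apply: (@integrable_le _ _ _ mu _ mD _ (fun x => f x ^+ 6 + g x ^+ 6)).
- by apply: measurable_funX; apply: measurable_funM => //; exact: measurable_funX.
- exact: integrable_add.
- move=> x _; rewrite ger0_norm ?sqr_ge0// exprMn !expr6_sqr3.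
  have := sqr_ge0 (f x); have := sqr_ge0 (g x).
  set s := f x ^+ 2; set t := g x ^+ 2 => t0 s0; rewrite expr2.
  have s3 : 0 <= s * s * s by exact: mulr_ge0 (mulr_ge0 s0 s0) s0.
  have t3 : 0 <= t * t * t by exact: mulr_ge0 (mulr_ge0 t0 t0) t0.
  have [st|ts] := leP s t.
    have h : 0 <= (t - s) * (t + s) * t.
      by apply: mulr_ge0 => //; apply: mulr_ge0; [rewrite subr_ge0|exact: addr_ge0].
    by lra.
  have h : 0 <= (s - t) * (s * s).
    by apply: mulr_ge0; [rewrite subr_ge0 ltW|exact: mulr_ge0].
  by lra.
Qed.

Lemma expr6D_le (x y : R) : (x + y) ^+ 6 <= 32 * (x ^+ 6 + y ^+ 6).
Proof.
have h1 : (x + y) ^+ 2 <= 2 * (x ^+ 2 + y ^+ 2).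
  by have := sqr_ge0 (x - y) => ?; lra.
rewrite (exprM _ 2 3) !expr6_sqr3; have := sqr_ge0 (x); have := sqr_ge0 (y).
move: h1; set s := x ^+ 2; set t := y ^+ 2; set r := (x + y) ^+ 2 => h1 t0 s0.
have r0 : 0 <= r by exact: sqr_ge0.
apply: (@le_trans _ _ ((2 * (s + t)) ^+ 3)).
  by rewrite lerXn2r// nnegrE (le_trans r0).
have : 0 <= (s + t) * (s - t) ^+ 2 by rewrite mulr_ge0 ?sqr_ge0// addr_ge0.
by move=> ?; lra.
Qed.

Lemma l6D f g : l6 f -> l6 g -> l6 (fun x => f x + g x).
Proof.
move=> [mf fi] [mg gi]; split; first exact: measurable_funD.
apply: (@integrable_le _ _ _ mu _ mD _ (fun x => 32 * (f x ^+ 6 + g x ^+ 6))).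
- by apply: measurable_funX; exact: measurable_funD.
- by apply: integrable_scale => //; exact: integrable_add.
- move=> x _; rewrite ger0_norm ?expr6_ge0//.
  exact: expr6D_le.
Qed.

Lemma l6Z (c : R) f : l6 f -> l6 (fun x => c * f x).
Proof.
move=> [mf fi]; split; first by apply: measurable_funM => //; exact: measurable_cst.
apply: (@integrable_le _ _ _ mu _ mD _ (fun x => c ^+ 6 * f x ^+ 6)).
- by apply: measurable_funX; apply: measurable_funM => //; exact: measurable_cst.
- exact: integrable_scale.
- by move=> x _; rewrite ger0_norm ?expr6_ge0// exprMn.
Qed.

(* Integrate Young's inequality 3 l^2 f^4 g^2 <= 2 l^3 f^6 + g^6 and optimise in [l]. *)
Lemma hoelder_42 f g : l6 f -> l6 g ->
  \I (fun x => (f x ^+ 2 * g x) ^+ 2) ^+ 3 <=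
  \I (fun x => f x ^+ 6) ^+ 2 * \I (fun x => g x ^+ 6).
Proof.
move=> lf lg; have [_ fi] := lf; have [_ gi] := lg; have [_ fgi] := l6_sqrM lf lg.
set X := \I (fun x => _ ^+ 2); set F := \I (fun x => f x ^+ 6); set G := \I _.
have F0 : 0 <= F by apply: Rint_ge0 => x _; exact: expr6_ge0.
have G0 : 0 <= G by apply: Rint_ge0 => x _; exact: expr6_ge0.
have young l : 0 <= l -> 3 * l ^+ 2 * X <= 2 * l ^+ 3 * F + G.
  move=> l0; rewrite -!(RintZ mD)// -RintD//; last exact: integrable_scale.
  apply: Rint_le => //; first exact: integrable_scale.
    by apply: integrable_add => //; exact: integrable_scale.
  move=> x _; rewrite exprMn !expr6_sqr3.
  have := sqr_ge0 (f x); have := sqr_ge0 (g x).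
  set s := f x ^+ 2; set t := g x ^+ 2 => t0 s0.
  have ls : 0 <= l * s by exact: mulr_ge0.
  have : 0 <= (l * s - t) ^+ 2 * (2 * (l * s) + t).
    by rewrite mulr_ge0 ?sqr_ge0// addr_ge0// mulr_ge0.
  move=> h; have -> : 3 * l ^+ 2 * (s ^+ 2 * t) = 3 * (l * s) ^+ 2 * t by ring.
  have -> : 2 * l ^+ 3 * (s * s * s) = 2 * (l * s) ^+ 3 by ring.
  lra.
have [X0|X0] := leP X 0.
  apply: (@le_trans _ _ 0); last by rewrite mulr_ge0 ?sqr_ge0.
  by rewrite exprS mulr_le0_ge0 ?sqr_ge0.
have [F1|F1] := ltP 0 F.
  have XF : 0 <= X / F by rewrite divr_ge0// ltW.
  have := young _ XF.
  have -> : 3 * (X / F) ^+ 2 * X = 3 * (X ^+ 3 / F ^+ 2) by field; lra.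
  have -> : 2 * (X / F) ^+ 3 * F = 2 * (X ^+ 3 / F ^+ 2) by field; lra.
  move=> h; have {}h : X ^+ 3 / F ^+ 2 <= G by lra.
  by rewrite mulrC -ler_pdivrMr// exprn_gt0.
have F2 : F = 0 by apply/le_anti; rewrite F0 F1.
have GX : 0 <= G / X by rewrite divr_ge0// ltW.
(* When [F = 0], Young's inequality reads [3 * l ^+ 2 * X <= G] for all [l >= 0], which this [l]
   violates. *)
have l0 : 0 <= 1 + G / X by lra.
have := young _ l0; rewrite F2 mulr0 add0r => h.
have h2 : 3 * (1 + G / X) * X <= G.
  have : 0 <= (1 + G / X) * (G / X) * X by exact: mulr_ge0 (mulr_ge0 l0 GX) (ltW X0).
  by set q := G / X in h *; move=> ?; lra.
have h3 : 3 * (1 + G / X) * X = 3 * X + 3 * G by field; lra.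
lra.
Qed.

(** The twelfth power of |fg|_2 <= |f|_6 |g|_2^(1/2) |g|_6^(1/2), that is, Hoelder with L^3
    interpolated between L^2 and L^6. One writes (fg)^2 as g times f^2 g, applies Cauchy-Schwarz,
    and then [hoelder_42]. *)
Lemma l6_product f g : l6 f -> l6 g ->
  l2norm (fun x => f x * g x) ^+ 12 <=
  l2norm g ^+ 6 * \I (fun x => f x ^+ 6) ^+ 2 * \I (fun x => g x ^+ 6).
Proof.
move=> lf lg; have lg2 := l6_l2 lg; have lfg := l6_sqrM lf lg.
have h : l2norm (fun x => f x * g x) ^+ 2 <= l2norm g * l2norm (fun x => f x ^+ 2 * g x).
  rewrite sqr_l2norm; apply: le_trans (normr_Rint_le lg2 lfg).
  apply: le_trans (ler_norm _); rewrite le_eqVlt; apply/orP; left; apply/eqP.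
  by apply: eq_Rintegral => x _ /=; ring.
rewrite (exprM _ 2 6).
apply: (@le_trans _ _ ((l2norm g * l2norm (fun x => f x ^+ 2 * g x)) ^+ 6)).
  by rewrite lerXn2r ?nnegrE ?mulr_ge0 ?l2norm_ge0 ?sqr_ge0.
rewrite exprMn -mulrA ler_wpM2l ?exprn_ge0 ?l2norm_ge0//.
by rewrite (exprM _ 2 3) sqr_l2norm; exact: hoelder_42.
Qed.

(** Smallness in L^2 of one factor, with both factors bounded in L^6, makes the product small in
    L^2. This is the continuity of products used in all approximation arguments below. *)
Lemma l6_product_small (M e : R) : 0 < e -> exists2 delta, 0 < delta &
  forall f g, l6 f -> l6 g -> \I (fun x => f x ^+ 6) <= M ->
    \I (fun x => g x ^+ 6) <= M -> l2norm g < delta ->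
    l2norm (fun x => f x * g x) < e.
Proof.
move=> e0; pose K := `|M| + 1; have M0 := normr_ge0 M; have MK := ler_norm M.
have K1 : 1 <= K by rewrite /K; lra.
have K0 : 0 < K by lra.
(* The bound of [l6_product] becomes [(e ^+ 2 / K) ^+ 6 * K ^+ 3 = e ^+ 12 / K ^+ 3], at most
   [e ^+ 12] because [K >= 1]. *)
exists (e ^+ 2 / K); first by rewrite divr_gt0// exprn_gt0.
move=> f g lf lg fM gM gd; rewrite -(@ltr_pXn2r _ 12)// ?nnegrE ?l2norm_ge0 ?ltW//.
apply: (le_lt_trans (l6_product lf lg)).
have F0 : 0 <= \I (fun x => f x ^+ 6) by apply: Rint_ge0 => x _; exact: expr6_ge0.
have G0 : 0 <= \I (fun x => g x ^+ 6) by apply: Rint_ge0 => x _; exact: expr6_ge0.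
have n0 := l2norm_ge0 g.
apply: (@le_lt_trans _ _ (l2norm g ^+ 6 * K ^+ 3)).
  rewrite -mulrA ler_wpM2l ?exprn_ge0// [K ^+ 3]exprSr; apply: ler_pM => //.
  - exact: sqr_ge0.
  - by rewrite lerXn2r ?nnegrE ?(ltW K0)//; apply: (le_trans fM); rewrite /K; lra.
  - by apply: (le_trans gM); rewrite /K; lra.
apply: (@lt_le_trans _ _ ((e ^+ 2 / K) ^+ 6 * K ^+ 3)).
  have d0 : 0 <= e ^+ 2 / K by rewrite divr_ge0 ?sqr_ge0// ltW.
  by rewrite ltr_pM2r ?exprn_gt0// ltr_pXn2r// nnegrE.
have -> : (e ^+ 2 / K) ^+ 6 * K ^+ 3 = e ^+ 12 / K ^+ 3 by field; lra.
rewrite ler_pdivrMr ?exprn_gt0//; apply: ler_peMr; last exact: exprn_ege1.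
exact: exprn_ge0 (ltW e0).
Qed.

End l2norm.

(** * Test functions on a bounded open set: integrability, integration by parts, Sobolev
    inequality *)

Section test_functions.
Context {R : realType} {d : nat}.
Variables (Omega : set 'rV[R]_d) (oO : open Omega) (bO : bounded_set Omega).
Local Notation mu := (@lebesgue_rV R d).
Local Notation I f := (Rintegral mu Omega f).
Local Notation test := (test_function Omega).

Lemma measurable_domain : measurable Omega.
Proof. exact: open_measurable_rV. Qed.

Lemma measure_domain_lty : (mu Omega < +oo)%E.
Proof.
have [M [_ HM]] := bO.
apply: le_lt_trans (lebesgue_rV_ball_lty d (`|M| + 2)).
apply: le_measure; rewrite ?inE; [exact: measurable_domain|exact: measurable_ball_rV|].
move=> x /HM h; rewrite -ball_normE /ball_ /= sub0r normrN.
apply: (@le_lt_trans _ _ (`|M| + 1)); last by rewrite ltrD2l ltr1n.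
by apply: h; have := ler_norm M => ?; lra.
Qed.

Lemma Rint_setT (f : 'rV[R]_d -> R) : (forall x, ~ Omega x -> f x = 0) ->
  Rintegral mu setT f = I f.
Proof.
move=> f0; rewrite [RHS]Rintegral_mkcond; apply: eq_Rintegral => x _.
by rewrite patchE; case: ifPn => // /negP; rewrite inE => /f0.
Qed.

Lemma test_l6 phi : test phi -> l6 mu Omega phi.
Proof.
move=> tp; have [L cp] := test_function_c1c tp; have [_ cphi _ _] := cp.
split; first exact: measurable_funTS (continuous_measurable_rV cphi).
apply: (@integrableS _ _ _ mu setT Omega) => //; first exact: measurable_domain.
exact: (c0c_integrable (c1c_c0c (c1cX 5 cp).1)).
Qed.

Lemma test_l2 phi : test phi -> l2 mu Omega phi.
Proof.
move=> /test_l6; apply: l6_l2; [exact: measurable_domain|exact: measure_domain_lty].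
Qed.

(** The sum of the two integrands is the derivative of [phi * psi], whose integral can be taken over
    the whole space, where [integral_partial0] applies. *)
Lemma test_ibp phi psi j : test phi -> test psi ->
  I (fun x => phi x * partial j psi x) = - I (fun x => partial j phi x * psi x).
Proof.
move=> tp tq; have mO := measurable_domain.
apply/eqP; rewrite -subr_eq0 opprK; apply/eqP.
have tdp := test_function_partial j tp; have tdq := test_function_partial j tq.
rewrite -RintD//; try by apply: l2M => //; exact: test_l2.
have tpq := test_functionM tp tq; have [L cpq] := test_function_c1c tpq.
have dp x : derivable phi x (delta_mx 0 j) by have [sp _ _] := tp; exact: (sp [::]).2.
have dq x : derivable psi x (delta_mx 0 j) by have [sq _ _] := tq; exact: (sq [::]).2.
rewrite (_ : (fun x => _) = partial j (fun x => phi x * psi x)); last first.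
  by rewrite (partialM dp dq); apply/funext => x; ring.
rewrite -Rint_setT; last first.
  by move=> x; exact/test_function_out/test_function_partial.
by rewrite /Rintegral (integral_partial0 j cpq).
Qed.

End test_functions.

(** Dimension 3 is the scale-invariant case, with an absolute constant. In dimension 2 the two sides
    scale differently, so the constant carries the measure of [Omega]. *)
Lemma sobolev_test {R : realType} d (Omega : set 'rV[R]_d) :
  d = 2%N \/ d = 3%N -> open Omega -> bounded_set Omega ->
  exists S : R, 0 <= S /\ forall phi, test_function Omega phi ->
    Rintegral (lebesgue_rV d) Omega (fun x => phi x ^+ 6) <=
    S * (\sum_j l2norm (lebesgue_rV d) Omega (partial j phi) ^+ 2) ^+ 3.
Proof.
move=> hd oO bO; have mO := measurable_domain oO.
have E phi : test_function Omega phi -> dirichlet phi =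
    \sum_j l2norm (lebesgue_rV d) Omega (partial j phi) ^+ 2.
  move=> tp; apply: eq_bigr => j _; rewrite sqr_l2norm (Rint_setT (Omega := Omega))// => x xO.
  by rewrite (test_function_out (test_function_partial j tp) xO) expr0n.
have E0 k phi : test_function Omega phi ->
    Rintegral (lebesgue_rV d) setT (fun x => phi x ^+ k.+1) =
    Rintegral (lebesgue_rV d) Omega (fun x => phi x ^+ k.+1).
  by move=> tp; rewrite (Rint_setT (Omega := Omega))// => x xO; rewrite (test_function_out tp xO) expr0n.
case: hd => ed.
  (* Written with [1 ^+ 2] so that [m] is literally the second factor in Cauchy-Schwarz for
     [phi ^+ 2] against 1, which is the hypothesis of [sobolev_2d]. *)
  pose m := Rintegral (lebesgue_rV d) Omega (fun _ => 1 ^+ 2).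
  have m0 : 0 <= m by apply: Rint_sqr_ge0.
  exists (144 * m); split; first by rewrite mulr_ge0.
  move=> phi tp; have [L cp] := test_function_c1c tp.
  rewrite -E// -E0//; subst d; apply: (sobolev_2d cp m0).
  rewrite !E0// mulrC.
  have l1 : l2 (lebesgue_rV 2) Omega (fun _ => 1).
    by split; [exact: measurable_cst|apply: integrable_cst_fin => //; exact: measure_domain_lty].
  have := cauchy_schwarz mO (test_l2 oO bO (test_functionM tp tp)) l1.
  congr (_ ^+ 2 <= _ * _); apply: eq_Rintegral => x _; ring.
exists (36 ^+ 2); split; first exact: sqr_ge0.
move=> phi tp; have [L cp] := test_function_c1c tp.
by rewrite -E// -E0//; subst d; exact: (sobolev_3d cp).
Qed.

(** * The space H^1_0 *)

(** Passage to the limit in approximations: restricting to [e <= 1] allows higher powers of [e] to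
    be absorbed into a linear error. *)
Lemma ler_forall_eps {R : realFieldType} (x y c : R) : 0 <= c ->
  (forall e, 0 < e -> e <= 1 -> x <= y + c * e) -> x <= y.
Proof.
move=> c0 H; apply/ler_addgt0Pr => e e0.
pose t := Num.min 1 (e / (c + 1)).
have c1 : 0 < c + 1 by lra.
have t0 : 0 < t by rewrite /t lt_min ltr01 divr_gt0.
apply: (le_trans (H t t0 _)); first by rewrite ge_min lexx.
rewrite lerD2l; apply: (@le_trans _ _ ((c + 1) * t)).
  by rewrite ler_wpM2r ?(ltW t0)//; lra.
by rewrite mulrC -ler_pdivlMr// ge_min lexx orbT.
Qed.

Section H10.
Context {R : realType} {d : nat}.
Variables (Omega : set 'rV[R]_d) (oO : open Omega) (bO : bounded_set Omega).
Local Notation mu := (@lebesgue_rV R d).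
Local Notation I f := (Rintegral mu Omega f).
Local Notation test := (test_function Omega).
Local Notation l2 := (l2 mu Omega).
Local Notation l6 := (l6 mu Omega).
Local Notation nrm := (l2norm mu Omega).

Let mO : measurable Omega := measurable_domain oO.
Let muO : (mu Omega < +oo)%E := measure_domain_lty oO bO.

Definition weak_grad (a : 'rV[R]_d -> R) (G : 'I_d -> 'rV[R]_d -> R) :=
  forall j psi, test psi ->
    I (fun x => a x * partial j psi x) = - I (fun x => G j x * psi x).

(* The scalar function [a] belongs to H^1_0 and [G] is one of its weak gradients.
   The approximation of [a] by test functions is phrased with some weak gradient
   [H] of the difference, as weak gradients are not known to be unique. *)
Definition h10 (a : 'rV[R]_d -> R) (G : 'I_d -> 'rV[R]_d -> R) :=
  [/\ l2 a, forall j, l2 (G j), weak_grad a G &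
    forall e, 0 < e -> exists phi H, [/\ test phi, forall j, l2 (H j),
      weak_grad (fun x => a x - phi x) H, nrm (fun x => a x - phi x) < e &
      forall j, nrm (H j) < e]].

Lemma test_h10 phi : test phi -> h10 phi (fun j => partial j phi).
Proof.
move=> tp; split; first exact: (test_l2 oO bO).
- by move=> j; apply: (test_l2 oO bO); exact: test_function_partial.
- by move=> j psi tq; exact: (test_ibp oO bO).
- have I0 (f : 'rV[R]_d -> R) : (forall x, f x = 0) -> I f = 0.
    move=> f0; rewrite (_ : f = fun _ => 0); last exact/funext.
    by rewrite /Rintegral integral0.
  have n0 (f : 'rV[R]_d -> R) : (forall x, f x = 0) -> nrm f = 0.
    by move=> f0; rewrite /l2norm I0 ?sqrtr0// => x; rewrite f0 expr0n.
  move=> e e0; exists phi, (fun _ _ => 0); split => //.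
  + move=> j; split; first exact: measurable_cst.
    by apply: (@eq_integrable _ _ _ mu _ mO (cst 0%E)) => //;
      [by move=> x _; rewrite expr0n|exact: integrable0].
  + move=> j psi _; rewrite !I0 ?oppr0// => x; last by rewrite subrr mul0r.
    by rewrite mul0r.
  + by rewrite n0// => x; rewrite subrr.
  + by move=> j; rewrite n0.
Qed.

(* [partial j phi] is a test function, so its own L^2 norm can be computed by pairing it
   with [G j - H j]. *)
Lemma h10_approx a G : h10 a G -> forall e, 0 < e ->
  exists phi H, [/\ test phi, forall j, l2 (H j),
    forall j psi, test psi -> I (fun x => partial j phi x * psi x) =
      I (fun x => (G j x - H j x) * psi x),
    nrm (fun x => a x - phi x) < e &
    forall j, nrm (H j) < e /\ nrm (partial j phi) <= nrm (G j) + e].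
Proof.
move=> [la lG wG ap] e e0; have [phi [H [tp lH wH ae He]]] := ap e e0.
exists phi, H; have E j psi : test psi -> I (fun x => partial j phi x * psi x) =
    I (fun x => (G j x - H j x) * psi x).
  move=> tq; have tdq := test_function_partial j tq; have tdp := test_function_partial j tp.
  have lq := test_l2 oO bO tq; have ldq := test_l2 oO bO tdq.
  have ldp := test_l2 oO bO tdp; have lp := test_l2 oO bO tp.
  have h1 := wG j psi tq; have h2 := wH j psi tq; have h3 := test_ibp oO bO j tp tq.
  have i1 := l2M mO la ldq; have i2 := l2M mO lp ldq.
  have i3 := l2M mO (lG j) lq; have i4 := l2M mO (lH j) lq.
  move: h2; rewrite (_ : (fun x => (a x - phi x) * _) =
    fun x => a x * partial j psi x + (-1) * (phi x * partial j psi x)); last first.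
    by apply/funext => x; ring.
  rewrite RintD ?RintZ//; last exact: integrable_scale.
  rewrite h1 h3.
  rewrite (_ : (fun x => (G j x - H j x) * _) =
    fun x => G j x * psi x + (-1) * (H j x * psi x)); last first.
    by apply/funext => x; ring.
  rewrite RintD ?RintZ//; last exact: integrable_scale.
  by move=> ?; lra.
split => // j; split; first exact: He.
have tdp := test_function_partial j tp; have ldp := test_l2 oO bO tdp.
have lGH := l2B mO (lG j) (lH j).
apply: (@le_trans _ _ (nrm (fun x => G j x - H j x))); last first.
  apply: (le_trans (l2norm_triangleB mO (lG j) (lH j))).
  by rewrite lerD2l; exact: ltW.
have := normr_Rint_le mO lGH ldp; rewrite -E//.
have -> : I (fun x => partial j phi x * partial j phi x) = nrm (partial j phi) ^+ 2.
  by rewrite sqr_l2norm.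
rewrite ger0_norm ?sqr_ge0// expr2.
have := l2norm_ge0 mu Omega (partial j phi).
rewrite le_eqVlt => /orP[/eqP <- _|n0]; first exact: l2norm_ge0.
by rewrite ler_pM2r.
Qed.

Variables (S : R) (S0 : 0 <= S).
Hypothesis sob : forall phi, test phi -> I (fun x => phi x ^+ 6) <=
  S * (\sum_j nrm (partial j phi) ^+ 2) ^+ 3.

Definition gradnorm2 (G : 'I_d -> 'rV[R]_d -> R) := \sum_j nrm (G j) ^+ 2.

Lemma gradnorm2_ge0 G : 0 <= gradnorm2 G.
Proof. by apply: sumr_ge0 => j _; exact: sqr_ge0. Qed.

(** 32 = 2^3 * 4: first (s + e)^2 <= 2 s^2 + 2 e for each component, then (x + y)^3 <= 4 (x^3 +
    y^3). Both [e ^+ 2] and [e ^+ 3] are bounded by [e], which keeps the error linear. *)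
Lemma Rint6_approx_le G phi e : e <= 1 -> 0 < e -> test phi ->
  (forall j, nrm (partial j phi) <= nrm (G j) + e) ->
  I (fun x => phi x ^+ 6) <= 32 * S * gradnorm2 G ^+ 3 + 32 * S * d%:R ^+ 3 * e.
Proof.
move=> e1 e0 tp H; apply: (le_trans (sob tp)).
have D0 := gradnorm2_ge0 G.
set X := \sum_j _.
have X0 : 0 <= X by apply: sumr_ge0 => j _; exact: sqr_ge0.
have de : 0 <= d%:R * e by rewrite mulr_ge0// ltW.
have XD : X <= 2 * gradnorm2 G + 2 * (d%:R * e).
  rewrite -mulr_natl in de *.
  apply: (@le_trans _ _ (\sum_(j < d) (2 * nrm (G j) ^+ 2 + 2 * e))).
    apply: ler_sum => j _; apply: (@le_trans _ _ ((nrm (G j) + e) ^+ 2)).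
      by rewrite lerXn2r ?nnegrE ?addr_ge0 ?l2norm_ge0// ltW.
    have := sqr_ge0 (nrm (G j) - e) => ?; have : e ^+ 2 <= e by nra.
    by move=> ?; lra.
  rewrite big_split /= -mulr_sumr sumr_const card_ord -mulr_natl.
  by rewrite lerD2l; lra.
rewrite -!mulrA [32 * _]mulrCA [32 * (S * _)]mulrCA -mulrDr ler_wpM2l//.
set D := gradnorm2 G in D0 XD *; set k := d%:R in de XD *.
apply: (@le_trans _ _ ((2 * D + 2 * (k * e)) ^+ 3)).
  by rewrite lerXn2r// nnegrE// (le_trans X0).
have : 0 <= (D + k * e) * (D - k * e) ^+ 2 by rewrite mulr_ge0 ?sqr_ge0// addr_ge0.
have k0 : 0 <= k by rewrite ler0n.
have : k ^+ 3 * e ^+ 3 <= k ^+ 3 * e.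
  by rewrite ler_wpM2l ?exprn_ge0// exprS ler_piMr ?(ltW e0)// exprn_ile1// ltW.
move=> h1 h2; lra.
Qed.

(** The truncation is only integrated, never differentiated: being bounded it is integrable before
    anything is known about [a ^+ 6]. *)
Definition trunc6 (a : 'rV[R]_d -> R) (K : R) x := Num.min `|a x| K ^+ 6.

Lemma trunc6_measurable a K : measurable_fun Omega a -> measurable_fun Omega (trunc6 a K).
Proof.
move=> ma; apply: measurable_funX; apply: measurable_minr; last exact: measurable_cst.
exact: measurableT_comp.
Qed.

Lemma trunc6_integrable a K : 0 <= K -> measurable_fun Omega a ->
  mu.-integrable Omega (EFin \o trunc6 a K).
Proof.
move=> K0 ma; apply: (integrable_le mO _ (integrable_cst_fin mO muO (K ^+ 6))).
  exact: trunc6_measurable.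
move=> x _; rewrite ger0_norm ?expr6_ge0// lerXn2r// ?nnegrE//.
  by rewrite le_min normr_ge0.
by rewrite ge_min lexx orbT.
Qed.

(** With b = min(|a|, K), convexity gives b^6 <= phi^6 + 6 b^5 (b - |phi|), and the last term is at
    most 6 K^5 |a - phi|. The L^2 distance to [phi] thus enters with a factor depending on [K], and
    disappears as [e] tends to 0, leaving a bound independent of [K]. *)
Lemma trunc6_le a G K : h10 a G -> 0 <= K -> I (trunc6 a K) <= 32 * S * gradnorm2 G ^+ 3.
Proof.
move=> ha K0; have [la lG _ _] := ha.
have l1 : l2 (fun _ => 1).
  by split; [exact: measurable_cst|exact: integrable_cst_fin].
pose c1 := 6 * K ^+ 5 * nrm (fun _ => 1).
have K5 : 0 <= 6 * K ^+ 5 by rewrite mulr_ge0// exprn_ge0.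
have c10 : 0 <= c1 by rewrite mulr_ge0 ?l2norm_ge0.
apply: (@ler_forall_eps _ _ _ (32 * S * d%:R ^+ 3 + c1)).
  by rewrite addr_ge0// !mulr_ge0// exprn_ge0.
move=> e e0 e1; have [phi [H [tp lH _ ae He]]] := h10_approx ha e0.
have cube := Rint6_approx_le e1 e0 tp (fun j => (He j).2).
have lap := l2B mO la (test_l2 oO bO tp).
have [lphi iphi] := test_l6 oO tp.
have lab : l2 (fun x => `|a x - phi x|).
  have [m1 i1] := lap; split; first exact: measurableT_comp.
  by apply: eq_integrable i1 => // x _ /=; rewrite real_normK ?num_real.
have iabs : mu.-integrable Omega (EFin \o (fun x => `|a x - phi x| * 1)).
  exact: l2M.
have nabs : I (fun x => `|a x - phi x| * 1) <= e * nrm (fun _ => 1).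
  apply: le_trans (ler_norm _) _; apply: le_trans (normr_Rint_le mO lab l1) _.
  rewrite ler_wpM2r ?l2norm_ge0//; apply: le_trans (ltW ae).
  rewrite le_eqVlt; apply/orP; left; apply/eqP; rewrite /l2norm; congr Num.sqrt.
  by apply: eq_Rintegral => x _; rewrite real_normK ?num_real.
apply: (@le_trans _ _ (I (fun x => phi x ^+ 6 + 6 * K ^+ 5 * (`|a x - phi x| * 1)))).
  apply: Rint_le => //.
  - by apply: trunc6_integrable => //; case: la.
  - by apply: integrable_add => //; exact: integrable_scale.
  move=> x _; rewrite /trunc6 mulr1.
  set b := Num.min _ _.
  have b0 : 0 <= b by rewrite /b le_min normr_ge0.
  have bK : b <= K by rewrite /b ge_min lexx orbT.
  have ba : b <= `|a x| by rewrite /b ge_min lexx.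
  have ab : `|a x| - `|phi x| <= `|a x - phi x| by exact: lerB_dist.
  (* convexity of the sixth power *)
  have cvx : 0 <= (`|phi x| - b) ^+ 2 *
      ((`|phi x| ^+ 2 + `|phi x| * b) ^+ 2 + 2 * (`|phi x| * b + b ^+ 2) ^+ 2 + 3 * (b ^+ 2) ^+ 2).
    apply: mulr_ge0; first exact: sqr_ge0.
    by apply: addr_ge0; [apply: addr_ge0; [exact: sqr_ge0|]|];
      apply: mulr_ge0 => //; exact: sqr_ge0.
  have -> : phi x ^+ 6 = `|phi x| ^+ 6.
    by rewrite !(exprM _ 2 3) real_normK ?num_real.
  have b5 : 0 <= 6 * b ^+ 5 by rewrite mulr_ge0// exprn_ge0.
  have h1 : 6 * b ^+ 5 * (b - `|phi x|) <= 6 * b ^+ 5 * `|a x - phi x|.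
    by rewrite ler_wpM2l//; lra.
  have h2 : 6 * b ^+ 5 * `|a x - phi x| <= 6 * K ^+ 5 * `|a x - phi x|.
    by rewrite ler_wpM2r// ler_wpM2l// lerXn2r// nnegrE.
  lra.
rewrite RintD ?RintZ//; last exact: integrable_scale.
have : 6 * K ^+ 5 * I (fun x => `|a x - phi x| * 1) <= 6 * K ^+ 5 * (e * nrm (fun _ => 1)).
  by rewrite ler_wpM2l.
rewrite /c1 => ?; lra.
Qed.

(** Monotone convergence over the truncation levels: their uniform bound yields both the
    integrability of [a ^+ 6] and the estimate. *)
Lemma h10_l6 a G : h10 a G ->
  l6 a /\ I (fun x => a x ^+ 6) <= 32 * S * gradnorm2 G ^+ 3.
Proof.
move=> ha; have [[ma ia] _ _ _] := ha.
pose g (n : nat) x := (trunc6 a n%:R x)%:E.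
have mg n : measurable_fun Omega (g n).
  by apply/measurable_EFinP; exact: trunc6_measurable.
have g0 n x : Omega x -> (0 <= g n x)%E.
  by move=> _; rewrite lee_fin; exact: expr6_ge0.
have ndg x : Omega x -> {homo g^~ x : n m / (n <= m)%N >-> (n <= m)%E}.
  move=> _ n m nm; rewrite lee_fin; apply: lerXn2r; rewrite ?nnegrE ?le_min ?normr_ge0 ?ler0n//.
  by rewrite !ge_min lexx ler_nat nm orbT.
have cv : (fun n => (\int[mu]_(x in Omega) g n x)%E) @ \oo -->
    (\int[mu]_(x in Omega) (a x ^+ 6)%:E)%E.
  rewrite (_ : (\int[mu]_(x in Omega) (a x ^+ 6)%:E)%E =
    (\int[mu]_(x in Omega) limn (g^~ x))%E); first exact: cvg_monotone_convergence.
  (* Pointwise the truncations are constant from level [|a x|] on. *)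
  apply: eq_integral => x _; apply/esym; apply: lim_near_cst => //.
  near=> n; rewrite /g /trunc6 min_l; last by near: n; exact: nbhs_infty_ger.
  by rewrite !(exprM _ 2 3) real_normK ?num_real.
have le : (\int[mu]_(x in Omega) (a x ^+ 6)%:E <= (32 * S * gradnorm2 G ^+ 3)%:E)%E.
  rewrite -(cvg_lim _ cv)//; apply: lime_le; first by apply/cvg_ex; eexists; exact: cv.
  apply: nearW => n; rewrite -EFin_Rintegral//; last exact: trunc6_integrable.
  by rewrite lee_fin; exact: trunc6_le.
have ia6 : mu.-integrable Omega (EFin \o (fun x => a x ^+ 6)).
  apply/integrableP; split; first by apply/measurable_EFinP; exact: measurable_funX.
  rewrite (_ : (\int[mu]_(x in Omega) _)%E = (\int[mu]_(x in Omega) (a x ^+ 6)%:E)%E).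
    by apply: le_lt_trans le _; rewrite ltry.
  by apply: eq_integral => x _ /=; rewrite ger0_norm ?expr6_ge0.
by split=> //; rewrite -lee_fin EFin_Rintegral.
Unshelve. all: by end_near. Qed.

End H10.

(** * Products of functions of H^1_0 as L^2-limits of test functions *)

Section H10_products.
Context {R : realType} {d : nat}.
Variables (Omega : set 'rV[R]_d) (oO : open Omega) (bO : bounded_set Omega).
Local Notation mu := (@lebesgue_rV R d).
Local Notation I f := (Rintegral mu Omega f).
Local Notation test := (test_function Omega).
Local Notation l2 := (l2 mu Omega).
Local Notation l6 := (l6 mu Omega).
Local Notation nrm := (l2norm mu Omega).
Local Notation h10 := (h10 Omega).
Local Notation gradnorm2 := (gradnorm2 Omega).

Let mO : measurable Omega := measurable_domain oO.
Let muO : (mu Omega < +oo)%E := measure_domain_lty oO bO.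

Variables (S : R) (S0 : 0 <= S).
Hypothesis sob : forall a G, h10 a G ->
  l6 a /\ I (fun x => a x ^+ 6) <= S * gradnorm2 G ^+ 3.

Lemma Rint6_ge0 (f : 'rV[R]_d -> R) : 0 <= I (fun x => f x ^+ 6).
Proof. by apply: Rint_ge0 => x _; exact: expr6_ge0. Qed.

Lemma RintB_l2 f g h : l2 f -> l2 g -> l2 h ->
  I (fun x => f x * (g x - h x)) = I (fun x => f x * g x) - I (fun x => f x * h x).
Proof.
move=> lf lg lh; have i1 := l2M mO lf lg; have i2 := l2M mO lf lh.
rewrite (_ : (fun x => f x * (g x - h x)) = fun x => f x * g x + (-1) * (f x * h x)); last first.
  by apply/funext => x; ring.
rewrite RintD ?RintZ//; last exact: integrable_scale.
by rewrite mulN1r.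
Qed.

Lemma l6B f g : l6 f -> l6 g -> l6 (fun x => f x - g x).
Proof.
move=> lf /(l6Z mO (-1)) lg; have := l6D mO lf lg.
by under eq_fun do rewrite mulN1r.
Qed.

Lemma Rint6_subr_le f g : l6 f -> l6 g ->
  I (fun x => (f x - g x) ^+ 6) <= 32 * (I (fun x => f x ^+ 6) + I (fun x => g x ^+ 6)).
Proof.
move=> lf lg; have [_ fi] := lf; have [_ gi] := lg; have [_ fgi] := l6B lf lg.
rewrite -RintD// -RintZ//; last exact: integrable_add.
apply: Rint_le => //; first by apply: integrable_scale => //; exact: integrable_add.
move=> x _; have := expr6D_le (f x) (- g x).
by rewrite !(exprM (- _) 2 3) sqrrN -exprM.
Qed.

(** The bound [M] is fixed before [e]. Capping the accuracy at 1 keeps the gradients of all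
    approximants below [nrm (G j) + 1], so Sobolev bounds their L^6 norms uniformly, as
    [l6_product_small] requires. *)
Lemma h10_approx6 a G : h10 a G -> exists2 M, 0 <= M & forall e, 0 < e ->
  exists phi H, [/\ test phi, forall j, l2 (H j),
    forall j psi, test psi -> I (fun x => partial j phi x * psi x) =
      I (fun x => (G j x - H j x) * psi x),
    nrm (fun x => a x - phi x) < e /\ (forall j, nrm (H j) < e) &
    [/\ I (fun x => a x ^+ 6) <= M, I (fun x => phi x ^+ 6) <= M &
      I (fun x => (a x - phi x) ^+ 6) <= M]].
Proof.
move=> ha; have [la6 _] := sob ha.
pose A := I (fun x => a x ^+ 6); have A0 : 0 <= A by exact: Rint6_ge0.
pose B := S * (\sum_j (nrm (G j) + 1) ^+ 2) ^+ 3.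
have B0 : 0 <= B.
  by rewrite mulr_ge0// exprn_ge0// sumr_ge0// => j _; exact: sqr_ge0.
exists (32 * (A + B)); first by rewrite mulr_ge0// addr_ge0.
move=> e e0; have e1 : 0 < Num.min e 1 by rewrite lt_min e0 ltr01.
have [phi [H [tp lH E ae He]]] := h10_approx oO bO ha e1.
have phiB : I (fun x => phi x ^+ 6) <= B.
  apply: (le_trans (sob (test_h10 oO bO tp)).2); rewrite ler_wpM2l//.
  have h : gradnorm2 (fun j => partial j phi) <= \sum_j (nrm (G j) + 1) ^+ 2.
    apply: ler_sum => j _; apply: lerXn2r; rewrite ?nnegrE ?addr_ge0 ?l2norm_ge0//.
    by apply: (le_trans (He j).2); rewrite lerD2l ge_min lexx orbT.
  by apply: lerXn2r; rewrite ?nnegrE ?(le_trans _ h)//; exact: gradnorm2_ge0.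
exists phi, H; split => //.
  split; first by apply: lt_le_trans ae _; rewrite ge_min lexx.
  by move=> j; apply: lt_le_trans (He j).1 _; rewrite ge_min lexx.
have dM := Rint6_subr_le la6 (test_l6 oO tp); rewrite -/A in dM *.
by split; lra.
Qed.

(** The witness is a product of approximants, and bc - chi psi = c (b - chi) + chi (c - psi); in
    each term one factor is small in L^2 and both are bounded in L^6. *)
Lemma h10M_closure b Gb c Gc : h10 b Gb -> h10 c Gc -> forall e, 0 < e ->
  exists2 theta, test theta & nrm (fun x => b x * c x - theta x) < e.
Proof.
move=> hb hc e e0.
have [lb _] := sob hb; have [lc _] := sob hc.
have [Mb Mb0 ab] := h10_approx6 hb; have [Mc Mc0 ac] := h10_approx6 hc.
have e2 : 0 < e / 2 by lra.
have [del del0 small] := l6_product_small mO muO (Mb + Mc) e2.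
have [chi [Hb [tchi _ _ [bn _] [b6 chi6 bchi6]]]] := ab _ del0.
have [psi [Hc [tpsi _ _ [cn _] [c6 psi6 cpsi6]]]] := ac _ del0.
have lchi := test_l6 oO tchi; have lpsi := test_l6 oO tpsi.
exists (fun x => chi x * psi x); first exact: test_functionM.
have h1 : nrm (fun x => c x * (b x - chi x)) < e / 2.
  by apply: small => //; [exact: l6B|lra|lra].
have h2 : nrm (fun x => chi x * (c x - psi x)) < e / 2.
  by apply: small => //; [exact: l6B|lra|lra].
have t := l2norm_triangle mO (l6M mO muO lc (l6B lb lchi)) (l6M mO muO lchi (l6B lc lpsi)).
rewrite (@eq_l2norm _ _ _ _ _ _ (fun x => c x * (b x - chi x) + chi x * (c x - psi x))).
  by apply: (le_lt_trans t); lra.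
by move=> x _; ring.
Qed.

Lemma weakly0_closure Z q : l2 Z -> l2 q ->
  (forall theta, test theta -> I (fun x => Z x * theta x) = 0) ->
  (forall e, 0 < e -> exists2 theta, test theta & nrm (fun x => q x - theta x) < e) ->
  I (fun x => Z x * q x) = 0.
Proof.
move=> lZ lq Z0 cl; apply/eqP; rewrite -normr_le0.
apply: (@ler_forall_eps _ _ _ (nrm Z)); first exact: l2norm_ge0.
move=> e e0 _; rewrite add0r; have [th tth qth] := cl e e0.
have lth := test_l2 oO bO tth.
have := RintB_l2 lZ lq lth; rewrite (Z0 _ tth) subr0 => <-.
apply: (le_trans (normr_Rint_le mO lZ (l2B mO lq lth))).
by rewrite ler_wpM2l ?l2norm_ge0// ltW.
Qed.

Lemma h10M_l2 a Ga b Gb : h10 a Ga -> h10 b Gb -> l2 (fun x => a x * b x).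
Proof. by move=> /sob[la _] /sob[lb _]; exact: l6M. Qed.

(** [partial j phi] and [G j - H j] are not known to agree almost everywhere; what is known is that
    their difference annihilates test functions, and this suffices for every [q] in the
    L^2-closure. *)
Lemma approx_grad_closure a G phi H j q : h10 a G -> test phi -> (forall j, l2 (H j)) ->
  (forall j psi, test psi -> I (fun x => partial j phi x * psi x) =
      I (fun x => (G j x - H j x) * psi x)) -> l2 q ->
  (forall e, 0 < e -> exists2 theta, test theta & nrm (fun x => q x - theta x) < e) ->
  I (fun x => partial j phi x * q x) = I (fun x => G j x * q x) - I (fun x => H j x * q x).
Proof.
move=> [_ lG _ _] tp lH E lq cl.
have ldp := test_l2 oO bO (test_function_partial j tp).
have lGH := l2B mO (lG j) (lH j).
have C (f g h : 'rV[R]_d -> R) : l2 f -> l2 g -> l2 h ->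
    I (fun x => (f x - g x) * h x) = I (fun x => f x * h x) - I (fun x => g x * h x).
  move=> lf lg lh; rewrite (_ : (fun x => _) = fun x => h x * (f x - g x)); last first.
    by apply/funext => x; ring.
  by rewrite RintB_l2//; congr (_ - _); apply: eq_Rintegral => x _; rewrite mulrC.
have := @weakly0_closure (fun x => partial j phi x - (G j x - H j x)) q.
rewrite C// C//; move=> h; apply/eqP; rewrite -subr_eq0; apply/eqP; apply: h => //.
  exact: l2B.
move=> th tth; have lth := test_l2 oO bO tth.
by rewrite C// E// subrr.
Qed.

End H10_products.

(** * Integration by parts, interpolation and Poincare inequality in H^1_0 *)

Section H10_estimates.
Context {R : realType} {d : nat}.
Variables (Omega : set 'rV[R]_d) (oO : open Omega) (bO : bounded_set Omega).
Local Notation mu := (@lebesgue_rV R d).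
Local Notation I f := (Rintegral mu Omega f).
Local Notation test := (test_function Omega).
Local Notation l2 := (l2 mu Omega).
Local Notation l6 := (l6 mu Omega).
Local Notation nrm := (l2norm mu Omega).
Local Notation h10 := (h10 Omega).
Local Notation gradnorm2 := (gradnorm2 Omega).

Let mO : measurable Omega := measurable_domain oO.
Let muO : (mu Omega < +oo)%E := measure_domain_lty oO bO.

Variables (S : R) (S0 : 0 <= S).
Hypothesis sob : forall a G, h10 a G ->
  l6 a /\ I (fun x => a x ^+ 6) <= S * gradnorm2 G ^+ 3.


Lemma normr_le_sum5 (x1 x2 x3 x4 x5 : R) :
  `|x1 + x2 + x3 + x4 + x5| <= `|x1| + `|x2| + `|x3| + `|x4| + `|x5|.
Proof.
by do 4 (apply: (le_trans (ler_normD _ _)); rewrite lerD2r).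
Qed.

Lemma ibp_error_split (a1 a2 a3 b1 b2 b3 h1 h2 : R) :
  b1 - h1 + (b2 - h2) + b3 = 0 ->
  a1 + a2 + a3 = a1 - b1 + (a2 - b2) + (a3 - b3) + h1 + h2.
Proof. by move=> h; lra. Qed.

Lemma ibp_error_bound (x1 x2 x3 x4 x5 g1 g2 g3 p q e : R) :
  x1 <= g1 * e -> x2 <= g2 * e -> x3 <= g3 * (2 * e) -> x4 <= e * (p + 1) ->
  x5 <= e * (q + 1) ->
  x1 + x2 + x3 + x4 + x5 <= (g1 + g2 + 2 * g3 + p + q + 2) * e.
Proof. by move=> ? ? ? ? ?; lra. Qed.

(** The integral of d_j (abc) vanishes. Only [a] and [b] are approximated, by [phi] and [chi]: their
    product is a test function, so the definition of the weak gradient of [c] applies to it. The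
    classical derivatives are then exchanged for [Ga - Ha] and [Gb - Hb], since [chi * c] and
    [phi * c] lie in the closure of the test functions. *)
Lemma h10_ibp a Ga b Gb c Gc j : h10 a Ga -> h10 b Gb -> h10 c Gc ->
  I (fun x => Ga j x * (b x * c x)) + I (fun x => Gb j x * (a x * c x)) +
  I (fun x => Gc j x * (a x * b x)) = 0.
Proof.
move=> ha hb hc.
have [la lGa _ _] := ha; have [lb lGb _ _] := hb; have [lc lGc wc _] := hc.
have [a6 _] := sob ha; have [b6 _] := sob hb; have [c6 _] := sob hc.
have [Ma Ma0 apa] := h10_approx6 oO bO S0 sob ha.
have [Mb Mb0 apb] := h10_approx6 oO bO S0 sob hb.
have lbc := h10M_l2 oO bO sob hb hc; have lac := h10M_l2 oO bO sob ha hc.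
have lab := h10M_l2 oO bO sob ha hb.
set E := _ + _ + _.
pose M := Ma + Mb + I (fun x => c x ^+ 6).
have Mc0 : 0 <= I (fun x => c x ^+ 6) by exact: Rint6_ge0.
have MaM : Ma <= M by rewrite /M -addrA lerDl addr_ge0.
have MbM : Mb <= M by rewrite /M -addrA addrCA lerDl addr_ge0.
have McM : I (fun x => c x ^+ 6) <= M by rewrite /M lerDr addr_ge0.
pose K := nrm (Ga j) + nrm (Gb j) + 2 * nrm (Gc j) +
  nrm (fun x => b x * c x) + nrm (fun x => a x * c x) + 2.
have K0 : 0 <= K by rewrite /K !addr_ge0 ?mulr_ge0 ?l2norm_ge0.
apply/eqP; rewrite -normr_le0; apply: (@ler_forall_eps _ _ _ K) => // e e0 e1.
rewrite add0r.
have [del del0 small] := l6_product_small mO muO M e0.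
have del1 : 0 < Num.min del e by rewrite lt_min del0 e0.
have [phi [Ha [tphi lHa Ea [an Han] [a6M phi6M aphi6M]]]] := apa _ del1.
have [chi [Hb [tchi lHb Eb [bn Hbn] [b6M chi6M bchi6M]]]] := apb _ del1.
have min1 x : x < Num.min del e -> x < del by move=> h; apply: lt_le_trans h _; rewrite ge_min lexx.
have min2 x : x < Num.min del e -> x < e by move=> h; apply: lt_le_trans h _; rewrite ge_min lexx orbT.
have hphi := test_h10 oO bO tphi; have hchi := test_h10 oO bO tchi.
have phi6 := test_l6 oO tphi; have chi6 := test_l6 oO tchi.
have lchic := h10M_l2 oO bO sob hchi hc; have lphic := h10M_l2 oO bO sob hphi hc.
have lphichi := h10M_l2 oO bO sob hphi hchi.
have t1 := approx_grad_closure oO bO j ha tphi lHa Ea lchic (h10M_closure oO bO S0 sob hchi hc).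
have t2 := approx_grad_closure oO bO j hb tchi lHb Eb lphic (h10M_closure oO bO S0 sob hphi hc).
(* the weak gradient of c tested against phi * chi *)
have t3 : I (fun x => partial j phi x * (chi x * c x)) +
    I (fun x => partial j chi x * (phi x * c x)) + I (fun x => Gc j x * (phi x * chi x)) = 0.
  have := wc j _ (test_functionM tphi tchi).
  have dp x : derivable phi x (delta_mx 0 j) by have [sp _ _] := tphi; exact: (sp [::]).2.
  have dq x : derivable chi x (delta_mx 0 j) by have [sq _ _] := tchi; exact: (sq [::]).2.
  rewrite (partialM dp dq).
  have ldphi := test_l2 oO bO (test_function_partial j tphi).
  have ldchi := test_l2 oO bO (test_function_partial j tchi).
  rewrite -RintD//; try exact: l2M.
  rewrite (_ : (fun x => c x * _) = fun x => partial j phi x * (chi x * c x) +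
    partial j chi x * (phi x * c x)); last by apply/funext => x; ring.
  by move=> ->; rewrite addNr.
have bc1 : nrm (fun x => b x * c x - chi x * c x) < e.
  rewrite (@eq_l2norm _ _ _ _ _ _ (fun x => c x * (b x - chi x))); last by move=> x _; ring.
  by apply: small; [done|exact: l6B|exact: McM|exact: le_trans bchi6M MbM|exact: min1].
have ac1 : nrm (fun x => a x * c x - phi x * c x) < e.
  rewrite (@eq_l2norm _ _ _ _ _ _ (fun x => c x * (a x - phi x))); last by move=> x _; ring.
  by apply: small; [done|exact: l6B|exact: McM|exact: le_trans aphi6M MaM|exact: min1].
have ab1 : nrm (fun x => a x * b x - phi x * chi x) <= 2 * e.
  have h1 : nrm (fun x => b x * (a x - phi x)) < e.
    by apply: small; [done|exact: l6B|exact: le_trans b6M MbM|exact: le_trans aphi6M MaM|exact: min1].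
  have h2 : nrm (fun x => phi x * (b x - chi x)) < e.
    by apply: small; [done|exact: l6B|exact: le_trans phi6M MaM|exact: le_trans bchi6M MbM|exact: min1].
  have t := l2norm_triangle mO (l6M mO muO b6 (l6B oO a6 phi6)) (l6M mO muO phi6 (l6B oO b6 chi6)).
  rewrite (@eq_l2norm _ _ _ _ _ _ (fun x => b x * (a x - phi x) + phi x * (b x - chi x))).
    by apply: (le_trans t); rewrite mulr_natl mulr2n; exact: lerD (ltW h1) (ltW h2).
  by move=> x _; ring.
have nchic : nrm (fun x => chi x * c x) <= nrm (fun x => b x * c x) + e.
  have t := l2norm_triangleB mO lbc (l2B mO lbc lchic).
  rewrite (@eq_l2norm _ _ _ _ _ _ (fun x => b x * c x - (b x * c x - chi x * c x))).
    by apply: (le_trans t); rewrite lerD2l ltW.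
  by move=> x _; ring.
have nphic : nrm (fun x => phi x * c x) <= nrm (fun x => a x * c x) + e.
  have t := l2norm_triangleB mO lac (l2B mO lac lphic).
  rewrite (@eq_l2norm _ _ _ _ _ _ (fun x => a x * c x - (a x * c x - phi x * c x))).
    by apply: (le_trans t); rewrite lerD2l ltW.
  by move=> x _; ring.
have d1 := RintB_l2 oO (lGa j) lbc lchic.
have d2 := RintB_l2 oO (lGb j) lac lphic.
have d3 := RintB_l2 oO (lGc j) lab lphichi.
(* Five errors: three from replacing products by their approximations, two from the remainders [Ha]
   and [Hb]; the constant [K] adds up their coefficients. *)
have -> : E = I (fun x => Ga j x * (b x * c x - chi x * c x)) +
    I (fun x => Gb j x * (a x * c x - phi x * c x)) +
    I (fun x => Gc j x * (a x * b x - phi x * chi x)) +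
    I (fun x => Ha j x * (chi x * c x)) + I (fun x => Hb j x * (phi x * c x)).
  by rewrite /E d1 d2 d3; apply: ibp_error_split; rewrite -t1 -t2.
apply: (le_trans (normr_le_sum5 _ _ _ _ _)).
have n1 := normr_Rint_le mO (lGa j) (l2B mO lbc lchic).
have n2 := normr_Rint_le mO (lGb j) (l2B mO lac lphic).
have n3 := normr_Rint_le mO (lGc j) (l2B mO lab lphichi).
have n4 := normr_Rint_le mO (lHa j) lchic.
have n5 := normr_Rint_le mO (lHb j) lphic.
have m1 : nrm (Ga j) * nrm (fun x => b x * c x - chi x * c x) <= nrm (Ga j) * e.
  by rewrite ler_wpM2l ?l2norm_ge0// ltW.
have m2 : nrm (Gb j) * nrm (fun x => a x * c x - phi x * c x) <= nrm (Gb j) * e.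
  by rewrite ler_wpM2l ?l2norm_ge0// ltW.
have m3 : nrm (Gc j) * nrm (fun x => a x * b x - phi x * chi x) <= nrm (Gc j) * (2 * e).
  by rewrite ler_wpM2l ?l2norm_ge0.
have m4 : nrm (Ha j) * nrm (fun x => chi x * c x) <= e * (nrm (fun x => b x * c x) + 1).
  apply: ler_pM; rewrite ?l2norm_ge0//; first by apply: ltW; exact: min2.
  by apply: (le_trans nchic); rewrite lerD2l.
have m5 : nrm (Hb j) * nrm (fun x => phi x * c x) <= e * (nrm (fun x => a x * c x) + 1).
  apply: ler_pM; rewrite ?l2norm_ge0//; first by apply: ltW; exact: min2.
  by apply: (le_trans nphic); rewrite lerD2l.
exact: ibp_error_bound (le_trans n1 m1) (le_trans n2 m2) (le_trans n3 m3) (le_trans n4 m4) (le_trans n5 m5).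
Qed.

(** The cube root of [l6_product], after the Sobolev inequality has been applied to both factors.
    The factor [b] appears half through its gradient and half through its L^2 norm, which is where
    h^(-1/2) will come from. *)
Lemma h10_product a Ga b Gb : h10 a Ga -> h10 b Gb ->
  nrm (fun x => a x * b x) ^+ 4 <=
  S * gradnorm2 Ga ^+ 2 * gradnorm2 Gb * nrm b ^+ 2.
Proof.
move=> ha hb; have [a6 aS] := sob ha; have [b6 bS] := sob hb.
have A0 := Rint6_ge0 Omega a; have B0 := Rint6_ge0 Omega b.
have ga := gradnorm2_ge0 Omega Ga; have gb := gradnorm2_ge0 Omega Gb.
have R0 : 0 <= S * gradnorm2 Ga ^+ 2 * gradnorm2 Gb * nrm b ^+ 2.
  by do 3 (apply: mulr_ge0; rewrite ?sqr_ge0//).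
rewrite -(@ler_pXn2r _ 3)// ?nnegrE ?exprn_ge0 ?l2norm_ge0//.
rewrite -exprM; apply: (le_trans (l6_product mO muO a6 b6)).
rewrite (_ : (S * _ * _ * _) ^+ 3 = nrm b ^+ 6 *
  (S * gradnorm2 Ga ^+ 3) ^+ 2 * (S * gradnorm2 Gb ^+ 3)); last by ring.
rewrite -[leLHS]mulrA -[leRHS]mulrA ler_wpM2l ?exprn_ge0 ?l2norm_ge0//; apply: ler_pM => //.
- exact: sqr_ge0.
- by apply: lerXn2r; rewrite ?nnegrE ?mulr_ge0 ?exprn_ge0.
Qed.

(** A consequence of the L^6 bound: integrate the pointwise inequality r <= s + r^3 / s^2 with r =
    a^2 and s comparable to the squared gradient norm. *)
Lemma h10_poincare a G : h10 a G ->
  nrm a ^+ 2 <= (Rintegral mu Omega (fun _ => 1) + S) * gradnorm2 G.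
Proof.
move=> ha; have [a6 aS] := sob ha; have [_ ia6] := a6; have [[_ ia2] _ _ _] := ha.
have g0 := gradnorm2_ge0 Omega G; set t := gradnorm2 G in aS g0 *.
set m := Rintegral _ _ _.
have m0 : 0 <= m by exact: Rint_ge0.
apply: (@ler_forall_eps _ _ _ (m + S)); first exact: addr_ge0.
(* The shift by [e] keeps [s] positive when the gradient norm is zero. *)
move=> e e0 _; rewrite -mulrDr; set s := t + e.
have s0 : 0 < s by rewrite /s; lra.
have i1 := integrable_cst_fin mO muO 1.
apply: (@le_trans _ _ (s * m + (s ^+ 2)^-1 * I (fun x => a x ^+ 6))).
  rewrite sqr_l2norm -!RintZ// -RintD//; try exact: integrable_scale.
  apply: Rint_le => //.
    by apply: integrable_add => //; exact: integrable_scale.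
  move=> x _; rewrite mulr1 expr6_sqr3; have := sqr_ge0 (a x); set r := a x ^+ 2 => r0.
  have [rs|sr] := leP r s.
    apply: (le_trans rs); rewrite lerDl; apply: mulr_ge0.
      by rewrite invr_ge0 sqr_ge0.
    exact: mulr_ge0 (mulr_ge0 r0 r0) r0.
  apply: (@le_trans _ _ ((s ^+ 2)^-1 * (r * r * r))); last by rewrite lerDr ltW.
  rewrite mulrC ler_pdivlMr ?exprn_gt0// -mulrA ler_wpM2l// expr2.
  by apply: ler_pM; rewrite ?ltW.
rewrite [leRHS]mulrDl [m * s]mulrC lerD2l mulrC ler_pdivrMr ?exprn_gt0//.
apply: (le_trans aS); rewrite -mulrA ler_wpM2l//.
have -> : s * s ^+ 2 = s ^+ 3 by ring.
by apply: lerXn2r; rewrite ?nnegrE// ?ltW// /s; lra.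
Qed.

End H10_estimates.

(** * Vector fields *)

Section vector_fields.
Context {R : realType} {d : nat}.
Variables (Omega : set 'rV[R]_d) (oO : open Omega) (bO : bounded_set Omega).
Local Notation mu := (@lebesgue_rV R d).
Local Notation I f := (Rintegral mu Omega f).
Local Notation l2 := (l2 mu Omega).
Local Notation nrm := (l2norm mu Omega).
Local Notation L2m := (L2m Omega).
Local Notation ipm := (ipm Omega).
Local Notation normm := (normm Omega).
Local Notation grad := (grad Omega).

Let mO : measurable Omega := measurable_domain oO.
Let muO : (mu Omega < +oo)%E := measure_domain_lty oO bO.

Lemma Rint_sum (J : Type) (s : seq J) (f : J -> 'rV[R]_d -> R) :
  (forall k, mu.-integrable Omega (EFin \o f k)) ->
  mu.-integrable Omega (EFin \o (fun x => \sum_(k <- s) f k x)) /\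
  I (fun x => \sum_(k <- s) f k x) = \sum_(k <- s) I (f k).
Proof.
move=> fi; elim: s => [|k s [IHi IHe]].
  rewrite big_nil (_ : (fun x => _) = fun _ => 0); last first.
    by apply/funext => x; rewrite big_nil.
  by split; [exact: integrable_cst_fin|rewrite /Rintegral integral0].
rewrite (_ : (fun x => _) = fun x => f k x + \sum_(k <- s) f k x); last first.
  by apply/funext => x; rewrite big_cons.
by split; [exact: integrable_add|rewrite RintD// big_cons IHe].
Qed.

Lemma Rint_sum2 (m n : nat) (f : 'I_m -> 'I_n -> 'rV[R]_d -> R) :
  (forall i j, mu.-integrable Omega (EFin \o f i j)) ->
  I (fun x => \sum_i \sum_j f i j x) = \sum_i \sum_j I (f i j).
Proof.
move=> fi; rewrite (Rint_sum _ _).2.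
  by apply: eq_bigr => i _; rewrite (Rint_sum _ (fi i)).2.
by move=> i; exact: (Rint_sum _ (fi i)).1.
Qed.

Lemma ipm_sum m n (F G : 'rV[R]_d -> 'M[R]_(m, n)) : L2m F -> L2m G ->
  ipm F G = \sum_i \sum_j I (fun x => F x i j * G x i j).
Proof.
by move=> lF lG; rewrite -Rint_sum2// => i j; exact: (l2M mO (lF i j) (lG i j)).
Qed.

Lemma sqr_normm m n (F : 'rV[R]_d -> 'M[R]_(m, n)) : normm F ^+ 2 = ipm F F.
Proof.
rewrite sqr_sqrtr//; apply: Rint_ge0 => x _.
by apply: sumr_ge0 => i _; apply: sumr_ge0 => j _; rewrite -expr2 sqr_ge0.
Qed.

Lemma normm_ge0 m n (F : 'rV[R]_d -> 'M[R]_(m, n)) : 0 <= normm F.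
Proof. exact: sqrtr_ge0. Qed.

Lemma sqr_normm_sum m n (F : 'rV[R]_d -> 'M[R]_(m, n)) : L2m F ->
  normm F ^+ 2 = \sum_i \sum_j nrm (fun x => F x i j) ^+ 2.
Proof.
move=> lF; rewrite sqr_normm ipm_sum//.
by apply: eq_bigr => i _; apply: eq_bigr => j _; rewrite sqr_l2norm.
Qed.

Lemma l2norm_le_normm m n (F : 'rV[R]_d -> 'M[R]_(m, n)) i j : L2m F ->
  nrm (fun x => F x i j) <= normm F.
Proof.
move=> lF; rewrite -(@ler_pXn2r _ 2)// ?nnegrE ?l2norm_ge0 ?normm_ge0//.
rewrite sqr_normm_sum// (bigD1 i)//= (bigD1 j)//= -addrA lerDl.
apply: addr_ge0; apply: sumr_ge0 => k _; first exact: sqr_ge0.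
by apply: sumr_ge0 => l _; exact: sqr_ge0.
Qed.

(** Cauchy-Schwarz entry by entry costs a factor [m * n], which is harmless: the bound only serves
    to show that a pairing vanishes or that a supremum is finite. *)
Lemma normr_ipm_le m n (F G : 'rV[R]_d -> 'M[R]_(m, n)) : L2m F -> L2m G ->
  `|ipm F G| <= (m * n)%:R * normm F * normm G.
Proof.
move=> lF lG; rewrite ipm_sum//; apply: (le_trans (ler_norm_sum _ _ _)).
apply: (@le_trans _ _ (\sum_(i < m) \sum_(j < n) (normm F * normm G))).
  apply: ler_sum => i _; apply: (le_trans (ler_norm_sum _ _ _)); apply: ler_sum => j _.
  apply: (le_trans (normr_Rint_le mO (lF i j) (lG i j))).
  by apply: ler_pM; rewrite ?l2norm_ge0 ?l2norm_le_normm.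
rewrite !sumr_const !card_ord -mulrnA -[X in X <= _]mulr_natl !natrM.
by rewrite le_eqVlt; apply/orP; left; apply/eqP; ring.
Qed.

Lemma gradP v : H1 Omega v -> is_weak_grad Omega v (grad v).
Proof. by move=> [_ [G wG]]; exact: (getPex (ex_intro _ G wG)). Qed.

Lemma L2m_grad v : H1 Omega v -> L2m (grad v).
Proof. by move=> /gradP[]. Qed.

Definition grad_row v i : 'I_d -> 'rV[R]_d -> R := fun j x => grad v x i j.

(** The bridge from vector fields to scalar components. The remainder [H] required by [h10] is a row
    of [grad (v - phi)], the very object whose norm the definition of [X] makes small. *)
Lemma X_h10 v i : X Omega v -> h10 Omega (fun x => v x 0 i) (grad_row v i).
Proof.
move=> [Hv ap]; have [lv _] := Hv; have [lg wg] := gradP Hv.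
split=> [||j psi tpsi|e e0].
- exact: lv.
- by move=> j; exact: lg.
- exact: wg.
have [phi [tphi le]] := ap e e0.
(* Without a weak gradient of [v - phi], [grad (v - phi)] would be the default of [get] and its
   small norm would carry no information. The witness is [grad v] minus the classical derivatives of
   [phi]. *)
have H1d : H1 Omega (v - phi).
  split.
    move=> k j; rewrite (_ : (fun x => (v - phi) x k j) =
      fun x => v x 0 j - phi x 0 j); last by apply/funext => x; rewrite (ord1 k) !mxE.
    exact: (l2B mO (lv 0 j) (test_l2 oO bO (tphi j))).
  exists (fun x => \matrix_(k, j) (grad v x k j - partial j (fun x => phi x 0 k) x)).
  have tp k j := test_l2 oO bO (test_function_partial j (tphi k)).
  split.
    move=> k j; rewrite (_ : (fun x => _) = fun x => grad v x k j -
      partial j (fun x => phi x 0 k) x); last by apply/funext => x; rewrite mxE.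
    exact: (l2B mO (lg k j) (tp k j)).
  move=> k j psi tpsi.
  have lpsi := test_l2 oO bO tpsi.
  have ldpsi := test_l2 oO bO (test_function_partial j tpsi).
  have h1 := wg k j psi tpsi; have h2 := test_ibp oO bO j (tphi k) tpsi.
  rewrite /ip /int_Omega in h1 *.
  have e1 := RintB_l2 oO ldpsi (lv 0 k) (test_l2 oO bO (tphi k)).
  have e2 := RintB_l2 oO lpsi (lg k j) (tp k j).
  have c (f g : 'rV[R]_d -> R) : I (fun x => f x * g x) = I (fun x => g x * f x).
    by apply: eq_Rintegral => x _; rewrite mulrC.
  transitivity (I (fun x => partial j psi x * (v x 0 k - phi x 0 k))).
    by apply: eq_Rintegral => x _; rewrite !mxE mulrC.
  rewrite e1 !(c (partial j psi)) h1 h2.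
  transitivity (- I (fun x => psi x * (grad v x k j - partial j (fun x => phi x 0 k) x))).
    by rewrite e2 !(c psi) opprB opprK addrC.
  by congr (- _); apply: eq_Rintegral => x _; rewrite mxE mulrC.
have [ld _] := H1d; have [lgd wgd] := gradP H1d.
have [n1 n2] : normm (v - phi) < e /\ normm (grad (v - phi)) < e.
  have q0 : 0 <= normm (v - phi) ^+ 2 + normm (grad (v - phi)) ^+ 2.
    by rewrite addr_ge0 ?sqr_ge0.
  have : normm (v - phi) ^+ 2 + normm (grad (v - phi)) ^+ 2 < e ^+ 2.
    rewrite -[ltLHS]sqr_sqrtr// ltr_pXn2r ?nnegrE ?sqrtr_ge0//; exact: ltW.
  move=> h; split; rewrite -(@ltr_pXn2r _ 2)// ?nnegrE ?normm_ge0 ?(ltW e0)//;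
    apply: le_lt_trans h.
  - by rewrite lerDl sqr_ge0.
  - by rewrite lerDr sqr_ge0.
have E : (fun x => v x 0 i - phi x 0 i) = (fun x => (v - phi) x 0 i).
  by apply/funext => x; rewrite !mxE.
have w : weak_grad Omega (fun x => (v - phi) x 0 i) (grad_row (v - phi) i).
  by move=> j psi tpsi; exact: wgd.
have n : nrm (fun x => (v - phi) x 0 i) < e.
  by apply: le_lt_trans n1; exact: (@l2norm_le_normm _ _ _ 0 i ld).
rewrite -E in w n.
exists (fun x => phi x 0 i), (grad_row (v - phi) i); split.
- exact: tphi.
- by move=> j; exact: lgd.
- exact: w.
- exact: n.
- by move=> j; apply: le_lt_trans n2; exact: (@l2norm_le_normm _ _ _ i j lgd).
Qed.

Lemma X_L2m v : X Omega v -> L2m v.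
Proof. by move=> [[]]. Qed.

Lemma X_L2m_grad v : X Omega v -> L2m (grad v).
Proof. by move=> [/L2m_grad]. Qed.

Lemma sum_gradnorm2 v : X Omega v ->
  \sum_i gradnorm2 Omega (grad_row v i) = normm (grad v) ^+ 2.
Proof. by move=> Xv; rewrite sqr_normm_sum//; exact: X_L2m_grad. Qed.

Lemma gradnorm2_le v i : X Omega v ->
  gradnorm2 Omega (grad_row v i) <= normm (grad v) ^+ 2.
Proof.
move=> Xv; rewrite -sum_gradnorm2// (bigD1 i)//= lerDl.
by apply: sumr_ge0 => k _; exact: gradnorm2_ge0.
Qed.

Variables (S : R) (S0 : 0 <= S).
Hypothesis sob : forall a G, h10 Omega a G ->
  l6 mu Omega a /\ I (fun x => a x ^+ 6) <= S * gradnorm2 Omega G ^+ 3.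

Lemma X_poincare v : X Omega v ->
  normm v ^+ 2 <= (I (fun _ => 1) + S) * normm (grad v) ^+ 2.
Proof.
move=> Xv; rewrite sqr_normm_sum; last exact: X_L2m.
rewrite big_ord1 -sum_gradnorm2// mulr_sumr; apply: ler_sum => i _.
exact: (h10_poincare oO bO S0 sob (X_h10 i Xv)).
Qed.

(** [sup] dominates the quotients only if they are bounded above, which follows from Poincare. A [v]
    of zero norm is excluded from the supremum, but then the pairing vanishes. The absolute value
    spares the sign of the supremum; only its square matters later. *)
Lemma ipm_le_dual_norm f v : L2m f -> X Omega v ->
  ipm f v <= `|dual_norm Omega f| * normm (grad v).
Proof.
move=> lf Xv; have lv := X_L2m Xv.
have [n0|n0] := eqVneq (normm v) 0.
  apply: (@le_trans _ _ 0); last by rewrite mulr_ge0 ?normm_ge0.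
  by apply: le_trans (ler_norm _) _; apply: le_trans (normr_ipm_le lf lv) _; rewrite n0 mulr0.
pose P := I (fun _ => 1) + S.
have P0 : 0 <= P by apply: addr_ge0 => //; exact: Rint_ge0.
(* By Poincare, the quotients in [dual_norm] have nonzero denominators. *)
have g0 w : X Omega w -> normm w != 0 -> 0 < normm (grad w).
  move=> Xw nw; rewrite lt0r normm_ge0 andbT; apply: contra nw => /eqP gw.
  have := X_poincare Xw; rewrite gw expr0n mulr0 => h.
  by rewrite -sqrf_eq0 eq_le h sqr_ge0.
have bound w : X Omega w -> normm w != 0 ->
    ipm f w / normm (grad w) <= (1 * d)%:R * normm f * Num.sqrt P.
  move=> Xw nw; rewrite ler_pdivrMr ?g0//.
  apply: le_trans (ler_norm _) _; apply: le_trans (normr_ipm_le lf (X_L2m Xw)) _.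
  rewrite -[leRHS]mulrA ler_wpM2l//; first by rewrite mulr_ge0 ?normm_ge0.
  rewrite -(@ler_pXn2r _ 2)// ?nnegrE ?mulr_ge0 ?normm_ge0 ?sqrtr_ge0//.
  by rewrite exprMn [Num.sqrt P ^+ 2]sqr_sqrtr//; exact: X_poincare.
rewrite -ler_pdivrMr ?g0//; apply: le_trans (ler_norm _).
apply: ub_le_sup; last by exists v.
exists ((1 * d)%:R * normm f * Num.sqrt P) => _ [w [Xw nw] <-].
exact: bound.
Qed.

End vector_fields.

(** * The skew-symmetric trilinear form *)

Section trilinear.
Context {R : realType} {d : nat}.
Variables (Omega : set 'rV[R]_d) (oO : open Omega) (bO : bounded_set Omega).
Local Notation mu := (@lebesgue_rV R d).
Local Notation I f := (Rintegral mu Omega f).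
Local Notation l2 := (l2 mu Omega).
Local Notation nrm := (l2norm mu Omega).
Local Notation L2m := (L2m Omega).
Local Notation ipm := (ipm Omega).
Local Notation normm := (normm Omega).
Local Notation grad := (grad Omega).

Let mO : measurable Omega := measurable_domain oO.
Let muO : (mu Omega < +oo)%E := measure_domain_lty oO bO.


Local Notation X := (X Omega).
Local Notation bstar := (bstar Omega).
Local Notation convect := (convect Omega).

Variables (S : R) (S0 : 0 <= S).
Hypothesis sob : forall a G, h10 Omega a G ->
  l6 mu Omega a /\ I (fun x => a x ^+ 6) <= S * gradnorm2 Omega G ^+ 3.

Lemma X_prod_l2 u v i j : X u -> X v -> l2 (fun x => u x 0 i * v x 0 j).
Proof.
move=> Xu Xv.
exact: (h10M_l2 oO bO sob (X_h10 oO bO i Xu) (X_h10 oO bO j Xv)).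
Qed.

Lemma ipm_convect u v w : X u -> X v -> X w ->
  ipm (convect u v) w = \sum_i \sum_j I (fun x => grad v x i j * (u x 0 j * w x 0 i)).
Proof.
move=> Xu Xv Xw; rewrite -(Rint_sum2 oO bO); last first.
  by move=> i j; apply: (l2M mO (X_L2m_grad Xv i j)); exact: X_prod_l2.
apply: eq_Rintegral => x _; rewrite big_ord1; apply: eq_bigr => i _.
rewrite !mxE mulr_suml; apply: eq_bigr => j _; rewrite mxE; ring.
Qed.

(* The paper's ((div u) v, w). *)
Definition div_pairing (u v w : 'rV[R]_d -> 'rV[R]_d) :=
  \sum_i \sum_j I (fun x => grad u x j j * (v x 0 i * w x 0 i)).

(** [h10_ibp] for the triple u_j, v_i, w_i in direction j, summed over i and j. *)
Lemma ipm_convect_skew u v w : X u -> X v -> X w ->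
  ipm (convect u v) w + ipm (convect u w) v + div_pairing u v w = 0.
Proof.
move=> Xu Xv Xw; rewrite !ipm_convect// /div_pairing -!big_split /=.
apply: big1 => i _; rewrite -!big_split /=; apply: big1 => j _.
have := h10_ibp oO bO S0 sob j (X_h10 oO bO j Xu) (X_h10 oO bO i Xv) (X_h10 oO bO i Xw).
by rewrite addrC addrA /grad_row => <-; congr (_ + _); rewrite addrC.
Qed.

(** Linearity is used only in the undifferentiated argument, where the choice made by [grad] does
    not interfere. *)
Lemma ipm_convectBr u v a e : X u -> X v -> X a -> X e -> X (a - e) ->
  ipm (convect u v) (a - e) = ipm (convect u v) a - ipm (convect u v) e.
Proof.
move=> Xu Xv Xa Xe Xae; rewrite !ipm_convect//.
rewrite -sumrB; apply: eq_bigr => i _; rewrite -sumrB; apply: eq_bigr => j _.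
rewrite -(RintB_l2 oO (X_L2m_grad Xv i j) (X_prod_l2 j i Xu Xa) (X_prod_l2 j i Xu Xe)).
by apply: eq_Rintegral => x _; rewrite !mxE; ring.
Qed.

Lemma div_pairingBr u v a e : X u -> X v -> X a -> X e ->
  div_pairing u v (a - e) = div_pairing u v a - div_pairing u v e.
Proof.
move=> Xu Xv Xa Xe; rewrite /div_pairing.
rewrite -sumrB; apply: eq_bigr => i _; rewrite -sumrB; apply: eq_bigr => j _.
rewrite -(RintB_l2 oO (X_L2m_grad Xu j j) (X_prod_l2 i i Xv Xa) (X_prod_l2 i i Xv Xe)).
by apply: eq_Rintegral => x _; rewrite !mxE; ring.
Qed.

Lemma skew_sub_algebra (c1 c2 c3 q1 q2 : R) : c1 + c1 + q1 = 0 ->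
  c1 - c2 + c3 + (q1 - q2) = 0 -> 2^-1 * c3 - 2^-1 * (c1 - c2) = c2 + 2^-1 * q2.
Proof. by move=> h1 h2; lra. Qed.

(** The skew relation for [a] and [a - e] trades the gradient of [a - e] for that of [a]; the one
    for [a] and [a] cancels what contains [a] alone. No gradient of [e] survives. *)
Lemma bstar_skew_sub u a e : X u -> X a -> X e -> X (a - e) ->
  bstar u (a - e) a = ipm (convect u a) e + 2^-1 * div_pairing u a e.
Proof.
move=> Xu Xa Xe Xae.
have h1 := ipm_convect_skew Xu Xa Xae; have h2 := ipm_convect_skew Xu Xa Xa.
rewrite /bstar /Defs.bstar; move: h1; rewrite ipm_convectBr// div_pairingBr//.
by move: h2; exact: skew_sub_algebra.
Qed.

Variables (h Cinv : R) (h0 : 0 < h) (Cinv0 : 0 < Cinv).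

(** [h10_product] bounds the fourth power by S |grad b|^4 |grad e|^2 |e|^2; the inverse inequality,
    needed for [e] only, turns |grad e|^2 into (Cinv / h)^2 |e|^2. The constant is the fourth root
    of S (Cinv / h)^2. *)
Lemma product_bound b e i j : X b -> X e ->
  h * normm (grad e) <= Cinv * normm e ->
  nrm (fun x => b x 0 j * e x 0 i) <=
  Num.sqrt (Num.sqrt S * (Cinv / h)) * normm (grad b) * normm e.
Proof.
move=> Xb Xe inv.
have := h10_product oO bO S0 sob (X_h10 oO bO j Xb) (X_h10 oO bO i Xe).
have gb := gradnorm2_le oO bO j Xb; have ge := gradnorm2_le oO bO i Xe.
have gb0 := gradnorm2_ge0 Omega (grad_row Omega b j).
have ge0 := gradnorm2_ge0 Omega (grad_row Omega e i).
have ne := @l2norm_le_normm _ _ _ oO bO _ _ e 0 i (X_L2m Xe).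
have n0 := l2norm_ge0 mu Omega (fun x => e x 0 i).
have inv' : normm (grad e) <= Cinv / h * normm e.
  by rewrite mulrAC ler_pdivlMr// mulrC.
have Ch0 : 0 <= Cinv / h by rewrite divr_ge0// ltW.
have k0 : 0 <= Num.sqrt S * (Cinv / h) by rewrite mulr_ge0// sqrtr_ge0.
move=> le4; rewrite -(@ler_pXn2r _ 4)// ?nnegrE ?l2norm_ge0//; last first.
  by rewrite !mulr_ge0 ?sqrtr_ge0 ?normm_ge0.
apply: (le_trans le4).
rewrite !exprMn.
have -> : Num.sqrt (Num.sqrt S * (Cinv / h)) ^+ 4 = S * (Cinv / h) ^+ 2.
  by rewrite (exprM _ 2 2) sqr_sqrtr// exprMn sqr_sqrtr.
have -> : S * (Cinv / h) ^+ 2 * normm (grad b) ^+ 4 * normm e ^+ 4 =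
   S * (normm (grad b) ^+ 2) ^+ 2 * ((Cinv / h * normm e) ^+ 2) * normm e ^+ 2 by ring.
apply: ler_pM.
- by apply: mulr_ge0 => //; apply: mulr_ge0 => //; exact: sqr_ge0.
- exact: sqr_ge0.
- apply: ler_pM => //.
  + by apply: mulr_ge0 => //; exact: sqr_ge0.
  + apply: ler_wpM2l; first exact: S0.
    by apply: lerXn2r gb; rewrite nnegrE; [exact: gb0|exact: sqr_ge0].
  + apply: (le_trans ge); apply: lerXn2r inv'; rewrite nnegrE; first exact: normm_ge0.
    by apply: mulr_ge0 => //; exact: normm_ge0.
- by apply: lerXn2r; rewrite ?nnegrE ?normm_ge0.
Qed.

Lemma half_sum_le (x y z : R) : x <= z -> y <= z -> 0 <= z -> x + 2^-1 * y <= 2 * z.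
Proof. by move=> ? ? ?; lra. Qed.

(** Both terms of [bstar_skew_sub] consist of d^2 integrals of a derivative times a product with a
    component of [e]: derivative of [a] and component of [u] in the first, the converse in the
    second. All share the bound [B], and 1 + 1/2 <= 2. *)
Lemma bstar_bound u a e : X u -> X a -> X e -> X (a - e) ->
  h * normm (grad e) <= Cinv * normm e ->
  `|bstar u (a - e) a| <= 2 * d%:R ^+ 2 * Num.sqrt (Num.sqrt S * (Cinv / h)) *
    normm (grad u) * normm (grad a) * normm e.
Proof.
move=> Xu Xa Xe Xae inv; rewrite bstar_skew_sub//.
set k := Num.sqrt _.
have [B BE] : exists B, B = k * normm (grad u) * normm (grad a) * normm e by eexists.
have perm1 (p q r s : R) : p * q * r * s = r * (p * q * s) by ring.
have perm2 (p q r s : R) : p * q * r * s = q * (p * r * s) by ring.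
have perm3 (m p q r s : R) : 2 * m * p * q * r * s = 2 * (m * (p * q * r * s)) by ring.
have k0 : 0 <= k by exact: sqrtr_ge0.
have B0 : 0 <= B.
  rewrite BE; apply: mulr_ge0; last exact: normm_ge0.
  by apply: mulr_ge0; last exact: normm_ge0; apply: mulr_ge0; last exact: normm_ge0.
have sumB (f : 'I_d -> 'I_d -> R) : (forall i j, `|f i j| <= B) ->
    `|\sum_i \sum_j f i j| <= d%:R ^+ 2 * B.
  move=> fB; apply: le_trans (ler_norm_sum _ _ _) _.
  apply: (@le_trans _ _ (\sum_(i < d) \sum_(j < d) B)).
    by apply: ler_sum => i _; apply: le_trans (ler_norm_sum _ _ _) _; exact: ler_sum.
  by rewrite !sumr_const !card_ord -mulrnA -[X in X <= _]mulr_natl natrM expr2.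
have b1 : `|ipm (convect u a) e| <= d%:R ^+ 2 * B.
  rewrite ipm_convect//; apply: sumB => i j.
  apply: le_trans (normr_Rint_le mO (X_L2m_grad Xa i j) (X_prod_l2 j i Xu Xe)) _.
  rewrite BE perm1.
  apply: ler_pM; rewrite ?l2norm_ge0//; last exact: product_bound.
  exact: (l2norm_le_normm oO bO i j (X_L2m_grad Xa)).
have b2 : `|div_pairing u a e| <= d%:R ^+ 2 * B.
  apply: sumB => i j.
  apply: le_trans (normr_Rint_le mO (X_L2m_grad Xu j j) (X_prod_l2 i i Xa Xe)) _.
  rewrite BE perm2.
  apply: ler_pM; rewrite ?l2norm_ge0//; last exact: product_bound.
  exact: (l2norm_le_normm oO bO j j (X_L2m_grad Xu)).
rewrite perm3 -BE.
apply: le_trans (ler_normD _ _) _; rewrite normrM gtr0_norm ?invr_gt0//.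
apply: half_sum_le b1 b2 _; apply: mulr_ge0 => //; exact: sqr_ge0.
Qed.

End trilinear.

(** * The mesh size *)

Section mesh.
Context {R : realType} {d : nat}.
Implicit Types (x y : 'rV[R]_d) (V : 'M[R]_(d.+1, d)).

Lemma enorm_ge0 x : 0 <= enorm x.
Proof. exact: sqrtr_ge0. Qed.

Lemma sqr_enorm x : enorm x ^+ 2 = \sum_(i < d) x 0 i ^+ 2.
Proof.
rewrite sqr_sqrtr; last by apply: sumr_ge0 => i _; rewrite -expr2 sqr_ge0.
by apply: eq_bigr => i _; rewrite expr2.
Qed.

Lemma enorm_gt0 x : x != 0 -> 0 < enorm x.
Proof.
move=> x0; rewrite lt0r enorm_ge0 andbT -sqrf_eq0 sqr_enorm.
apply: contra x0 => /eqP s0; apply/eqP/rowP => i; rewrite mxE.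
apply/eqP; rewrite -sqrf_eq0; apply/eqP.
by apply: (psumr_eq0P _ s0) => // k _; exact: sqr_ge0.
Qed.

Lemma enorm_le x : enorm x <= Num.sqrt d%:R * `|x|.
Proof.
rewrite -(@ler_pXn2r _ 2)// ?nnegrE ?enorm_ge0 ?mulr_ge0 ?sqrtr_ge0//.
rewrite sqr_enorm exprMn sqr_sqrtr// mulr_natl -[X in _ *+ X](card_ord d) -sumr_const.
apply: ler_sum => i _; rewrite -real_normK ?num_real//.
by apply: lerXn2r; rewrite ?nnegrE// ler_mx_coord.
Qed.

Lemma simplex_bounded V z : simplex V z -> `|z| <= d.+1%:R * `|V|.
Proof.
move=> [a [a0 _ a1 ->]].
apply: ler_mx_norm; first by rewrite mulr_ge0.
move=> i j; rewrite (ord1 i) mxE; apply: le_trans (ler_norm_sum _ _ _) _.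
rewrite mulr_natl -[X in _ *+ X](card_ord d.+1) -sumr_const.
apply: ler_sum => k _; rewrite normrM -[leRHS]mul1r.
apply: ler_pM => //; last exact: ler_mx_coord.
rewrite ger0_norm// -a1 (bigD1 k)//= lerDl; exact: sumr_ge0.
Qed.

Lemma vertex_simplex V k : simplex V (row k V).
Proof.
exists (delta_mx 0 k); split.
- by move=> i; rewrite mxE ler0n.
- by move=> i /(_ Logic.I).
- rewrite (bigD1 k)//= big1 => [|i ik]; first by rewrite addr0 mxE !eqxx.
  by rewrite mxE (negbTE ik) andbF.
- exact: rowE.
Qed.

(** Affine independence separates two vertices, and [d > 0] provides the second one. Boundedness of
    the simplex is needed for the supremum to dominate their distance. *)
Lemma diam_simplex_gt0 V : (0 < d)%N -> affinely_independent V -> 0 < diam (simplex V).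
Proof.
move=> d0 indep.
pose i1 : 'I_d.+1 := lift ord0 (Ordinal d0).
have v01 : row i1 V - row ord0 V != 0.
  rewrite subr_eq0; apply/eqP => e01.
  pose a : 'rV[R]_d.+1 := delta_mx 0 i1 - delta_mx 0 ord0.
  have : a = 0.
    apply: indep; last by rewrite /a mulmxBl -!rowE e01 subrr.
    rewrite (bigD1 i1)//= (bigD1 ord0)//= big1 ?addr0.
      by rewrite !mxE /= subr0 sub0r subrr.
    move=> i /andP[ii1 i0]; rewrite !mxE /= (negbTE ii1) (negbTE i0); exact: subrr.
  move/rowP/(_ i1); rewrite !mxE /= => /eqP; apply/negP.
  by rewrite subr0 oner_eq0.
apply: lt_le_trans (enorm_gt0 v01) _.
apply: ub_le_sup; last first.
  by exists (row i1 V, row ord0 V) => //; split; exact: vertex_simplex.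
exists (Num.sqrt d%:R * (d.+1%:R * `|V| + d.+1%:R * `|V|)) => _ [[x y] [/= sx sy] <-].
apply: le_trans (enorm_le _) _; rewrite ler_wpM2l ?sqrtr_ge0//.
by apply: le_trans (ler_normB _ _) _; apply: lerD; exact: simplex_bounded.
Qed.

(** A nonempty domain forces at least one element. If [h] were 0, the quotient [dt / (nu * h)] would
    be 0 and the time step condition void. *)
Lemma mesh_size_gt0 (Omega : set 'rV[R]_d) M (T : 'I_M -> 'M[R]_(d.+1, d)) :
  (0 < d)%N -> Omega !=set0 -> triangulation Omega T -> 0 < mesh_size T.
Proof.
move=> d0 [x Ox] [indep cover _].
have [k _ _] : (\bigcup_k simplex (T k)) x by rewrite cover; exact: subset_closure.
by apply: lt_le_trans (diam_simplex_gt0 d0 (indep k)) _; exact: le_bigmax.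
Qed.

End mesh.

(** * The energy estimate *)

Section bilinear.
Context {R : realType} {d : nat}.
Variables (Omega : set 'rV[R]_d) (oO : open Omega) (bO : bounded_set Omega).
Local Notation mu := (@lebesgue_rV R d).
Local Notation L2m := (L2m Omega).
Local Notation ipm := (ipm Omega).
Local Notation normm := (normm Omega).
Local Notation field := ('rV[R]_d -> 'rV[R]_d).
Implicit Types F G H a b c e : field.

Let mO : measurable Omega := measurable_domain oO.

Lemma L2mD F G : L2m F -> L2m G -> L2m (F + G).
Proof.
move=> lF lG i j.
rewrite (_ : (fun x => (F + G) x i j) = fun x => F x i j + G x i j).
  exact: (l2D mO (lF i j) (lG i j)).
by apply/funext => x; rewrite !mxE.
Qed.

Lemma L2mZ (k : R) F : L2m F -> L2m (k *: F).
Proof.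
move=> lF i j.
rewrite (_ : (fun x => (k *: F) x i j) = fun x => k * F x i j).
  exact: (l2Z mO k (lF i j)).
by apply/funext => x; rewrite !mxE.
Qed.

Lemma ipmC F G : ipm F G = ipm G F.
Proof.
apply: eq_Rintegral => x _; apply: eq_bigr => i _; apply: eq_bigr => j _.
exact: mulrC.
Qed.

Lemma ipmDl F G H : L2m F -> L2m G -> L2m H -> ipm (F + G) H = ipm F H + ipm G H.
Proof.
move=> lF lG lH; rewrite !(ipm_sum oO bO)//; last exact: L2mD.
rewrite -big_split; apply: eq_bigr => i _; rewrite -big_split; apply: eq_bigr => j _ /=.
rewrite -(RintD mO (l2M mO (lF i j) (lH i j)) (l2M mO (lG i j) (lH i j))).
by apply: eq_Rintegral => x _; rewrite !mxE; ring.
Qed.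

Lemma ipmZl (k : R) F H : L2m F -> L2m H -> ipm (k *: F) H = k * ipm F H.
Proof.
move=> lF lH; rewrite !(ipm_sum oO bO)//; last exact: L2mZ.
rewrite mulr_sumr; apply: eq_bigr => i _; rewrite mulr_sumr; apply: eq_bigr => j _ /=.
rewrite -(RintZ mO _ (l2M mO (lF i j) (lH i j))).
by apply: eq_Rintegral => x _; rewrite !mxE; ring.
Qed.

(** The common shape of all the fields in the energy identity, which thereby reduces to the ten
    mutual inner products of four consecutive iterates. *)
Definition comb4 (x y z w : R) a b c e : field := x *: a + y *: b + z *: c + w *: e.

Section comb4.
Variables (a b c e : field).
Hypotheses (la : L2m a) (lb : L2m b) (lc : L2m c) (le : L2m e).

Lemma L2m_comb4 x y z w : L2m (comb4 x y z w a b c e).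
Proof. exact: L2mD (L2mD (L2mD (L2mZ x la) (L2mZ y lb)) (L2mZ z lc)) (L2mZ w le). Qed.

Lemma ipm_comb4 x y z w H : L2m H -> ipm (comb4 x y z w a b c e) H =
  x * ipm a H + y * ipm b H + z * ipm c H + w * ipm e H.
Proof.
move=> lH; have l k F : L2m F -> L2m (k *: F) by exact: L2mZ.
rewrite /comb4 (ipmDl _ (l w e le) lH); last by do 2 (apply: L2mD; last exact: l); exact: l.
rewrite (ipmDl _ (l z c lc) lH); last by apply: L2mD; exact: l.
by rewrite (ipmDl (l x a la) (l y b lb) lH) !ipmZl.
Qed.

Lemma sqr_normm_comb4 x y z w : normm (comb4 x y z w a b c e) ^+ 2 =
  x ^+ 2 * ipm a a + y ^+ 2 * ipm b b + z ^+ 2 * ipm c c + w ^+ 2 * ipm e e +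
  2 * (x * y * ipm a b + x * z * ipm a c + x * w * ipm a e +
       y * z * ipm b c + y * w * ipm b e + z * w * ipm c e).
Proof.
have l4 := L2m_comb4 x y z w.
rewrite sqr_normm (ipm_comb4 _ _ _ _ l4) !(ipmC _ (comb4 _ _ _ _ _ _ _ _)).
rewrite (ipm_comb4 _ _ _ _ la) (ipm_comb4 _ _ _ _ lb).
rewrite (ipm_comb4 _ _ _ _ lc) (ipm_comb4 _ _ _ _ le).
rewrite (ipmC b a) (ipmC c a) (ipmC e a) (ipmC c b) (ipmC e b) (ipmC e c).
move: (ipm a a) (ipm b b) (ipm c c) (ipm e e) (ipm a b) (ipm a c) (ipm a e) (ipm b c) (ipm b e) (ipm c e).
by clear => *; ring.
Qed.

End comb4.

Definition energy a b c := 12^-1 * normm a ^+ 2 + 12^-1 * normm (3 *: a - b) ^+ 2 +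
  12^-1 * normm (3 *: a - 3 *: b + c) ^+ 2.

(** The inner products are plain variables and the squared norms are expanded exactly as
    [sqr_normm_comb4] delivers them, zero coefficients included, so that only a polynomial identity
    remains. *)
Lemma blended_algebra (dt T na nb n1 n2 n3 n4 n5 aa bb cc ee ab ac ae bc be ce ba ca ea : R) :
  0 < dt -> T = (6 * dt)^-1 * (10 * aa + (-15) * ba + 6 * ca + (-1) * ea) ->
  na = aa -> nb = bb ->
  n1 = 1 ^+ 2 * aa + (-3) ^+ 2 * bb + 3 ^+ 2 * cc + (-1) ^+ 2 * ee +
    2 * (1 * (-3) * ab + 1 * 3 * ac + 1 * (-1) * ae +
         (-3) * 3 * bc + (-3) * (-1) * be + 3 * (-1) * ce) ->
  n2 = 0 ^+ 2 * aa + 3 ^+ 2 * bb + (-3) ^+ 2 * cc + 1 ^+ 2 * ee +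
    2 * (0 * 3 * ab + 0 * (-3) * ac + 0 * 1 * ae +
         3 * (-3) * bc + 3 * 1 * be + (-3) * 1 * ce) ->
  n3 = 0 ^+ 2 * aa + 3 ^+ 2 * bb + (-1) ^+ 2 * cc + 0 ^+ 2 * ee +
    2 * (0 * 3 * ab + 0 * (-1) * ac + 0 * 0 * ae +
         3 * (-1) * bc + 3 * 0 * be + (-1) * 0 * ce) ->
  n4 = 3 ^+ 2 * aa + (-3) ^+ 2 * bb + 1 ^+ 2 * cc + 0 ^+ 2 * ee +
    2 * (3 * (-3) * ab + 3 * 1 * ac + 3 * 0 * ae +
         (-3) * 1 * bc + (-3) * 0 * be + 1 * 0 * ce) ->
  n5 = 3 ^+ 2 * aa + (-1) ^+ 2 * bb + 0 ^+ 2 * cc + 0 ^+ 2 * ee +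
    2 * (3 * (-1) * ab + 3 * 0 * ac + 3 * 0 * ae +
         (-1) * 0 * bc + (-1) * 0 * be + 0 * 0 * ce) ->
  ba = ab -> ca = ac -> ea = ae ->
  dt * T = 12^-1 * na + 12^-1 * n5 + 12^-1 * n4 -
    (12^-1 * nb + 12^-1 * n3 + 12^-1 * n2) + 12^-1 * n1.
Proof.
by move=> dt0 -> -> -> -> -> -> -> -> -> -> ->; field; lra.
Qed.

Lemma blended_identity dt a b c e : 0 < dt -> L2m a -> L2m b -> L2m c -> L2m e ->
  dt * ipm ((6 * dt)^-1 *: (10 *: a - 15 *: b + 6 *: c - e)) a =
  energy a b c - energy b c e + 12^-1 * normm (a - 3 *: b + 3 *: c - e) ^+ 2.
Proof.
move=> dt0 la lb lc le.
have ext (f g : field) : (forall t k, f t 0 k = g t 0 k) -> f = g.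
  by move=> fg; apply/funext => t; apply/rowP => k; exact: fg.
have E0 : 10 *: a - 15 *: b + 6 *: c - e = comb4 10 (-15) 6 (-1) a b c e.
  by apply: ext => t k; rewrite !mxE; ring.
have E1 : a - 3 *: b + 3 *: c - e = comb4 1 (-3) 3 (-1) a b c e.
  by apply: ext => t k; rewrite !mxE; ring.
have E2 : 3 *: b - 3 *: c + e = comb4 0 3 (-3) 1 a b c e.
  by apply: ext => t k; rewrite !mxE; ring.
have E3 : 3 *: b - c = comb4 0 3 (-1) 0 a b c e.
  by apply: ext => t k; rewrite !mxE; ring.
have E4 : 3 *: a - 3 *: b + c = comb4 3 (-3) 1 0 a b c e.
  by apply: ext => t k; rewrite !mxE; ring.
have E5 : 3 *: a - b = comb4 3 (-1) 0 0 a b c e.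
  by apply: ext => t k; rewrite !mxE; ring.
have N := sqr_normm_comb4 la lb lc le.
have T : ipm ((6 * dt)^-1 *: (10 *: a - 15 *: b + 6 *: c - e)) a =
    (6 * dt)^-1 * (10 * ipm a a + (-15) * ipm b a + 6 * ipm c a + (-1) * ipm e a).
  by rewrite E0 (ipmZl _ (L2m_comb4 la lb lc le 10 (-15) 6 (-1)) la) (ipm_comb4 la lb lc le _ _ _ _ la).
have N1 := N 1 (-3) 3 (-1); have N2 := N 0 3 (-3) 1; have N3 := N 0 3 (-1) 0.
have N4 := N 3 (-3) 1 0; have N5 := N 3 (-1) 0 0.
rewrite -E1 in N1; rewrite -E2 in N2; rewrite -E3 in N3; rewrite -E4 in N4; rewrite -E5 in N5.
exact: (blended_algebra dt0 T (sqr_normm Omega a) (sqr_normm Omega b) N1 N2 N3 N4 N5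
  (ipmC b a) (ipmC c a) (ipmC e a)).
Qed.

End bilinear.

(** [T], [B] and [F] stand for the time difference, the nonlinear term and the force, all tested
    with the new iterate; [D] is the dual norm, and [g], [gu], [nd] are the norms of the gradient of
    the new iterate, of the gradient of the fluctuation, and of delta. *)
Lemma energy_step_algebra {R : realType} (dt nu h kap sS Cinv k C E' E T B F D g gu nd : R) :
  0 < dt -> 0 < nu -> 0 < h -> 0 <= g -> kap ^+ 2 = sS * (Cinv / h) ->
  48 * k ^+ 2 * sS * Cinv <= C ->
  dt * T = E' - E + 12^-1 * nd ^+ 2 ->
  T + B + nu * g ^+ 2 = F -> F <= D * g ->
  `|B| <= 2 * k * kap * gu * g * nd ->
  C * (dt / (nu * h)) * gu ^+ 2 <= 1 ->
  E' + 24^-1 * nd ^+ 2 + dt / 4 * (nu * g ^+ 2) <= E + dt / nu * D ^+ 2.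
Proof.
move=> dt0 nu0 h0 g0 kapE CE TE eqn FD Bb tstep.
have young1 : D * g <= D ^+ 2 / nu + nu * g ^+ 2 / 4.
  have : 0 <= (D - nu * g / 2) ^+ 2 / nu by rewrite divr_ge0 ?sqr_ge0// ltW.
  have -> : (D - nu * g / 2) ^+ 2 / nu = D ^+ 2 / nu + nu * g ^+ 2 / 4 - D * g by field; lra.
  by lra.
(* The weight leaves 1/12 - 1/24 = 1/24 of the squared norm of delta on the left-hand side. *)
have young2 : dt * (2 * k * kap * gu * g * nd) <=
    24^-1 * nd ^+ 2 + 6 * (dt * (2 * k * kap * gu * g)) ^+ 2.
  set x := dt * (2 * k * kap * gu * g).
  have -> : dt * (2 * k * kap * gu * g * nd) = x * nd by rewrite /x; ring.
  have : 0 <= (nd - 12 * x) ^+ 2 by exact: sqr_ge0.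
  by clear; lra.
(* Origin of 48: 6 * 2^2 = 24 from Young's inequality, doubled because only half of the viscous term
   is spent here. *)
have small : 6 * (dt * (2 * k * kap * gu * g)) ^+ 2 <= dt * (nu * g ^+ 2) / 2.
  have -> : 6 * (dt * (2 * k * kap * gu * g)) ^+ 2 =
    dt * (nu * g ^+ 2) / 2 * ((48 * k ^+ 2 * sS * Cinv) * (dt / (nu * h)) * gu ^+ 2).
    rewrite (_ : 6 * _ ^+ 2 = 24 * k ^+ 2 * kap ^+ 2 * dt ^+ 2 * gu ^+ 2 * g ^+ 2); last by ring.
    rewrite kapE; field; lra.
  rewrite -[leRHS]mulr1 ler_wpM2l//.
    by rewrite divr_ge0// mulr_ge0 ?(ltW dt0)// mulr_ge0 ?(ltW nu0)// sqr_ge0.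
  apply: le_trans tstep; rewrite ler_wpM2r ?sqr_ge0// ler_wpM2r//.
  by rewrite divr_ge0 ?(ltW dt0)// mulr_ge0 ?ltW.
have dF : dt * F <= dt * (D ^+ 2 / nu + nu * g ^+ 2 / 4).
  by rewrite ler_pM2l//; exact: le_trans FD young1.
have dB : - (dt * B) <= dt * (2 * k * kap * gu * g * nd).
  rewrite -mulrN ler_pM2l//; apply: le_trans Bb.
  by rewrite -normrN ler_norm.
have e1 : dt * T = dt * F - dt * B - dt * (nu * g ^+ 2) by rewrite -eqn; ring.
have e2 : dt / nu * D ^+ 2 = dt * (D ^+ 2 / nu) by ring.
rewrite e2; move: dF dB young2 small; rewrite mulrDr.
move: TE; rewrite e1.
by clear; lra.
Qed.

(** * Stability of finite element spaces under linear combinations *)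

Section fe_space.
Context {R : realType} (V : lmodType R) (S : set V).
Hypothesis fS : fin_dim_subspace S.

Lemma fin_dim0 : S 0.
Proof.
have [m [e ->]] := fS; exists (fun _ => 0).
by rewrite big1// => i _; rewrite scale0r.
Qed.

Lemma fin_dimD u v : S u -> S v -> S (u + v).
Proof.
have [m [e ->]] := fS => -[c ->] [c' ->]; exists (fun i => c i + c' i).
by rewrite -big_split; apply: eq_bigr => i _; rewrite scalerDl.
Qed.

Lemma fin_dimZ (k : R) u : S u -> S (k *: u).
Proof.
have [m [e ->]] := fS => -[c ->]; exists (fun i => k * c i).
by rewrite scaler_sumr; apply: eq_bigr => i _; rewrite scalerA.
Qed.

Lemma fin_dimB u v : S u -> S v -> S (u - v).
Proof.
by move=> Su Sv; rewrite -scaleN1r; apply: fin_dimD => //; exact: fin_dimZ.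
Qed.

Lemma fin_dim_sum (J : Type) (s : seq J) (F : J -> V) :
  (forall j, S (F j)) -> S (\sum_(j <- s) F j).
Proof.
by move=> SF; elim/big_ind: _ => //; [exact: fin_dim0|exact: fin_dimD].
Qed.

End fe_space.

Lemma energy_telescope {R : realFieldType} (A B E s t F D2 D3 x : R) :
  A + s + t <= E + F -> B + D2 + D3 <= A + x -> B + (s + D2) + (t + D3) <= E + (F + x).
Proof. by move=> h1 h2; lra. Qed.

(** * One time step and the summation over all steps *)

Section energy_estimate.
Context {R : realType} {d : nat}.
Variables (Omega : set 'rV[R]_d) (oO : open Omega) (bO : bounded_set Omega).
Local Notation field := ('rV[R]_d -> 'rV[R]_d).
Local Notation normm := (normm Omega).
Local Notation grad := (grad Omega).

Variables (S : R) (S0 : 0 <= S).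
Hypothesis sob : forall a G, h10 Omega a G ->
  l6 (lebesgue_rV d) Omega a /\
  Rintegral (lebesgue_rV d) Omega (fun x => a x ^+ 6) <= S * gradnorm2 Omega G ^+ 3.

Variables (C h Cinv dt nu : R) (J : nat) (N : nat) (f : 'I_J -> R -> field)
  (Xh : set field) (Qh : set ('rV[R]_d -> R^o))
  (u : 'I_J -> nat -> field) (p : 'I_J -> nat -> 'rV[R]_d -> R^o).
Hypotheses (h0 : 0 < h) (Cinv0 : 0 < Cinv) (dt0 : 0 < dt) (nu0 : 0 < nu).
Hypothesis CE : 48 * (d%:R ^+ 2) ^+ 2 * Num.sqrt S * Cinv <= C.
Hypotheses (fXh : fin_dim_subspace Xh) (XhX : Xh `<=` X Omega)
  (inv : inverse_inequality Omega h Cinv Xh)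
  (lf : forall j t, 0 <= t -> L2m Omega (f j t))
  (u012 : forall j, [/\ Xh (u j 0%N), Xh (u j 1%N) & Xh (u j 2%N)])
  (scheme : forall j n, (2 <= n < N)%N -> en_blended_bdf Omega dt nu f Xh Qh u p j n)
  (tstep : forall j n, (2 <= n < N)%N ->
    C * (dt / (nu * h)) * normm (grad (fluct u j n)) ^+ 2 <= 1).

Lemma iterates_Xh j n : (n <= N)%N -> Xh (u j n).
Proof.
have [X0 X1 X2] := u012 j.
case: n => [//|[//|[//|n]]] nN.
by have [] := scheme j (ltac:(by apply/andP; split) : (2 <= n.+2 < N)%N).
Qed.

Lemma extrap_Xh j n : (2 <= n < N)%N -> Xh (extrap (u j) n).
Proof.
move=> /andP[n2 nN].
have x0 := iterates_Xh j (ltnW nN).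
have x1 : Xh (u j n.-1) by apply: iterates_Xh; apply: leq_trans (leq_pred _) (ltnW nN).
have x2 : Xh (u j n.-2).
  by apply: iterates_Xh; apply: leq_trans (leq_pred _) (leq_trans (leq_pred _) (ltnW nN)).
exact: (fin_dimD fXh (fin_dimB fXh (fin_dimZ fXh 3 x0) (fin_dimZ fXh 3 x1)) x2).
Qed.

Lemma fluct_Xh j n : (2 <= n < N)%N -> Xh (fluct u j n).
Proof.
move=> nN; apply: (fin_dimB fXh); first exact: extrap_Xh.
by apply: (fin_dimZ fXh); apply: (fin_dim_sum fXh) => k; exact: extrap_Xh.
Qed.

Lemma energy_step j n : (2 <= n < N)%N ->
  energy Omega (u j n.+1) (u j n) (u j n.-1) +
  24^-1 * normm (u j n.+1 - 3 *: u j n + 3 *: u j n.-1 - u j n.-2) ^+ 2 +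
  dt / 4 * (nu * normm (grad (u j n.+1)) ^+ 2) <=
  energy Omega (u j n) (u j n.-1) (u j n.-2) +
  dt / nu * dual_norm Omega (f j (n.+1%:R * dt)) ^+ 2.
Proof.
move=> nN; have /andP[n2 ltnN] := nN.
have [Xa Qp eqn divfree] := scheme j nN.
set a := u j n.+1; set b := u j n; set c := u j n.-1; set e := u j n.-2.
have Xb : Xh b by exact: iterates_Xh (ltnW ltnN).
have Xc : Xh c by apply: iterates_Xh; apply: leq_trans (leq_pred _) (ltnW ltnN).
have Xe : Xh e.
  by apply: iterates_Xh; apply: leq_trans (leq_pred _) (leq_trans (leq_pred _) (ltnW ltnN)).
have Xw := extrap_Xh j nN; have Xu := fluct_Xh j nN.
(* Delta is the new iterate minus its extrapolation, so the extrapolation in the explicit term of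
   the scheme is the new iterate minus delta. *)
have dE : a - 3 *: b + 3 *: c - e = a - extrap (u j) n.
  by apply/funext => t; apply/rowP => k; rewrite /extrap -/b -/c -/e !mxE; ring.
rewrite dE; set del := a - extrap (u j) n.
have Xdel : Xh del by exact: (fin_dimB fXh).
have wE : extrap (u j) n = a - del by rewrite /del opprB addrC subrK.
have t0 : 0 <= n.+1%:R * dt by rewrite mulr_ge0// ltW.
have id := blended_identity oO bO dt0 (X_L2m (XhX Xa)) (X_L2m (XhX Xb))
  (X_L2m (XhX Xc)) (X_L2m (XhX Xe)).
rewrite -/a -/b -/c -/e dE -/del in id.
have FD := ipm_le_dual_norm oO bO S0 sob (lf j t0) (XhX Xa).
(* The inverse inequality is invoked for [del] alone; [eq_ind] restates the membership of the
   extrapolation for [a - del], the form that [bstar_bound] expects. *)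
have Bb := bstar_bound oO bO S0 sob h0 Cinv0 (XhX Xu) (XhX Xa) (XhX Xdel)
  (eq_ind _ (fun z => X Omega z) (XhX Xw) _ wE) (inv Xdel).
have kE : Num.sqrt (Num.sqrt S * (Cinv / h)) ^+ 2 = Num.sqrt S * (Cinv / h).
  by rewrite sqr_sqrtr// mulr_ge0 ?sqrtr_ge0// divr_ge0// ltW.
rewrite -[dual_norm _ _ ^+ 2]real_normK ?num_real//.
have := eqn a Xa.
(* The new pressure is itself admissible in the discrete incompressibility condition of the new
   velocity. *)
have -> : ip Omega (p j n.+1) (div Omega a) = 0.
  rewrite -(divfree _ Qp); apply: eq_Rintegral => x _; exact: mulrC.
have -> : bstar Omega (ens_mean u n) (u j n.+1) a = 0 by rewrite /bstar subrr.
rewrite addr0 subr0 {1}wE -/a -sqr_normm => eq1.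
exact: (energy_step_algebra dt0 nu0 h0 (normm_ge0 Omega (grad a)) kE CE id eq1 FD Bb (tstep j nN)).
Qed.

Lemma energy_sum j n : (2 <= n <= N)%N ->
  energy Omega (u j n) (u j n.-1) (u j n.-2) +
  24^-1 * \sum_(2 <= k < n)
    normm (u j k.+1 - 3 *: u j k + 3 *: u j k.-1 - u j k.-2) ^+ 2 +
  dt / 4 * \sum_(2 <= k < n) nu * normm (grad (u j k.+1)) ^+ 2 <=
  energy Omega (u j 2) (u j 1) (u j 0) +
  \sum_(2 <= k < n) dt / nu * dual_norm Omega (f j (k.+1%:R * dt)) ^+ 2.
Proof.
elim: n => [//|n IH] /andP[n2 nN].
(* The induction really starts at index 2, where all sums are empty. *)
have [n1|n1] := eqVneq n 1%N.
  by rewrite n1 !big_geq// !mulr0 !addr0.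
have nn : (2 <= n)%N by case: n n1 n2 {IH nN} => [|[|]].
have nN' : (2 <= n < N)%N by rewrite nn.
have := energy_step j nN'; have := IH (ltac:(by rewrite nn ltnW)).
rewrite !big_nat_recr//= !mulrDr => h1 h2.
exact: energy_telescope h1 h2.
Qed.

End energy_estimate.

Theorem theorem1 (R : realType) (d : nat) (hd : d = 2%N \/ d = 3%N)
    (Omega : set 'rV[R]_d) (hOmega : regular_domain Omega)
    (Cinv : R) (hCinv : 0 < Cinv) :
  exists C : R, 0 < C /\
  forall (M : nat) (T : 'I_M -> 'M[R]_(d.+1, d)) (h : R)
    (Xh : set ('rV[R]_d -> 'rV[R]_d)) (Qh : set ('rV[R]_d -> R^o)) (beta : R)
    (J : nat) (dt nu : R) (f : 'I_J -> R -> 'rV[R]_d -> 'rV[R]_d) (N : nat)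
    (u : 'I_J -> nat -> 'rV[R]_d -> 'rV[R]_d)
    (p : 'I_J -> nat -> 'rV[R]_d -> R^o),
  triangulation Omega T -> h = mesh_size T ->
  velocity_fe_space Omega T Xh -> pressure_fe_space Omega T Qh ->
  0 < beta -> inf_sup Omega beta Xh Qh ->
  inverse_inequality Omega h Cinv Xh ->
  (1 <= J)%N -> 0 < dt -> 0 < nu ->
  (forall j t, 0 <= t -> L2m Omega (f j t)) ->
  (2 < N)%N ->
  (forall j, [/\ Xh (u j 0%N), Xh (u j 1%N) & Xh (u j 2%N)]) ->
  (forall j n, (2 <= n < N)%N ->
    en_blended_bdf Omega dt nu f Xh Qh u p j n) ->
  (forall j n, (2 <= n < N)%N ->
    C * (dt / (nu * h)) * normm Omega (grad Omega (fluct u j n)) ^+ 2 <= 1) ->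
  forall j : 'I_J,
    12^-1 * normm Omega (u j N) ^+ 2
    + 12^-1 * normm Omega (3 *: u j N - u j N.-1) ^+ 2
    + 12^-1 * normm Omega (3 *: u j N - 3 *: u j N.-1 + u j N.-2) ^+ 2
    + 24^-1 * \sum_(2 <= n < N) normm Omega
        (u j n.+1 - 3 *: u j n + 3 *: u j n.-1 - u j n.-2) ^+ 2
    + dt / 4 * \sum_(2 <= n < N) nu * normm Omega (grad Omega (u j n.+1)) ^+ 2
    <= \sum_(2 <= n < N)
         dt / nu * dual_norm Omega (f j (n.+1%:R * dt)) ^+ 2
    + 12^-1 * normm Omega (u j 2%N) ^+ 2
    + 12^-1 * normm Omega (3 *: u j 2%N - u j 1%N) ^+ 2
    + 12^-1 * normm Omega (3 *: u j 2%N - 3 *: u j 1%N + u j 0%N) ^+ 2.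
Proof.
have [oO _ neO bO _] := hOmega.
have [S1 [S10 sob1]] := sobolev_test hd oO bO.
have S0 : 0 <= 32 * S1 by rewrite mulr_ge0.
have sob a G := @h10_l6 R d Omega oO bO S1 S10 sob1 a G.
have d0 : (0 < d)%N by case: hd => ->.
(* The factor 32 comes from [h10_l6], [d%:R ^+ 2] counts the pairs of components in [bstar_bound],
   and adding 1 keeps the constant positive even if [S1] is 0. *)
exists (48 * (d%:R ^+ 2) ^+ 2 * Num.sqrt (32 * S1) * Cinv + 1); split.
  apply: ltr_wpDl; last exact: ltr01.
  apply: mulr_ge0; last exact: ltW.
  apply: mulr_ge0; last exact: sqrtr_ge0.
  by apply: mulr_ge0 => //; exact: sqr_ge0.
move=> M T h Xh Qh beta J dt nu f N u p tri hE [fXh XhX _] _ _ _ inv _ dt0 nu0 lf N2 u012 scheme tstep j.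
have h0 : 0 < h by rewrite hE; exact: mesh_size_gt0 tri.
have CE : 48 * (d%:R ^+ 2) ^+ 2 * Num.sqrt (32 * S1) * Cinv <=
    48 * (d%:R ^+ 2) ^+ 2 * Num.sqrt (32 * S1) * Cinv + 1 by rewrite lerDl.
have NN : (2 <= N <= N)%N by rewrite ltnW ?leqnn.
have := energy_sum oO bO S0 sob h0 hCinv dt0 nu0 CE fXh XhX inv lf u012 scheme tstep j NN.
have perm (s x y z : R) : s + x + y + z = x + y + z + s by ring.
by move=> le_N; rewrite [leRHS]perm; exact: le_N.
Qed.
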